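(* Let $n\ge1$ be an integer and $q\in(1,\infty)$. Then the system \[ \mathcal R_n=\{1\}\cup\{\sqrt3\,\mathcal C_{\mathbf k},\ \sqrt3\,\mathcal S_{\mathbf k}:\mathbf k\in\mathbb Z^n,\ \mathbf k\succ0\} \] is a Schauder basis (in the Pringsheim sense) of the real Lebesgue space $L_q((0,1)^n)$.
   Context: Define $\mathcal C(x)=4\left|x-\frac12\right|-1$ and $\mathcal S(x)=\left|2-4\left|x-\frac14\right|\right|-1$ for $x\in[0,1]$, and extend both functions to $\mathbb R$ periodically with period $1$. For $\mathbf k\in\mathbb Z^n\setminus\{0\}$ we write $\mathbf k\succ 0$ if the first non-zero entry of $\mathbf k$ is positive, and put $\mathcal C_{\mathbf k}(x)=\mathcal C(\mathbf k\cdot x)$, $\mathcal S_{\mathbf k}(x)=\mathcal S(\mathbf k\cdot x)$ for $x\in\mathbb R^n$, where $\mathbf k\cdot x=k_1x_1+\dots+k_nx_n$. A system $\{1\}\cup\{u_{\mathbf k},v_{\mathbf k}:\mathbf k\in\mathbb Z^n,\ \mathbf k\succ0\}$ is a Schauder basis of $L_q((0,1)^n)$ in the Pringsheim sense if for every $f\in L_q((0,1)^n)$ there are unique real scalars $\alpha_0$ and $\alpha_{\mathbf k},\beta_{\mathbf k}$ ($\mathbf k\succ0$) such that the rectangular partial sums $\alpha_0+\sum_{\mathbf k\succ0,\ |k_1|\le m_1,\dots,|k_n|\le m_n}(\alpha_{\mathbf k}u_{\mathbf k}+\beta_{\mathbf k}v_{\mathbf k})$ converge to $f$ in $L_q((0,1)^n)$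 as $\min\{m_1,\dots,m_n\}\to\infty$, $\mathbf m\in\mathbb N^n$. *)

(* Defs.v *)
From HB Require Import structures.
From mathcomp Require Import all_boot all_order all_algebra.
From mathcomp Require Import all_classical all_reals all_analysis.

Set Implicit Arguments.
Unset Strict Implicit.
Unset Printing Implicit Defensive.
Import Order.TTheory GRing.Theory Num.Theory.
Import numFieldNormedType.Exports.

Local Open Scope classical_set_scope.
Local Open Scope ring_scope.

(* R^n, with the product of the Borel sigma-algebras *)
Notation Rn R n := (n.-tuple (measurableTypeR R)).

Section tuple_cons.
Context (R : realType) (n : nat).

Definition tcons (p : measurableTypeR R * Rn R n) : Rn R n.+1 :=
  [tuple of p.1 :: p.2].

Definition tuncons (t : Rn R n.+1) : measurableTypeR R * Rn R n :=
  (thead t, [tuple of behead t]).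

Lemma measurable_tcons : measurable_fun [set: _] tcons.
Proof. exact: measurable_cons. Qed.

Lemma measurable_tuncons : measurable_fun [set: _] tuncons.
Proof.
by apply: measurable_fun_pair; [exact: measurable_tnth|exact: measurable_behead].
Qed.

Lemma tconsK : cancel tcons tuncons.
Proof. by case=> x t; congr pair; apply: val_inj. Qed.

Lemma tunconsK : cancel tuncons tcons.
Proof. by move=> t; apply: val_inj; case/tupleP: t => x t. Qed.

End tuple_cons.

Section lebesgue_measure_step.
Local Open Scope ereal_scope.
Context (R : realType) (n : nat).
Variable mu : {sigma_finite_measure set (Rn R n) -> \bar R}.

Definition lebesgue_step : set (Rn R n.+1) -> \bar R :=
  pushforward (@lebesgue_measure R \x mu) (@tcons R n).

Let lebesgue_step0 : lebesgue_step set0 = 0.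
Proof. by rewrite /lebesgue_step /pushforward preimage_set0 measure0. Qed.

Let lebesgue_step_ge0 A : 0 <= lebesgue_step A.
Proof. by rewrite /lebesgue_step /pushforward measure_ge0. Qed.

Let lebesgue_step_sigma_additive : semi_sigma_additive lebesgue_step.
Proof. by apply: measure_semi_sigma_additive => *; exact: measurable_tcons. Qed.

HB.instance Definition _ := isMeasure.Build _ _ _ lebesgue_step
  lebesgue_step0 lebesgue_step_ge0 lebesgue_step_sigma_additive.

Lemma lebesgue_step_sigma_finite : sigma_finite setT lebesgue_step.
Proof.
have /sigma_finiteP[F [TF ndF Foo]] := sigma_finiteT (@lebesgue_measure R).
have /sigma_finiteP[G [TG ndG Goo]] := sigma_finiteT mu.
exists (fun k => @tuncons R n @^-1` (F k `*` G k)).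
  rewrite -preimage_bigcup (_ : \bigcup_k _ = setT) ?preimage_setT//.
  rewrite -setXTT TF TG predeqE => -[x y]; split.
    by move=> [k _ []/= ? ?]; split; exists k.
  move=> [/= [k _ Fkx] [l _ Gly]]; exists (maxn k l) => //; split.
  - by move: x Fkx; exact/subsetPset/ndF/leq_maxl.
  - by move: y Gly; exact/subsetPset/ndG/leq_maxr.
move=> k; have [mF Fk] := Foo k; have [mG Gk] := Goo k; split.
  by rewrite -[X in measurable X]setTI; apply: measurable_tuncons => //;
    exact: measurableX.
rewrite /lebesgue_step /pushforward -comp_preimage.
rewrite (_ : _ \o _ = id); last by apply/funext => x /=; rewrite tconsK.
by rewrite preimage_id product_measure1E// lte_mul_pinfty// ge0_fin_numE.
Qed.

HB.instance Definition _ :=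
  Measure_isSigmaFinite.Build _ _ _ lebesgue_step lebesgue_step_sigma_finite.

End lebesgue_measure_step.

Fixpoint lebesgue_Rn (R : realType) (n : nat) :
    {sigma_finite_measure set (Rn R n) -> \bar R} :=
  match n with
  | 0 => dirac [tuple]
  | n'.+1 => lebesgue_step (lebesgue_Rn R n')
  end.

Lemma measurable_box (R : realType) (n : nat) (A : 'I_n -> set (measurableTypeR R)) :
  (forall i, measurable (A i)) ->
  measurable [set x : Rn R n | forall i, A i (tnth x i)].
Proof.
move=> mA; rewrite (_ : [set x | _] =
    \bigcap_(i in [set: 'I_n]) (@tnth n _ ^~ i @^-1` A i)); last first.
  by apply/seteqP; split => x /= h i; [move=> _; exact: h|exact: (h i Logic.I)].
apply: fin_bigcap_measurable; first exact: finite_finset.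
by move=> i _; rewrite -[X in measurable X]setTI; exact: measurable_tnth.
Qed.

Lemma lebesgue_Rn_box (R : realType) (n : nat)
    (A : 'I_n -> set (measurableTypeR R)) :
  (forall i, measurable (A i)) ->
  lebesgue_Rn R n [set x | forall i, A i (tnth x i)] =
  (\prod_(i < n) lebesgue_measure (A i))%E.
Proof.
elim: n A => [|n IH] A mA.
  by rewrite big_ord0 /= /dirac indicE mem_set// => -[].
rewrite big_ord_recl /= /lebesgue_step /pushforward.
rewrite (_ : _ @^-1` _ =
    A ord0 `*` [set x | forall i, A (lift ord0 i) (tnth x i)]); last first.
  apply/seteqP; split => -[x t] /= => [h|[h0 h] i].
    by split=> [|i]; [have := h ord0|have := h (lift ord0 i); rewrite tnthS].
  by case: (unliftP ord0 i) => [j|] ->; rewrite ?tnthS.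
rewrite product_measure1E//; last first.
  exact: (@measurable_box R n (fun i => A (lift ord0 i))).
by congr (_ * _)%E; exact: (IH (fun i => A (lift ord0 i))).
Qed.

Definition open_cube (R : realType) (n : nat) : set (Rn R n) :=
  [set x | forall i, tnth x i \in `]0, 1[].

Lemma measurable_open_cube (R : realType) (n : nat) :
  measurable (@open_cube R n).
Proof. by apply: (@measurable_box R n (fun=> `]0, 1[%classic)) => i. Qed.

(* L_q((0,1)^n) is formed with respect to this measure: functions on R^n, up to
   equality a.e. on the cube. *)
Definition cube_measure (R : realType) (n : nat) :
    {measure set (Rn R n) -> \bar R} :=
  mrestr (lebesgue_Rn R n) (@measurable_open_cube R n).

(* k > 0 : the first non-zero entry of k is positive; false for k = 0 *)
Definition lex_pos (n : nat) (k : n.-tuple int) : bool :=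
  0 < head 0 [seq j <- k | j != 0].

Definition posZ (n : nat) := {k : n.-tuple int | lex_pos k}.

Definition dotZ (R : realType) (n : nat) (k : n.-tuple int) (x : Rn R n) : R :=
  \sum_(i < n) (tnth k i)%:~R * tnth x i.

Definition periodize (R : realType) (g : R -> R) (x : R) : R :=
  g (x - (Num.floor x)%:~R).

Definition Ctri (R : realType) : R -> R :=
  periodize (fun x => 4 * `|x - 1 / 2| - 1).

Definition Stri (R : realType) : R -> R :=
  periodize (fun x => `|2 - 4 * `|x - 1 / 4| | - 1).

Definition Ck (R : realType) (n : nat) (k : posZ n) (x : Rn R n) : R :=
  Ctri (dotZ (val k) x).

Definition Sk (R : realType) (n : nat) (k : posZ n) (x : Rn R n) : R :=
  Stri (dotZ (val k) x).

Definition rect (n : nat) (m : n.-tuple nat) : set (posZ n) :=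
  [set k | forall i, (absz (tnth (val k) i) <= tnth m i)%N].

(* so that the sums over [rect m] below are genuine finite sums *)
Lemma finite_rect (n : nat) (m : n.-tuple nat) : finite_set (rect m).
Proof.
pose N := (\max_(i < n) tnth m i)%N.
pose g (p : {ffun 'I_n -> 'I_N.+1 * bool}) : n.-tuple int :=
  [tuple (-1) ^+ (p i).2 * ((p i).1 : nat)%:Z | i < n].
have fin : finite_set (g @` setT) by apply: finite_image; exact: finite_finset.
apply: (@sub_finite_set _ _ (val @^-1` (g @` setT))); last first.
  by apply: finite_preimage fin => x y _ _; exact: val_inj.
move=> k /= km.
have kN i : (absz (tnth (val k) i) < N.+1)%N.
  by rewrite ltnS (leq_trans (km i))// (leq_bigmax i).
exists [ffun i => (Ordinal (kN i), tnth (val k) i < 0)] => //.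
apply: eq_from_tnth => i; rewrite tnth_mktuple ffunE /=.
by rewrite -intEsign.
Qed.

(* m -> oo in N^n in the sense that min(m_1, ..., m_n) -> oo *)
Definition pringsheim (n : nat) : set_system (n.-tuple nat) :=
  filter_from setT (fun N => [set m | forall i, (N <= tnth m i)%N]).

#[global] Instance pringsheim_proper_filter (n : nat) :
  ProperFilter (@pringsheim n).
Proof.
apply: filter_from_proper => [|N _]; last first.
  by exists [tuple N | _ < n] => i; rewrite tnth_mktuple.
apply: filter_from_filter; first by exists 0%N.
move=> N M _ _; exists (maxn N M) => // m h.
by split => i; have := h i; rewrite geq_max => /andP[].
Qed.

Definition rect_sum (R : realType) (n : nat) (u v : posZ n -> Rn R n -> R)
    (c : R * (posZ n -> R) * (posZ n -> R)) (m : n.-tuple nat) (x : Rn R n) : R :=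
  let: (a0, a, b) := c in
  a0 + \sum_(k \in rect m) (a k * u k x + b k * v k x).

(* {1} together with the u_k, v_k is a Schauder basis of L_q((0,1)^n) in the
   Pringsheim sense *)
Definition pringsheim_schauder_basis (R : realType) (n : nat) (q : R)
    (u v : posZ n -> Rn R n -> R) : Prop :=
  [/\ forall k, u k \in Lfun (cube_measure R n) q%:E,
      forall k, v k \in Lfun (cube_measure R n) q%:E &
      forall f, f \in Lfun (cube_measure R n) q%:E ->
        exists! c : R * (posZ n -> R) * (posZ n -> R),
          'N[cube_measure R n]_q%:E[EFin \o (f \- rect_sum u v c m)%R]%E
            @[m --> @pringsheim n] --> 0%E].

(* Main.v *)
Require Import Defs.
From mathcomp Require Import all_boot all_order all_algebra.
From mathcomp Require Import all_classical all_reals all_analysis.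
From mathcomp Require Import measurable_realfun ring lra zify.

Set Implicit Arguments.
Unset Strict Implicit.
Unset Printing Implicit Defensive.
Import Order.TTheory GRing.Theory Num.Theory.
Import numFieldNormedType.Exports.

Local Open Scope classical_set_scope.
Local Open Scope ring_scope.

(* Since C(y) = gam * sum_{j = 1 mod 4} j^-2 cos(2 pi j y) with gam = 8/pi^2, and
   S(y) = C(y - 1/4) is the same series with sines, the operator
   T f(x) = sum_{j = 1 mod 4} j^-2 f(j x) maps the trigonometric system to gam^-1
   times the triangular one.  Each dilation f |-> f(j .) preserves the L_q norm of a
   trigonometric polynomial and sum_{j <> 1} j^-2 <= 1/4, so |T f - f| <= |f|/4: the
   basis property is transferred from the trigonometric system to the triangular one.

   For the trigonometric system the rectangular partial sums are uniformly bounded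
   by M. Riesz's theorem, applied one variable at a time.  The bound for the
   conjugate function v of u rests on the subharmonicity, in a half-plane, of
   C (u^2 + e^2)^a - (u^2 + v^2 + e^2)^a for q = 2a <= 2, and, with
   h = u^2 + v^2 + e^2, of h^(a-1) (2 a^2 (u^2 + e^2) - h) for q >= 2: their
   mean over a period at depth s <= 0 is convex and bounded above, hence monotone.
   Trigonometric polynomials are dense by Fejer approximation of indicators of
   boxes and a Dynkin-class argument. *)

(** * Periodic harmonic functions and the conjugate function *)

(** The operator [T] acts diagonally: it sends each cosine or sine to a multiple of the triangular
    function of the same index, so it commutes with truncation to a rectangle. No inverse of [T] is
    built: [|T f - f| <= |f|/4] already makes the two norms comparable on finite sums, and density
    follows by iterating the contraction. The class 1 modulo 4 is chosen because [cos(2 pi j (y -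
    1/4)) = cos(2 pi j y - pi/2)] for such [j], so that one [T] serves C and S together.

    The truncation to [|k| <= m] is a combination of two conjugate functions of modulated
    polynomials, which is how a bound uniform in [m] comes out of the conjugate function inequality.
    In that inequality the positive summand [e] keeps the powers smooth at common zeros of [u] and
    [v]. Conjugation removes the constant term, so [v] decays with depth; at great depth the
    subharmonic function is therefore nonnegative, and monotonicity of its mean carries this sign up
    to the boundary. Both ranges of [q] are treated directly, without duality. *)

Section mean.
Variable R : realType.
Implicit Types f g : R -> R.

Definition mean f : R := \int[@lebesgue_measure R]_(x in `[0, 1]) f x.

Lemma continuous_integrable01 f : continuous f ->
  (@lebesgue_measure R).-integrable `[0, 1] (EFin \o f).
Proof.
move=> cf; apply: continuous_compact_integrable; first exact: segment_compact.
exact: continuous_subspaceT.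
Qed.

Lemma cont_cst (c : R) : continuous (fun _ : R => c).
Proof. by move=> x; exact: cvg_cst. Qed.

Lemma cont_add f g : continuous f -> continuous g -> continuous (fun x => f x + g x).
Proof. by move=> cf cg x; apply: cvgD; [exact: cf|exact: cg]. Qed.

Lemma cont_mul f g : continuous f -> continuous g -> continuous (fun x => f x * g x).
Proof. by move=> cf cg x; apply: cvgM; [exact: cf|exact: cg]. Qed.

Lemma cont_comp f g : continuous f -> continuous g -> continuous (fun x => g (f x)).
Proof. by move=> cf cg x; apply: continuous_comp; [exact: cf|exact: cg]. Qed.

Lemma meanD f g : continuous f -> continuous g ->
  mean (fun x => f x + g x) = mean f + mean g.
Proof. by move=> cf cg; rewrite /mean RintegralD//; exact: continuous_integrable01. Qed.

Lemma meanZ c f : continuous f -> mean (fun x => c * f x) = c * mean f.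
Proof. by move=> cf; rewrite /mean RintegralZl//; exact: continuous_integrable01. Qed.

Lemma mean_cst c : mean (fun=> c) = c.
Proof.
rewrite /mean Rintegral_cst//.
by have /= -> := @lebesgue_measure_itv R `[0, 1]; rewrite lte01 sube0/= mulr1.
Qed.

Lemma le_mean f g : continuous f -> continuous g -> (forall x, f x <= g x) ->
  mean f <= mean g.
Proof. by move=> cf cg fg; apply: le_Rintegral => //; exact: continuous_integrable01. Qed.

Lemma mean_ge0 f : (forall x, 0 <= f x) -> 0 <= mean f.
Proof. by move=> f0; exact: Rintegral_ge0. Qed.

Lemma eq_mean f g : f =1 g -> mean f = mean g.
Proof. by move=> /funext ->. Qed.

Lemma mean_derive (f F : R -> R) : continuous f ->
  (forall x : R, is_derive x 1 F (f x)) -> mean f = F 1 - F 0.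
Proof.
move=> cf dF.
have dF' x : derivable F x 1 by have [] := dF x.
have cF : continuous F by move=> x; apply/differentiable_continuous/derivable1_diffP.
rewrite /mean /Rintegral (@continuous_FTC2 _ f F)//.
- exact: continuous_subspaceT.
- split; [by move=> x _| |].
    by apply: cvg_at_right_filter; exact: cF.
  by apply: cvg_at_left_filter; exact: cF.
- by move=> x _; rewrite derive1E; have [] := dF x.
Qed.

End mean.

(** * Functions of two variables with explicit second derivatives *)

Section jets.
Variable R : realType.
Implicit Types f g : R -> R -> R.

Definition jcont f := continuous (fun p : R * R => f p.1 p.2).

(** The pure second derivatives are those that enter the Laplacian [fss + fxx]. They are explicit
    arguments so that the closure rules below compute them; joint continuity serves differentiation
    under the integral over a period. *)
Record is_jet (f fs fss fx fxx : R -> R -> R) : Prop := IsJet {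
  jet_s : forall s x : R, is_derive s 1 (f ^~ x) (fs s x);
  jet_ss : forall s x : R, is_derive s 1 (fs ^~ x) (fss s x);
  jet_x : forall s x : R, is_derive x 1 (f s) (fx s x);
  jet_xx : forall s x : R, is_derive x 1 (fx s) (fxx s x);
  jet_c : jcont f; jet_cs : jcont fs; jet_css : jcont fss;
  jet_cx : jcont fx; jet_cxx : jcont fxx }.

Lemma jcontD f g : jcont f -> jcont g -> jcont (fun s x => f s x + g s x).
Proof. by move=> cf cg p; apply: continuousD; [exact: cf|exact: cg]. Qed.

Lemma jcontM f g : jcont f -> jcont g -> jcont (fun s x => f s x * g s x).
Proof. by move=> cf cg p; apply: continuousM; [exact: cf|exact: cg]. Qed.

Lemma jcont_cst c : jcont (fun _ _ => c).
Proof. by move=> p; exact: cvg_cst. Qed.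

Lemma jcont_comp (h : R -> R) f : (forall s x, {for f s x, continuous h}) ->
  jcont f -> jcont (fun s x => h (f s x)).
Proof. by move=> ch cf p; apply: continuous_comp; [exact: cf|exact: ch]. Qed.

Lemma jcont_slice f s : jcont f -> continuous (f s).
Proof.
move=> cf x; apply: (@continuous_comp _ _ _ (fun x => (s, x)) (fun p => f p.1 p.2)).
  exact: (@cvg_pair _ _ _ _ _ _ _ _ _ (fun=> s) id (cvg_cst s) cvg_id).
exact: cf.
Qed.

Lemma is_jet_cst c :
  is_jet (fun _ _ => c) (fun _ _ => 0) (fun _ _ => 0) (fun _ _ => 0) (fun _ _ => 0).
Proof. by split=> *; (try exact: is_derive_cst); exact: jcont_cst. Qed.

Lemma is_jetD f fs fss fx fxx g gs gss gx gxx :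
  is_jet f fs fss fx fxx -> is_jet g gs gss gx gxx ->
  is_jet (fun s x => f s x + g s x) (fun s x => fs s x + gs s x)
    (fun s x => fss s x + gss s x) (fun s x => fx s x + gx s x)
    (fun s x => fxx s x + gxx s x).
Proof.
move=> [f1 f2 f3 f4 f5 f6 f7 f8 f9] [g1 g2 g3 g4 g5 g6 g7 g8 g9].
by split=> *; (try exact: is_deriveD); exact: jcontD.
Qed.

Lemma is_derive1M (f g : R -> R) (x a b : R) : is_derive x 1 f a -> is_derive x 1 g b ->
  is_derive x 1 (fun x => f x * g x) (a * g x + f x * b).
Proof.
move=> fa gb; apply: is_derive_eq (is_deriveM fa gb) _.
by rewrite /GRing.scale /= addrC [g x * a]mulrC.
Qed.

Lemma is_derive1D (f g : R -> R) (x a b : R) : is_derive x 1 f a -> is_derive x 1 g b ->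
  is_derive x 1 (fun x => f x + g x) (a + b).
Proof. by move=> fa gb; exact: is_deriveD. Qed.

Lemma is_jetM f fs fss fx fxx g gs gss gx gxx :
  is_jet f fs fss fx fxx -> is_jet g gs gss gx gxx ->
  is_jet (fun s x => f s x * g s x)
    (fun s x => fs s x * g s x + f s x * gs s x)
    (fun s x => (fss s x * g s x + fs s x * gs s x) +
                (fs s x * gs s x + f s x * gss s x))
    (fun s x => fx s x * g s x + f s x * gx s x)
    (fun s x => (fxx s x * g s x + fx s x * gx s x) +
                (fx s x * gx s x + f s x * gxx s x)).
Proof.
move=> [f1 f2 f3 f4 f5 f6 f7 f8 f9] [g1 g2 g3 g4 g5 g6 g7 g8 g9].
split=> *; (try (repeat (apply: jcontD || apply: jcontM) => //)).
- exact: is_derive1M.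
- by apply: is_derive1D; exact: is_derive1M.
- exact: is_derive1M.
- by apply: is_derive1D; exact: is_derive1M.
Qed.

(** Real powers are smooth only away from 0, which is why a positive [e] is added to the sums of
    squares below. *)
Lemma is_jet_powR (a : R) (h hs hss hx hxx : R -> R -> R) : (forall s x : R, 0 < h s x) ->
  is_jet h hs hss hx hxx ->
  is_jet (fun s x => h s x `^ a)
    (fun s x => a * h s x `^ (a - 1) * hs s x)
    (fun s x => a * (a - 1) * h s x `^ (a - 2) * hs s x * hs s x
                + a * h s x `^ (a - 1) * hss s x)
    (fun s x => a * h s x `^ (a - 1) * hx s x)
    (fun s x => a * (a - 1) * h s x `^ (a - 2) * hx s x * hx s x
                + a * h s x `^ (a - 1) * hxx s x).
Proof.
move=> h0 [f1 f2 f3 f4 f5 f6 f7 f8 f9].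
have dp (b y : R) : 0 < y -> is_derive y 1 (@powR R ^~ b) (b * y `^ (b - 1)).
  by move=> y0; exact: is_derive1_powR.
have cp b : jcont (fun s x => h s x `^ b).
  apply: (@jcont_comp (@powR R ^~ b)) => // s x.
  apply/differentiable_continuous/derivable1_diffP.
  by have [] := dp b _ (h0 s x).
have d1 (b : R) (k : R -> R) (x k' : R) : 0 < k x -> is_derive x 1 k k' ->
    is_derive x 1 (fun x => k x `^ b) (b * k x `^ (b - 1) * k').
  by move=> kx dk; apply: is_derive_eq; first exact: (is_derive1_comp (dp b _ kx) dk);
    rewrite mulrC.
have d2 (b : R) (k l : R -> R) (x k' l' : R) : 0 < k x -> is_derive x 1 k k' ->
    l x = k' -> is_derive x 1 l l' -> 
    is_derive x 1 (fun x => b * k x `^ (b - 1) * l x)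
      (b * (b - 1) * k x `^ (b - 2) * k' * l x + b * k x `^ (b - 1) * l').
  move=> kx dk lx dl; apply: is_derive_eq.
    exact: (is_derive1M (is_derive1M (is_derive_cst b x 1) (d1 (b - 1) _ _ _ kx dk)) dl).
  by rewrite lx mul0r add0r -addrA -opprD !mulrA.
split=> *.
- exact: d1.
- exact: d2.
- exact: d1.
- exact: d2.
- exact: cp.
all: repeat (apply: jcontD || apply: jcontM || apply: jcont_cst || apply: cp) => //.
Qed.

End jets.

(** * Means of subharmonic functions over a period *)

Section subharmonic.
Variable R : realType.
Implicit Types f g : R -> R -> R.

Lemma jcont_bounded f (a b : R) : jcont f ->
  exists M : R, forall s x : R, s \in `[a, b] -> x \in `[0, 1] -> `|f s x| <= M.
Proof.
move=> cf.
have cK : compact (`[a, b]%classic `*` `[0%R, 1%R]%classic : set (R * R)).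
  by apply: compact_setX; exact: segment_compact.
have : compact ((fun p : R * R => f p.1 p.2) @` (`[a, b]%classic `*` `[0%R, 1%R]%classic)).
  by apply: continuous_compact => //; exact: continuous_subspaceT.
move=> /compact_bounded[M [_ /(_ (M + 1))]].
rewrite ltrDl ltr01 => /(_ isT) HM.
by exists (M + 1) => s x sab x01; apply: HM; exists (s, x).
Qed.

(** Differentiation under the integral sign: for [t] within distance 1 of [s], compactness bounds
    the derivative by a constant, which is the dominating function. *)
Lemma is_derive_mean f fs : (forall s x : R, is_derive s 1 (f ^~ x) (fs s x)) ->
  jcont f -> jcont fs ->
  forall s : R, is_derive s 1 (fun s => mean (f s)) (mean (fs s)).
Proof.
move=> df cf cfs s.
have [M HM] := jcont_bounded (s - 1) (s + 1) cfs.
have Is : `]s - 1, s + 1[%classic s.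
  by rewrite /= in_itv /= ltrDl ltr01 ltrBlDr ltrDl ltr01.
have int1 (t : R) : `]s - 1, s + 1[%classic t ->
    (@lebesgue_measure R).-integrable `[0, 1] (EFin \o f t).
  by move=> _; apply: continuous_integrable01; exact: jcont_slice.
have der (t x : R) : `]s - 1, s + 1[%classic t -> `[0, 1]%classic x -> derivable (f ^~ x) t 1.
  by move=> _ _; have [] := df t x.
have M0 (x : R) : 0 <= `|M| by [].
have intM : (@lebesgue_measure R).-integrable `[0, 1] (EFin \o (fun=> `|M|)).
  by apply: continuous_integrable01 => x; exact: cvg_cst.
have ub (t x : R) : `]s - 1, s + 1[%classic t -> `[0, 1]%classic x ->
    `|partial1of2 f t x| <= `|M|.
  move=> /= ts x01; rewrite partial1of2E.
  have [_ ->] := df t x.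
  apply: (le_trans _ (ler_norm M)); apply: HM => //.
  by move: ts; rewrite !in_itv /= => /andP[/ltW -> /ltW ->].
have m01 : measurable (`[0, 1]%classic : set (measurableTypeR R)) by [].
apply: DeriveDef.
  exact: (derivable_under_integral m01 Is int1 der M0 intM ub).
rewrite -derive1E.
rewrite (differentiation_under_integral m01 Is int1 der M0 intM ub).
by apply: eq_mean => x; rewrite partial1of2E; have [_ ->] := df s x.
Qed.

Lemma MVT1 (f df : R -> R) (a b : R) : (forall x : R, is_derive x 1 f (df x)) -> a <= b ->
  exists2 c, a <= c <= b & f b - f a = df c * (b - a).
Proof.
move=> fdf ab; have cf : {within `[a, b], continuous f}.
  by apply: derivable_within_continuous => x _; have [] := fdf x.
have [c] := @MVT_segment R f df a b ab (fun x _ => fdf x) cf.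
by rewrite in_itv /= => cab E; exists c.
Qed.

(* [J s = mean (W s)] satisfies [J'' = mean (Wss + Wxx) >= 0], and a convex
   function bounded above near [-oo] is nondecreasing. *)
Lemma subharmonic_mean_ge0 (W Ws Wss Wx Wxx : R -> R -> R) (B s0 : R) :
  is_jet W Ws Wss Wx Wxx ->
  (forall s, Wx s 0 = Wx s 1) ->
  (forall s x, 0 <= Wss s x + Wxx s x) ->
  (forall s x, s <= 0 -> W s x <= B) ->
  (forall s x, s <= s0 -> 0 <= W s x) ->
  0 <= mean (W 0).
Proof.
move=> jW per sub WB W0.
have J1 := is_derive_mean (jet_s jW) (jet_c jW) (jet_cs jW).
have J2 := is_derive_mean (jet_ss jW) (jet_cs jW) (jet_css jW).
have J2ge0 s : 0 <= mean (Wss s).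
  have -> : mean (Wss s) = mean (fun x => Wss s x + Wxx s x).
    rewrite meanD; [|exact/jcont_slice/(jet_css jW)|exact/jcont_slice/(jet_cxx jW)].
    rewrite (mean_derive (jcont_slice (jet_cxx jW)) (jet_xx jW s)).
    by rewrite per subrr addr0.
  exact: mean_ge0.
have J1nd s t : s <= t -> mean (Ws s) <= mean (Ws t).
  move=> st; have [c _ E] := MVT1 J2 st.
  by rewrite -subr_ge0 E mulr_ge0 // subr_ge0.
have JB s : s <= 0 -> mean (W s) <= B.
  move=> s_le0; rewrite -[leRHS]mean_cst; apply: le_mean.
  - exact/jcont_slice/(jet_c jW).
  - by move=> ?; exact: cvg_cst.
  - by move=> x; exact: WB.
have J0 s : s <= s0 -> 0 <= mean (W s).
  by move=> ss0; apply: mean_ge0 => x; exact: W0.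
rewrite leNgt; apply/negP => Jneg.
pose s1 := Num.min s0 (-1).
have s1s0 : s1 <= s0 by rewrite ge_min lexx.
have s1_lt0 : s1 < 0 by rewrite gt_min ltrN10 orbT.
have [c /andP[s1c c0] E] := MVT1 J1 (ltW s1_lt0).
set d := - mean (Ws c).
have d0 : 0 < d.
  rewrite oppr_gt0 -(pmulr_llt0 _ (_ : 0 < 0 - s1)) ?sub0r ?oppr_gt0 //.
  move: E; rewrite sub0r => <-.
  by rewrite subr_lt0; apply: lt_le_trans Jneg _; exact: J0.
(* To the left of [s1] the slope is at most [- d], so over the distance [(|B| + 1) / d] the mean
   climbs by at least [|B| + 1]; being nonnegative at [s1], it exceeds [B] at [s]. *)
pose s := s1 - (`|B| + 1) / d.
have s_s1 : s <= s1.
  by rewrite /s gerBl divr_ge0 ?(ltW d0) // addr_ge0.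
have [c' /andP[sc' c's1] E'] := MVT1 J1 s_s1.
have : mean (W s) <= B by apply: JB; exact: le_trans s_s1 (ltW s1_lt0).
have Ec : mean (W s1) - mean (W s) <= - (`|B| + 1).
  have -> : - (`|B| + 1) = - d * (s1 - s).
    by rewrite /s opprB addrCA subrr addr0 mulNr mulrCA divff ?mulr1 ?gt_eqF.
  rewrite E' ler_wpM2r ?subr_ge0 // /d opprK; apply: J1nd.
  exact: le_trans c's1 s1c.
have := J0 _ s1s0.
have := ler_norm B.
by move: Ec; move: (`|B|) => b; lra.
Qed.

End subharmonic.

(** * Trigonometric polynomials in one variable and their harmonic extensions *)

Section trig1.
Variable R : realType.
Implicit Types (L : seq (R * int * R)) (t : R * int * R) (x s : R).

Definition freq (k : int) : R := 2 * pi * k%:~R.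

(** A triple [(A, k, d)] is the wave [A cos(2 pi k x + d)]. With a free phase, derivatives,
    conjugates, dilates and products with a cosine or a sine are again lists of waves, without
    complex numbers; repeated and negative frequencies are allowed. *)
Definition trig1 L x : R := \sum_(t <- L) t.1.1 * cos (freq t.1.2 * x + t.2).

(** The Poisson extension of [trig1 L] to the half-plane [s <= 0], with boundary [s = 0]. Terms of
    nonzero frequency die out as [s] tends to minus infinity. *)
Definition harm L s x : R :=
  \sum_(t <- L) t.1.1 * expR (`|freq t.1.2| * s) * cos (freq t.1.2 * x + t.2).

Definition ds L := [seq (t.1.1 * `|freq t.1.2|, t.1.2, t.2) | t <- L].
Definition dx L := [seq (t.1.1 * freq t.1.2, t.1.2, t.2 + pi / 2) | t <- L].
(** The conjugate function (periodic Hilbert transform); [sg 0 = 0] deletes the constant terms. *)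
Definition conjl L := [seq (t.1.1 * Num.sg (freq t.1.2), t.1.2, t.2 - pi / 2) | t <- L].

Lemma harm_cons t L : harm (t :: L) =
  fun s x => t.1.1 * expR (`|freq t.1.2| * s) * cos (freq t.1.2 * x + t.2) + harm L s x.
Proof. by apply/funext => s; apply/funext => x; rewrite /harm big_cons. Qed.

Lemma harm_nil : harm [::] = fun _ _ => 0.
Proof. by apply/funext => ?; apply/funext => ?; rewrite /harm big_nil. Qed.

Lemma is_derive1_affine (f : R -> R) (c d x y df : R) : y = c * x + d ->
  is_derive y 1 f df -> is_derive x 1 (fun x => f (c * x + d)) (df * c).
Proof.
move=> -> df'.
have dg : is_derive x 1 (fun x => c * x + d) c.
  have hc (b : R) : is_derive x 1 (fun=> b) 0 by exact: is_derive_cst.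
  have hi : is_derive x 1 (fun x : R => x) 1 by exact: is_derive_id.
  apply: is_derive_eq (is_derive1D (is_derive1M (hc c) hi) (hc d)) _.
  by rewrite mul0r add0r mulr1 addr0.
exact: (@is_derive1_comp R f (fun x => c * x + d) x df c df' dg).
Qed.

Lemma is_derive_expRM (c s : R) :
  is_derive s 1 (fun s => expR (c * s)) (expR (c * s) * c).
Proof.
have -> : (fun s => expR (c * s)) = (fun s => expR (c * s + 0)).
  by apply/funext => y; rewrite addr0.
apply: (@is_derive1_affine expR c 0 s (c * s)).
by rewrite addr0.
Qed.

Lemma is_derive_cosM (c d x : R) :
  is_derive x 1 (fun x => cos (c * x + d)) (cos (c * x + (d + pi / 2)) * c).
Proof.
rewrite addrA cosDpihalf.
exact: (@is_derive1_affine cos c d x (c * x + d)).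
Qed.

Lemma is_derive1Z (f : R -> R) (x a c : R) : is_derive x 1 f a ->
  is_derive x 1 (fun x => c * f x) (c * a).
Proof.
move=> fa; have hc : is_derive x 1 (fun=> c) 0 by exact: is_derive_cst.
apply: is_derive_eq (is_derive1M hc fa) _.
by rewrite mul0r add0r.
Qed.

Lemma is_derive1Zr (f : R -> R) (x a c : R) : is_derive x 1 f a ->
  is_derive x 1 (fun x => f x * c) (a * c).
Proof.
move=> fa; have hc : is_derive x 1 (fun=> c) 0 by exact: is_derive_cst.
apply: is_derive_eq (is_derive1M fa hc) _.
by rewrite mulr0 addr0.
Qed.

Lemma jcont_harm L : jcont (harm L).
Proof.
elim: L => [|t L IH].
  by rewrite harm_nil; exact: jcont_cst.
rewrite harm_cons; apply: jcontD => //; apply: jcontM.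
- apply: jcontM; first exact: jcont_cst.
  apply: (@jcont_comp _ expR (fun s x => `|freq t.1.2| * s)).
    by move=> s x; exact: continuous_expR.
  by apply: jcontM; [exact: jcont_cst|move=> p; exact: cvg_fst].
- apply: (@jcont_comp _ cos (fun s x => freq t.1.2 * x + t.2)).
    by move=> s x; exact: continuous_cos.
  apply: jcontD; last exact: jcont_cst.
  by apply: jcontM; [exact: jcont_cst|move=> p; exact: cvg_snd].
Qed.

Lemma derive_harm_s L s x : is_derive s 1 (harm L ^~ x) (harm (ds L) s x).
Proof.
elim: L => [|t L IH].
  by rewrite /= harm_nil; exact: is_derive_cst.
rewrite /= !harm_cons /=; apply: is_derive1D => //.
apply: is_derive1Zr; rewrite -!mulrA.
apply: (@is_derive1Z (fun s => expR (`|freq t.1.2| * s))); rewrite mulrC.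
exact: is_derive_expRM.
Qed.

Lemma derive_harm_x L s x : is_derive x 1 (harm L s) (harm (dx L) s x).
Proof.
elim: L => [|t L IH].
  by rewrite /= harm_nil; exact: is_derive_cst.
rewrite /= !harm_cons /=; apply: is_derive1D => //.
rewrite [_ * freq _ * _]mulrAC -[_ * freq _ * _]mulrA [freq _ * cos _]mulrC.
apply: (@is_derive1Z (fun x => cos (freq t.1.2 * x + t.2))).
exact: is_derive_cosM.
Qed.

Lemma is_jet_harm L :
  is_jet (harm L) (harm (ds L)) (harm (ds (ds L))) (harm (dx L)) (harm (dx (dx L))).
Proof.
split; try (move=> s x; (exact: derive_harm_s || exact: derive_harm_x)).
all: exact: jcont_harm.
Qed.

(** Harmonicity: two quarter-period shifts of the phase produce the minus sign, and both sides carry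
    the squared frequency. *)
Lemma harm_dxx L s x : harm (dx (dx L)) s x = - harm (ds (ds L)) s x.
Proof.
rewrite /harm !big_map -sumrN; apply: eq_bigr => t _ /=.
rewrite !addrA !cosDpihalf sinD cos_pihalf sin_pihalf mulr0 mulr1 add0r.
have E : `|freq t.1.2| * `|freq t.1.2| = freq t.1.2 * freq t.1.2.
  by rewrite -expr2 real_normK // num_real.
by rewrite -(mulrA _ `|freq _| `|freq _|) E !mulrA; ring.
Qed.

(** This and the next lemma are the Cauchy-Riemann equations for the pair [harm L],
    [harm (conjl L)]; they rest on [sg f * |f| = f] and [sg f * f = |f|]. *)
Lemma harm_ds_conj L s x : harm (ds (conjl L)) s x = - harm (dx L) s x.
Proof.
rewrite /harm !big_map -sumrN; apply: eq_bigr => t _ /=.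
rewrite !addrA cosDpihalf cosBpihalf.
by rewrite -(mulrA t.1.1 (Num.sg _)) -numEsg mulrN opprK.
Qed.

Lemma harm_dx_conj L s x : harm (dx (conjl L)) s x = harm (ds L) s x.
Proof.
rewrite /harm !big_map; apply: eq_bigr => t _ /=.
rewrite subrK -(mulrA t.1.1 (Num.sg _)); congr (_ * _ * _ * _).
by rewrite normrEsg.
Qed.

Lemma harm0 L : harm L 0 = trig1 L.
Proof.
apply/funext => x; rewrite /harm /trig1; apply: eq_bigr => t _.
by rewrite mulr0 expR0 mulr1.
Qed.

Lemma cosDfreq k d : cos (d + freq k) = cos d.
Proof.
have -> : freq k = (pi *+ 2) *~ k :> R by rewrite -[RHS]mulrzr -mulr_natl.
case: k => k; first by rewrite -pmulrn (periodicn (@cosD2pi R)).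
rewrite NegzE mulrNz -pmulrn -[in RHS](subrK ((pi *+ 2) *+ k.+1) d).
by rewrite (periodicn (@cosD2pi R)).
Qed.

Lemma cos_freq1 k (d : R) : cos (freq k * 1 + d) = cos (freq k * 0 + d).
Proof. by rewrite mulr1 mulr0 add0r addrC cosDfreq. Qed.

Lemma harm_per L s : harm L s 0 = harm L s 1.
Proof. by rewrite /harm; apply: eq_bigr => t _; rewrite cos_freq1. Qed.

Definition sumamp L : R := \sum_(t <- L) `|t.1.1|.

Lemma sumamp_ge0 L : 0 <= sumamp L.
Proof. by apply: sumr_ge0 => *. Qed.

Lemma harm_le L s x : s <= 0 -> `|harm L s x| <= sumamp L.
Proof.
move=> s0; apply: (le_trans (ler_norm_sum _ _ _)); apply: ler_sum => t _.
rewrite !normrM -mulrA ler_piMr // mulr_ile1 //.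
- by rewrite ger0_norm ?expR_ge0 // -expR0 ler_expR mulr_ge0_le0.
- by rewrite ler_norml cos_geN1 cos_le1.
Qed.

Lemma freq_ge1 k : k != 0 -> 1 <= `|freq k|.
Proof.
move=> k0; rewrite /freq normrM -intr_norm.
have k1 : (1 : R) <= `|k|%:~R by rewrite ler1z -gtz0_ge1 normr_gt0.
have p1 : 1 <= `|2 * pi : R|.
  rewrite ger0_norm ?mulr_ge0 ?pi_ge0 //.
  by have := @pi_ge2 R; lra.
by rewrite -[leLHS]mulr1 ler_pM.
Qed.

(** A frequency that survives conjugation has absolute value at least 1, whence the decay like
    [expR s]. *)
Lemma harm_conj_le L s x : s <= 0 -> `|harm (conjl L) s x| <= sumamp L * expR s.
Proof.
move=> s0; apply: (le_trans (ler_norm_sum _ _ _)); rewrite big_map mulr_suml.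
apply: ler_sum => t _ /=.
have [->|k0] := eqVneq t.1.2 0.
  by rewrite /freq mulr0z mulr0 sgr0 mulr0 !mul0r normr0 mulr_ge0 ?expR_ge0.
have := freq_ge1 k0; move: (freq t.1.2) => f f1.
rewrite !normrM -!mulrA ler_wpM2l //.
apply: (@le_trans _ _ (1 * (expR s * 1))); last by rewrite mul1r mulr1.
apply: ler_pM => //; first by rewrite normr_sg lern1 leq_b1.
apply: ler_pM => //; last by rewrite ler_norml cos_geN1 cos_le1.
rewrite ger0_norm ?expR_ge0 // ler_expR.
nra.
Qed.

Lemma harm_conj_small L (e : R) : 0 < e ->
  exists s0, forall s x, s <= s0 -> `|harm (conjl L) s x| <= e.
Proof.
move=> e0; have M0 : 0 < sumamp L + 1 by rewrite ltr_wpDl // sumamp_ge0.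
exists (Num.min 0 (ln (e / (sumamp L + 1)))) => s x.
rewrite le_min => /andP[s0 sl]; apply: (le_trans (harm_conj_le _ _ s0)).
have E : expR s <= e / (sumamp L + 1) by rewrite -ler_expR lnK ?posrE ?divr_gt0 // in sl.
rewrite ler_pdivlMr // in E.
apply: le_trans E; rewrite mulrC ler_wpM2l ?expR_ge0 //.
by rewrite lerDl.
Qed.

End trig1.

(** * Energy inequalities for the conjugate function *)

Section conj_bound.
Variable R : realType.
Implicit Types (L : seq (R * int * R)).

Lemma continuous_trig1 L : continuous (trig1 L).
Proof. by rewrite -harm0; exact/jcont_slice/jcont_harm. Qed.

Lemma continuous_powR_comp (f : R -> R) (a : R) : continuous f -> (forall x, 0 < f x) ->
  continuous (fun x => f x `^ a).
Proof.
move=> cf f0 x.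
apply: (@continuous_comp _ _ _ f (fun y => y `^ a)); first exact: cf.
apply/differentiable_continuous/derivable1_diffP.
by have [] := is_derive1_powR a (f0 x).
Qed.

Lemma powR_le2 (a x y : R) : a <= 0 -> 0 < x -> x <= y -> y `^ a <= x `^ a.
Proof.
move=> a0 x0 xy; have y0 : 0 < y by exact: lt_le_trans xy.
rewrite -[a]opprK !(powRN _ (- a)) lef_pV2 ?posrE ?powR_gt0 //.
by apply: ge0_ler_powR => //; rewrite ?oppr_ge0 ?nnegrE //; exact: ltW.
Qed.

Lemma powR_pred (a x : R) : 0 < x -> x `^ (a - 1) = x * x `^ (a - 2).
Proof.
move=> x0; rewrite (_ : a - 1 = 1 + (a - 2)); last by ring.
rewrite [LHS]powRD; last by rewrite (gt_eqF x0) implybT.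
by rewrite powRr1 // ltW.
Qed.

(** The bounded expression is the Laplacian of [C h1^a - h2^a] with [h1 = u^2 + e] and
    [h2 = u^2 + v^2 + e]. Here [p1], [p2] are the powers [a - 1], [a - 2] of [h1], [q1], [q2] those
    of [h2], [D] is the squared gradient of [u], and [4 z] that of [h2]. The term in [z] has the
    right sign for [a <= 1]; the remaining negative term [4 a D q1] is absorbed since
    [C (4 a - 2) = 4] and [q1 <= p1]. *)
Lemma laplacian_le1 (a C e u D z p1 p2 q1 q2 : R) :
  1 / 2 < a -> a <= 1 -> 0 <= C -> C * (4 * a - 2) = 4 -> 0 < e -> 0 <= D -> 0 <= z ->
  p1 = (u * u + e) * p2 -> 0 < p2 -> 0 < q2 -> q1 <= p1 ->
  0 <= C * a * D * (4 * (a - 1) * p2 * (u * u) + 2 * p1)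
     - a * (4 * (a - 1) * q2 * z + 4 * D * q1).
Proof.
move=> a12 a1 C0 Ca e0 D0 z0 P1 P2 Q2 QP.
have B1 : (a - 1) * p1 <= (a - 1) * p2 * (u * u).
  have : 0 <= (1 - a) * (e * p2) by apply: mulr_ge0; [lra|apply: mulr_ge0; exact: ltW].
  by rewrite P1; lra.
have CaD : 0 <= C * a * D by apply: mulr_ge0 => //; apply: mulr_ge0; lra.
have B3 : C * a * D * ((4 * a - 2) * p1) <=
   C * a * D * (4 * (a - 1) * p2 * (u * u) + 2 * p1).
  by apply: ler_wpM2l => //; lra.
have B4 : C * a * D * ((4 * a - 2) * p1) = 4 * a * D * p1.
  by rewrite (_ : 4 * a * D * p1 = (C * (4 * a - 2)) * a * D * p1); [ring|rewrite Ca].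
have B5 : a * D * q1 <= a * D * p1 by apply: ler_wpM2l => //; apply: mulr_ge0; lra.
have B6 : 0 <= a * ((1 - a) * q2 * z).
  apply: mulr_ge0; first lra.
  by apply: mulr_ge0 => //; apply: mulr_ge0; [lra|exact: ltW].
move: B3; rewrite B4; lra.
Qed.

Lemma conj_energy_le1 (a : R) : 1 / 2 < a -> a <= 1 ->
  exists2 K, 0 <= K & forall L (e : R), 0 < e ->
  mean (fun x => (trig1 L x * trig1 L x + trig1 (conjl L) x * trig1 (conjl L) x + e) `^ a) <=
  K * mean (fun x => (trig1 L x * trig1 L x + e) `^ a).
Proof.
move=> a12 a1; pose C := 2 / (2 * a - 1).
have C2 : 2 <= C by rewrite /C ler_pdivlMr; lra.
have Ca : C * (4 * a - 2) = 4.
  by rewrite /C; field; apply/eqP; lra.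
have C0 : 0 <= C by lra.
exists C => // L e e0.
have ju := is_jet_harm L; have jv := is_jet_harm (conjl L).
set u := harm L in ju *; set v := harm (conjl L) in jv *.
have je := is_jet_cst e.
have h1_gt0 s x : 0 < u s x * u s x + e by rewrite ltr_wpDl // -expr2 sqr_ge0.
have h2_gt0 s x : 0 < u s x * u s x + v s x * v s x + e.
  by rewrite ltr_wpDl // addr_ge0 // -expr2 sqr_ge0.
have j1 := is_jet_powR a h1_gt0 (is_jetD (is_jetM ju ju) je).
have j2 := is_jet_powR a h2_gt0 (is_jetD (is_jetD (is_jetM ju ju) (is_jetM jv jv)) je).
have jW := is_jetD (is_jetM (is_jet_cst C) j1) (is_jetM (is_jet_cst (-1)) j2).
(* The parameter [e] enters the energies unsquared, so [v] is made smaller than its square root. *)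
have [s0 vsmall] := @harm_conj_small R L (Num.sqrt e) (eqbRL (sqrtr_gt0 e) e0).
have := subharmonic_mean_ge0 (B := C * (sumamp L * sumamp L + e) `^ a) (s0 := s0) jW.
have eW : mean (fun x => C * (u 0 x * u 0 x + e) `^ a +
     -1 * (u 0 x * u 0 x + v 0 x * v 0 x + e) `^ a) = 
   C * mean (fun x => (trig1 L x * trig1 L x + e) `^ a) -
   mean (fun x => (trig1 L x * trig1 L x + trig1 (conjl L) x * trig1 (conjl L) x + e) `^ a).
  have c1 : continuous (fun x => (u 0 x * u 0 x + e) `^ a) by exact: jcont_slice (jet_c j1).
  have c2 : continuous (fun x => (u 0 x * u 0 x + v 0 x * v 0 x + e) `^ a).
    exact: jcont_slice (jet_c j2).
  rewrite meanD; first by rewrite !meanZ // mulN1r -!harm0.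
  - exact: (@jcont_slice _ _ 0 (jet_c (is_jetM (is_jet_cst C) j1))).
  - exact: (@jcont_slice _ _ 0 (jet_c (is_jetM (is_jet_cst (-1)) j2))).
rewrite eW subr_ge0; apply.
- by move=> s; rewrite /u /v !(harm_per _ s).
- move=> s x.
  have E1 : harm (dx (dx L)) s x = - harm (ds (ds L)) s x by rewrite harm_dxx.
  have E2 : harm (dx (dx (conjl L))) s x = - harm (ds (ds (conjl L))) s x by rewrite harm_dxx.
  have E3 : harm (ds (conjl L)) s x = - harm (dx L) s x by rewrite harm_ds_conj.
  have E4 : harm (dx (conjl L)) s x = harm (ds L) s x by rewrite harm_dx_conj.
  rewrite E1 E2 E3 E4.
  have := h1_gt0 s x; have := h2_gt0 s x.
  set h1 := u s x * u s x + e; set h2 := u s x * u s x + v s x * v s x + e => h2_0 h1_0.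
  have P1 := powR_pred a h1_0.
  have P2 : 0 < h1 `^ (a - 2) by rewrite powR_gt0.
  have Q2 : 0 < h2 `^ (a - 2) by rewrite powR_gt0.
  have QP : h2 `^ (a - 1) <= h1 `^ (a - 1).
    apply: powR_le2 => //; first by rewrite subr_le0.
    by rewrite lerD2r lerDl -expr2 sqr_ge0.
  set D := harm (ds L) s x * harm (ds L) s x + harm (dx L) s x * harm (dx L) s x.
  have D0 : 0 <= D by apply: addr_ge0; rewrite -expr2 sqr_ge0.
  set z := (u s x * harm (ds L) s x - v s x * harm (dx L) s x) ^+ 2 +
    (u s x * harm (dx L) s x + v s x * harm (ds L) s x) ^+ 2.
  have z0 : 0 <= z by apply: addr_ge0; rewrite sqr_ge0.
  rewrite [X in 0 <= X](_ : _ =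
    C * a * D * (4 * (a - 1) * h1 `^ (a - 2) * (u s x * u s x) + 2 * h1 `^ (a - 1))
     - a * (4 * (a - 1) * h2 `^ (a - 2) * z + 4 * D * h2 `^ (a - 1))).
    exact: (laplacian_le1 a12 a1 C0 Ca e0 D0 z0 P1 P2 Q2 QP).
  by rewrite /z /D; ring.
- move=> s x s_le0.
  have H := harm_le L x s_le0.
  have : (u s x * u s x + e) `^ a <= (sumamp L * sumamp L + e) `^ a.
    apply: ge0_ler_powR; rewrite ?nnegrE; [lra|exact: ltW| |].
      by rewrite addr_ge0 ?(ltW e0) // -expr2 sqr_ge0.
    rewrite lerD2r; apply: (@le_trans _ _ (`|u s x| * `|u s x|)); last by rewrite ler_pM.
    by rewrite -normrM ler_norm.
  have : 0 <= (u s x * u s x + v s x * v s x + e) `^ a by rewrite powR_ge0.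
  move: (_ `^ a) (_ `^ a) (_ `^ a) => A1 A2 A3; clear -C2 => H1 H2; nra.
- move=> s x ss0.
  have H := vsmall s x ss0.
  have H' : v s x * v s x <= e.
    rewrite -[leRHS]sqr_sqrtr ?(ltW e0) // expr2.
    apply: (@le_trans _ _ (`|v s x| * `|v s x|)); last by rewrite ler_pM.
    by rewrite -normrM ler_norm.
  (* From [v^2 <= e] one gets [h2 <= 2 h1], hence [h2^a <= 2^a h1^a <= C h1^a]. *)
  have H1 : (u s x * u s x + v s x * v s x + e) `^ a <= (2 * (u s x * u s x + e)) `^ a.
    apply: ge0_ler_powR; rewrite ?nnegrE; [lra|exact: ltW| |].
      by rewrite mulr_ge0 // ltW.
    by move: (u s x) (v s x) H'; clear -e0 => u0 v0 H'; nra.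
  rewrite powRM // in H1; last exact: ltW.
  have H2 : 2 `^ a <= 2 :> R.
    by rewrite -[leRHS]powRr1 // ler_powR //; lra.
  move: H1; have := powR_ge0 (u s x * u s x + e) a.
  move: (_ `^ a) H2 (_ `^ a) (_ `^ a) => A1 H2 A2 A3; clear -C2 H2 => H3 H4; nra.
Qed.

Lemma powR_predE (a x : R) : 0 < x -> x `^ a = x * x `^ (a - 1).
Proof.
move=> x0; have := powR_pred (a + 1) x0.
by rewrite addrK (_ : a + 1 - 2 = a - 1) //; ring.
Qed.

(** The Laplacian of [h^b (B (u^2 + e) - h)], where [r = u^2 + v^2], [h = r + e], [H = h^(b - 2)]
    and [D] is the squared gradient of [u]. By Cauchy-Riemann the gradients of [u] and [v] are
    orthogonal and that of [h] has square [4 r D]. With [B = 2 (b + 1)^2] the negative terms cancel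
    exactly and a sum of nonnegative ones remains. *)
Lemma laplacian_ge1 (b B e D H u r : R) : 0 <= b -> B = 2 * (b + 1) * (b + 1) -> 0 < e ->
  0 <= D -> 0 < H -> 0 <= r -> 
  0 <= D * (4 * b * H * (b * r + e) * (B * (u * u + e) - (r + e))
            + 2 * b * (r + e) * H * (4 * B * (u * u) - 4 * r)
            + (r + e) * (r + e) * H * (2 * B - 4)).
Proof.
move=> b0 BE e0 D0 H0 r0; apply: mulr_ge0 => //.
have uu0 : 0 <= u * u by rewrite -expr2 sqr_ge0.
have B0 : 0 <= B by rewrite BE; apply: mulr_ge0; [apply: mulr_ge0|]; lra.
rewrite [X in 0 <= X](_ : _ = H * (4 * b * (b * r + e) * (B * (u * u + e))
   + 8 * b * (r + e) * (B * (u * u)) + (r + e) * ((4 * (b * b) + 4 * b) * e))).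
  move: (u * u) uu0 (ltW H0) (ltW e0) => U U0 H0' e0'.
  by rewrite !(mulr_ge0, addr_ge0).
by rewrite BE; ring.
Qed.

(** Separates [h] from [X]. If [h <= 2 B X], then [h^(a - 1) B X] is at most [(2 B X)^a]; otherwise
    [B X <= h / 2] and the left side is already at most [- h^a / 2]. *)
Lemma young_powR (a B h X : R) : 1 <= a -> 1 <= B -> 0 < h -> 0 < X ->
  h `^ (a - 1) * (B * X - h) <= (2 * B) `^ a * X `^ a - 1 / 2 * h `^ a.
Proof.
move=> a1 B1 h0 X0; have BX0 : 0 < 2 * B * X by rewrite !mulr_gt0 //; lra.
rewrite -powRM; [|lra|exact: ltW].
rewrite !(powR_predE a) //.
have hb := powR_gt0 (a - 1) h0; have Xb := powR_gt0 (a - 1) BX0.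
have [hX|/ltW Xh] := lerP h (2 * B * X).
  have : h `^ (a - 1) <= (2 * B * X) `^ (a - 1).
    by apply: ge0_ler_powR; rewrite ?nnegrE; [lra|exact: ltW|exact: ltW|].
  move: (_ `^ _) hb ((_ * _) `^ _) Xb => p p0 q q0 pq.
  have BX : 0 < B * X by apply: mulr_gt0 => //; lra.
  have : p * (B * X) <= q * (B * X) by rewrite ler_wpM2r // ltW.
  have := mulr_gt0 q0 BX; have := mulr_gt0 p0 h0; clear; lra.
move: (_ `^ _) hb ((_ * _) `^ _) Xb => p p0 q q0.
have : p * (2 * B * X) <= p * h by rewrite ler_wpM2l // ltW.
have := mulr_gt0 BX0 q0; clear; lra.
Qed.

Lemma conj_energy_ge1 (a : R) : 1 <= a ->
  exists2 K, 0 <= K & forall L (e : R), 0 < e ->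
  mean (fun x => (trig1 L x * trig1 L x + trig1 (conjl L) x * trig1 (conjl L) x + e) `^ a) <=
  K * mean (fun x => (trig1 L x * trig1 L x + e) `^ a).
Proof.
move=> a1; pose b := a - 1; pose B := 2 * (b + 1) * (b + 1).
have b0 : 0 <= b by rewrite /b; lra.
have B2 : 2 <= B by rewrite /B; clear -b0; nra.
(* The factor 2 compensates the [1 / 2] in front of [h^a] in [young_powR]. *)
exists (2 * (2 * B) `^ a) => [|L e e0]; first by rewrite mulr_ge0 // powR_ge0.
have ju := is_jet_harm L; have jv := is_jet_harm (conjl L).
set u := harm L in ju *; set v := harm (conjl L) in jv *.
have je := is_jet_cst e.
have h1_gt0 s x : 0 < u s x * u s x + e by rewrite ltr_wpDl // -expr2 sqr_ge0.
have h2_gt0 s x : 0 < u s x * u s x + v s x * v s x + e.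
  by rewrite ltr_wpDl // addr_ge0 // -expr2 sqr_ge0.
have j1 := is_jet_powR a h1_gt0 (is_jetD (is_jetM ju ju) je).
have jh := is_jetD (is_jetD (is_jetM ju ju) (is_jetM jv jv)) je.
have j2 := is_jet_powR a h2_gt0 jh.
have jg := is_jetD (is_jetM (is_jet_cst B) (is_jetD (is_jetM ju ju) je))
  (is_jetM (is_jet_cst (-1)) jh).
have jW := is_jetM (is_jet_powR b h2_gt0 jh) jg.
have [s0 vsmall] := @harm_conj_small R L (Num.sqrt e) (eqbRL (sqrtr_gt0 e) e0).
set M := sumamp L.
have := subharmonic_mean_ge0 (B := (M * M + M * M + e) `^ b * (B * (M * M + e)))
  (s0 := s0) jW.
have W0 : mean (fun x => (u 0 x * u 0 x + v 0 x * v 0 x + e) `^ b *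
   (B * (u 0 x * u 0 x + e) + -1 * (u 0 x * u 0 x + v 0 x * v 0 x + e))) <=
   (2 * B) `^ a * mean (fun x => (trig1 L x * trig1 L x + e) `^ a) +
   (- (1 / 2)) *
   mean (fun x => (trig1 L x * trig1 L x + trig1 (conjl L) x * trig1 (conjl L) x + e) `^ a).
  have c1 : continuous (fun x => (u 0 x * u 0 x + e) `^ a) by exact: jcont_slice (jet_c j1).
  have c2 : continuous (fun x => (u 0 x * u 0 x + v 0 x * v 0 x + e) `^ a).
    exact: jcont_slice (jet_c j2).
  have j3 := is_jetM (is_jet_cst ((2 * B) `^ a)) j1.
  have j4 := is_jetM (is_jet_cst (- (1 / 2))) j2.
  rewrite -!harm0 -[X in X + _]meanZ // -[X in _ + X]meanZ // -meanD.
  - apply: le_mean.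
    + exact: jcont_slice (jet_c jW).
    + exact: jcont_slice (jet_c (is_jetD j3 j4)).
    + move=> x; rewrite mulN1r mulNr; apply: young_powR => //; clear -B2; lra.
  - exact: (@jcont_slice _ _ 0 (jet_c j3)).
  - exact: (@jcont_slice _ _ 0 (jet_c j4)).
move: W0; set w := mean _ => W0 H.
suff w0 : 0 <= w by move: (le_trans w0 W0); clear; lra.
apply: H.
- by move=> s; rewrite /u /v !(harm_per _ s).
- move=> s x.
  have E1 : harm (dx (dx L)) s x = - harm (ds (ds L)) s x by rewrite harm_dxx.
  have E2 : harm (dx (dx (conjl L))) s x = - harm (ds (ds (conjl L))) s x by rewrite harm_dxx.
  have E3 : harm (ds (conjl L)) s x = - harm (dx L) s x by rewrite harm_ds_conj.
  have E4 : harm (dx (conjl L)) s x = harm (ds L) s x by rewrite harm_dx_conj.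
  rewrite E1 E2 E3 E4.
  have h0 := h2_gt0 s x.
  rewrite (powR_predE b h0) (powR_pred b h0).
  set H := (_ `^ (b - 2)).
  have H0 : 0 < H by rewrite powR_gt0.
  set r := u s x * u s x + v s x * v s x.
  have r0 : 0 <= r by apply: addr_ge0; rewrite -expr2 sqr_ge0.
  set D := harm (ds L) s x * harm (ds L) s x + harm (dx L) s x * harm (dx L) s x.
  have D0 : 0 <= D by apply: addr_ge0; rewrite -expr2 sqr_ge0.
  have := laplacian_ge1 (u s x) b0 (erefl B) e0 D0 H0 r0.
  congr (_ <= _); move: H {H0}; rewrite /r /D; clear.
  move: (u s x) (v s x) (harm (ds L) s x) (harm (dx L) s x) => ? ? ? ? H.
  by ring.
- move=> s x s_le0.
  have Hu := harm_le L x s_le0.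
  have Hv : `|v s x| <= M.
    apply: le_trans (harm_conj_le _ _ s_le0) _.
    by rewrite ler_piMr ?sumamp_ge0 // -expR0 ler_expR.
  have sq (y : R) : `|y| <= M -> y * y <= M * M.
    move=> yM; apply: (@le_trans _ _ (`|y| * `|y|)); last by rewrite ler_pM.
    by rewrite -normrM ler_norm.
  apply: (@le_trans _ _ ((u s x * u s x + v s x * v s x + e) `^ b * (B * (u s x * u s x + e)))).
    by rewrite ler_wpM2l ?powR_ge0 // mulN1r gerBl ltW.
  apply: ler_pM; rewrite ?powR_ge0 //.
  + by apply: mulr_ge0; [lra|exact: ltW].
  + apply: ge0_ler_powR; [exact: b0|by rewrite nnegrE ltW| |].
      by rewrite nnegrE !addr_ge0 // -?expr2 ?sqr_ge0 // ltW.
    by rewrite lerD2r lerD // sq.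
  + by rewrite ler_wpM2l //; [lra|rewrite lerD2r sq].
- move=> s x ss0.
  have H := vsmall s x ss0.
  have H' : v s x * v s x <= e.
    rewrite -[leRHS]sqr_sqrtr ?(ltW e0) // expr2.
    apply: (@le_trans _ _ (`|v s x| * `|v s x|)); last by rewrite ler_pM.
    by rewrite -normrM ler_norm.
  (* [B >= 2] and [v^2 <= e] give [B (u^2 + e) >= u^2 + v^2 + e]. *)
  rewrite mulr_ge0 ?powR_ge0 //.
  have : 0 <= u s x * u s x by rewrite -expr2 sqr_ge0.
  move: (u s x * u s x) (v s x * v s x) H' => U V; clear -B2 e0 => H' U0; nra.
Qed.

End conj_bound.

(** * The conjugate function inequality of M. Riesz *)

Section conj_bound.
Variable R : realType.
Implicit Types (L : seq (R * int * R)).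

Lemma continuous_norm_powR (p : R) : 0 < p -> continuous (fun y : R => `|y| `^ p).
Proof.
move=> p0 y; have [->|y0] := eqVneq y 0.
  apply/cvgrPdist_lt => e e0; near=> z.
  rewrite normr0 powR0 ?gt_eqF // sub0r normrN ger0_norm ?powR_ge0 //.
  rewrite -[ltRHS]powRr1 ?ltW // -(mulVf (lt0r_neq0 p0)) powRrM.
  apply: gt0_ltr_powR => //; rewrite ?nnegrE ?powR_ge0 //.
  near: z; exists (e `^ p^-1) => /=; first by rewrite powR_gt0.
  by move=> z /=; rewrite sub0r normrN.
apply: (@continuous_comp _ _ _ (fun y : R => `|y|) (fun y => y `^ p)).
  exact: norm_continuous.
apply/differentiable_continuous/derivable1_diffP.
have y1 : 0 < `|y| by rewrite normr_gt0.
by have [] := is_derive1_powR p y1.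
Unshelve. all: end_near. Qed.

Lemma powRD_le (a x y : R) : 0 <= a -> 0 <= x -> 0 <= y ->
  (x + y) `^ a <= 2 `^ a * x `^ a + 2 `^ a * y `^ a.
Proof.
move=> a0; wlog xy : x y / x <= y => [H x0 y0|x0 y0].
  have [xy|/ltW yx] := lerP x y; first exact: H.
  by rewrite addrC [leRHS]addrC; exact: H.
rewrite -!powRM // -[leLHS]add0r lerD ?powR_ge0 //.
by apply: ge0_ler_powR; rewrite ?nnegrE ?addr_ge0 ?mulr_ge0 //; lra.
Qed.

(** The energy inequalities with [a = p / 2], freed of [e]: [|v|^p] is below the left energy, the
    right one is at most [2^a |u|^p + 2^a e^a], and [e] is taken so small that its contribution is
    below any given [d]. *)
Lemma conj_bound (p : R) : 1 < p ->
  exists2 K, 0 <= K & forall L,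
  mean (fun x => `|trig1 (conjl L) x| `^ p) <= K * mean (fun x => `|trig1 L x| `^ p).
Proof.
move=> p1; pose a := p / 2.
have a0 : 0 < a by rewrite /a; lra.
have [K K0 HK] : exists2 K, 0 <= K & forall L (e : R), 0 < e ->
  mean (fun x => (trig1 L x * trig1 L x + trig1 (conjl L) x * trig1 (conjl L) x + e) `^ a) <=
  K * mean (fun x => (trig1 L x * trig1 L x + e) `^ a).
  have [a1|/ltW a1] := lerP a 1; last exact: conj_energy_ge1.
  by apply: conj_energy_le1 => //; rewrite /a; lra.
have sqE (y : R) : `|y| `^ p = (y * y) `^ a.
  rewrite -expr2 -real_normK ?num_real // -powR_mulrn // -powRrM.
  by congr (_ `^ _); rewrite /a; field.
have cp (f : R -> R) : continuous f -> continuous (fun x => `|f x| `^ p).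
  by move=> cf x; apply: (@continuous_comp _ _ _ f (fun y => `|y| `^ p));
    [exact: cf|apply: continuous_norm_powR; lra].
exists (K * 2 `^ a) => [|L]; first by rewrite mulr_ge0 // powR_ge0.
set f := trig1 L; set g := trig1 (conjl L).
have cf : continuous (fun x => `|f x| `^ p) by apply: cp; exact: continuous_trig1.
have cg : continuous (fun x => `|g x| `^ p) by apply: cp; exact: continuous_trig1.
apply/ler_addgt0Pr => d d0; set c := K * 2 `^ a.
have c0 : 0 <= c by rewrite mulr_ge0 // powR_ge0.
have [e e0 ed] : exists2 e, 0 < e & c * e `^ a <= d.
  exists ((d / (c + 1)) `^ a^-1); first by rewrite powR_gt0 // divr_gt0 // ltr_wpDl.
  rewrite -powRrM mulVf ?gt_eqF // powRr1 ?divr_ge0 ?addr_ge0 ?(ltW d0) //.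
  by rewrite mulrCA ler_piMr ?(ltW d0) // ler_pdivrMr ?mul1r ?lerDl // ltr_wpDl.
have cF : continuous (fun x => (f x * f x + e) `^ a).
  have j := is_jetD (is_jetM (is_jet_harm L) (is_jet_harm L)) (is_jet_cst e).
  rewrite /f -harm0; apply: continuous_powR_comp; first exact: jcont_slice (jet_c j).
  by move=> x; rewrite ltr_wpDl // -expr2 sqr_ge0.
have cG : continuous (fun x => (f x * f x + g x * g x + e) `^ a).
  have j := is_jetD (is_jetD (is_jetM (is_jet_harm L) (is_jet_harm L))
    (is_jetM (is_jet_harm (conjl L)) (is_jet_harm (conjl L)))) (is_jet_cst e).
  rewrite /f /g -!harm0; apply: continuous_powR_comp; first exact: jcont_slice (jet_c j).
  by move=> x; rewrite ltr_wpDl // addr_ge0 // -expr2 sqr_ge0.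
have le1 : mean (fun x => `|g x| `^ p) <= mean (fun x => (f x * f x + g x * g x + e) `^ a).
  apply: le_mean => // x; rewrite sqE; apply: ge0_ler_powR; first exact: ltW.
  - by rewrite nnegrE -expr2 sqr_ge0.
  - by rewrite nnegrE !addr_ge0 // -?expr2 ?sqr_ge0 // ltW.
  - by rewrite addrAC lerDr addr_ge0 // -?expr2 ?sqr_ge0 // ltW.
have cS : continuous (fun x => 2 `^ a * `|f x| `^ p).
  by apply: cont_mul => //; exact: cont_cst.
have cC : continuous (fun x : R => 2 `^ a * e `^ a) by exact: cont_cst.
have le2 : mean (fun x => (f x * f x + e) `^ a) <=
    2 `^ a * mean (fun x => `|f x| `^ p) + 2 `^ a * e `^ a.
  rewrite -[X in _ + X]mean_cst -meanZ // -meanD //.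
  apply: le_mean => //.
    exact: cont_add.
  move=> x; rewrite sqE; apply: powRD_le; [exact: ltW| |exact: ltW].
  by rewrite -expr2 sqr_ge0.
apply: le_trans le1 _; apply: le_trans (HK L e e0) _.
apply: (@le_trans _ _ (K * (2 `^ a * mean (fun x => `|f x| `^ p) + 2 `^ a * e `^ a))).
  by rewrite ler_wpM2l.
by rewrite mulrDr !mulrA lerD2l.
Qed.

End conj_bound.

(** * Integer dilations of periodic functions *)

Section dilation.
Variable R : realType.
Implicit Types (L : seq (R * int * R)).

(** The primitive is the integral from [- N], hence the restriction to a bounded interval. *)
Lemma local_primitive (g : R -> R) (N : R) : continuous g ->
  exists F : R -> R, forall x, -N < x -> x < N -> is_derive x 1 F (g x).
Proof.
move=> cg.
exists (fun x => \int[@lebesgue_measure R]_(t in `[- N, x]) g t) => x Nx xN.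
have [] := @continuous_FTC1_closed R g (- N) x N xN _ Nx (cg x).
  apply: continuous_compact_integrable; first exact: segment_compact.
  exact: continuous_subspaceT.
by move=> dF <-; rewrite derive1E; apply: DeriveDef.
Qed.

Lemma mean_derive_loc (f F : R -> R) : continuous f ->
  (forall x : R, -1 < x -> x < 2 -> is_derive x 1 F (f x)) -> mean f = F 1 - F 0.
Proof.
move=> cf dF.
have dF' (x : R) : -1 < x -> x < 2 -> derivable F x 1 by move=> ? ?; have [] := dF x.
have cF (x : R) : -1 < x -> x < 2 -> {for x, continuous F}.
  by move=> x0 x1; apply/differentiable_continuous/derivable1_diffP/dF'.
rewrite /mean /Rintegral (@continuous_FTC2 _ f F)//.
- exact: continuous_subspaceT.
- split.
  + move=> x; rewrite in_itv /= => /andP[x0 x1]; apply: dF'; lra.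
  + by apply: cvg_at_right_filter; apply: cF; lra.
  + by apply: cvg_at_left_filter; apply: cF; lra.
- move=> x; rewrite in_itv /= => /andP[x0 x1]; rewrite derive1E.
  by have [||_ ->] := dF x; [lra|lra|].
Qed.

(** For a primitive [F] of [g], periodicity gives [F (c + 1) - F c = mean g] on unit intervals, so
    [F j - F 0 = j * mean g]; and [F (j x) / j] is a primitive of the dilate. *)
Lemma mean_dilate (g : R -> R) (j : int) : continuous g -> j != 0 ->
  (forall (i : int) t, g (t + i%:~R) = g t) ->
  mean (fun x => g (j%:~R * x)) = mean g.
Proof.
(* Large enough for [j x] and for [x + c] with [x] between -1 and 2, the range on which
   [mean_derive_loc] asks for a derivative. *)
move=> cg j0 per; pose N : R := 2 * `|j|%:~R + 2.
have j1 : (1 : R) <= `|j|%:~R by rewrite ler1z -gtz0_ge1 normr_gt0.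
have [F dF] := local_primitive N cg.
have step (c : int) : - `|j|%:~R <= c%:~R :> R -> c%:~R <= `|j|%:~R - 1 :> R ->
    F (c + 1)%:~R - F c%:~R = mean g.
  move=> c0 c1.
  rewrite -(_ : mean (fun t => g (1 * t + c%:~R)) = mean g); last first.
    by apply: eq_mean => t; rewrite mul1r per.
  have -> : F (c + 1)%:~R - F c%:~R = F (1 * 1 + c%:~R) - F (1 * 0 + c%:~R).
    by rewrite mulr1 mulr0 add0r intrD addrC [1 + _]addrC addrC.
  apply/esym; apply: (@mean_derive_loc _ (fun t => F (1 * t + c%:~R))).
    apply: (@cont_comp _ (fun t : R => 1 * t + c%:~R) g) => //.
    by apply: cont_add; [apply: cont_mul; [exact: cont_cst|move=> x; exact: cvg_id]|exact: cont_cst].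
  move=> x x0 x2; rewrite -[g _]mulr1.
  apply: is_derive1_affine => //; apply: dF; rewrite /N; lra.
have steps (m : nat) (c : int) : - `|j|%:~R <= c%:~R :> R -> (c + m)%:~R <= `|j|%:~R :> R ->
    F (c + m)%:~R - F c%:~R = m%:R * mean g.
  elim: m => [|m IH] c0; first by rewrite addr0 subrr mul0r.
  rewrite -addn1 PoszD addrA => c1.
  have c2 : (c + m)%:~R <= `|j|%:~R - 1 :> R by move: c1; rewrite intrD; lra.
  have c3 : (0 : R) <= m%:R by [].
  have c4 : - `|j|%:~R <= (c + m)%:~R :> R by rewrite intrD; lra.
  have := step _ c4 c2; have := IH c0.
  rewrite natrD mulrDl mul1r => H1 H2.
  by rewrite -H1 -?H2; [ring|lra].
have jR : (j%:~R : R) != 0 by rewrite intr_eq0.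
have -> : mean (fun x => g (j%:~R * x)) =
    j%:~R^-1 * F (j%:~R * 1 + 0) - j%:~R^-1 * F (j%:~R * 0 + 0).
  apply: (@mean_derive_loc _ (fun x => j%:~R^-1 * F (j%:~R * x + 0))).
    apply: (@cont_comp _ (fun t : R => j%:~R * t) g) => //.
    by apply: cont_mul; [exact: cont_cst|move=> x; exact: cvg_id].
  move=> x x0 x2.
  rewrite -[g _](mulKf jR) [_ * g _]mulrC; apply: is_derive1Z.
  apply: is_derive1_affine => //; rewrite ?addr0 //.
  have : `|j%:~R * x| < N.
    rewrite normrM -intr_norm /N.
    have : `|x| < 2 by rewrite ltr_norml; lra.
    by move: j1; clear; nra.
  by rewrite ltr_norml => /andP[? ?]; apply: dF.
rewrite !mulr0 !addr0 mulr1 -mulrBr.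
suff -> : F j%:~R - F 0 = j%:~R * mean g by rewrite mulKf.
move: j0 step steps => _ _; case: j @N j1 dF jR => m N j1 dF jR steps.
  have := steps m 0; rewrite add0r => -> //.
  by rewrite mulr0z oppr_le0.
(* For negative [j] the unit steps climb from [j] up to 0. *)
have := steps m.+1 (Negz m); rewrite NegzE addNr.
rewrite normrN mulrNz => H.
by rewrite mulNr -H ?opprB.
Qed.

Definition dil1 (j : int) L := [seq (t.1.1, j * t.1.2, t.2) | t <- L].

Lemma freqM (j k : int) : freq R (j * k) = freq R k * j%:~R.
Proof. by rewrite /freq intrM; ring. Qed.

Lemma trig1_dil j L x : trig1 (dil1 j L) x = trig1 L (j%:~R * x).
Proof.
by rewrite /trig1 big_map; apply: eq_bigr => t _ /=; rewrite freqM mulrA.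
Qed.

Lemma trig1_per L (i : int) x : trig1 L (x + i%:~R) = trig1 L x.
Proof.
rewrite /trig1; apply: eq_bigr => t _ /=.
rewrite mulrDr -addrA [freq _ _ * i%:~R + _]addrC addrA -freqM mulrC.
by rewrite cosDfreq mulrC.
Qed.

Lemma mean_dil1 (p : R) j L : 0 < p -> j != 0 ->
  mean (fun x => `|trig1 (dil1 j L) x| `^ p) = mean (fun x => `|trig1 L x| `^ p).
Proof.
move=> p0 j0.
have E : mean (fun x => `|trig1 L (j%:~R * x)| `^ p) = mean (fun x => `|trig1 L x| `^ p).
  apply: (@mean_dilate (fun x => `|trig1 L x| `^ p)) => //; last first.
    by move=> i t; rewrite trig1_per.
  apply: (@cont_comp _ (trig1 L) (fun y => `|y| `^ p)); first exact: continuous_trig1.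
  exact: continuous_norm_powR.
by rewrite -E; apply: eq_mean => x; rewrite trig1_dil.
Qed.

End dilation.

(** * Partial sums in one variable *)

Section partial_sums1.
Variable R : realType.
Implicit Types (L : seq (R * int * R)).

Definition psum1 (m : nat) L := [seq t <- L | (absz t.1.2 <= m)%N].

Definition modcos (M : int) L :=
  [seq (t.1.1 / 2, t.1.2 + M, t.2) | t <- L] ++
  [seq (t.1.1 / 2, t.1.2 - M, t.2) | t <- L].

Definition modsin (M : int) L :=
  [seq (t.1.1 / 2, t.1.2 + M, t.2 - pi / 2) | t <- L] ++
  [seq (- t.1.1 / 2, t.1.2 - M, t.2 - pi / 2) | t <- L].

Lemma freqD (j k : int) : freq R (j + k) = freq R j + freq R k.
Proof. by rewrite /freq intrD mulrDr. Qed.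

Lemma freqN (j : int) : freq R (- j) = - freq R j.
Proof. by rewrite /freq mulrNz mulrN. Qed.

Lemma trig1_modcos M L x : trig1 (modcos M L) x = trig1 L x * cos (freq R M * x).
Proof.
rewrite /trig1 big_cat !big_map /= -big_split mulr_suml; apply: eq_bigr => t _ /=.
rewrite !freqD freqN !(mulrDl (freq R _)) !(mulNr (freq R _)).
rewrite [_ + freq R M * x + t.2]addrAC [_ - freq R M * x + t.2]addrAC.
by rewrite [cos (_ + freq R M * x)]cosD [cos (_ - freq R M * x)]cosB; field.
Qed.

Lemma trig1_modsin M L x : trig1 (modsin M L) x = trig1 L x * sin (freq R M * x).
Proof.
rewrite /trig1 big_cat !big_map /= -big_split mulr_suml; apply: eq_bigr => t _ /=.
rewrite !freqD freqN !addrA !cosBpihalf !(mulrDl (freq R _)) !(mulNr (freq R _)).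
rewrite [_ + freq R M * x + t.2]addrAC [_ - freq R M * x + t.2]addrAC.
by rewrite [sin (_ + freq R M * x)]sinD [sin (_ - freq R M * x)]sinB; field.
Qed.

(** By the addition formulas each wave is multiplied by half the difference of two signs. For
    positive [M] this multiplier is 1 inside the window [|k| < M], 0 outside it, and 1/2 at its two
    ends. *)
Lemma window_conj M L x :
  sin (freq R M * x) * trig1 (conjl (modcos M L)) x -
  cos (freq R M * x) * trig1 (conjl (modsin M L)) x =
  \sum_(t <- L) (Num.sg (freq R (t.1.2 + M)) - Num.sg (freq R (t.1.2 - M))) / 2 *
     (t.1.1 * cos (freq R t.1.2 * x + t.2)).
Proof.
rewrite /trig1 !big_map !big_cat !big_map /= -!big_split !mulr_sumr -sumrB.
apply: eq_bigr => t _ /=.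
rewrite !freqD freqN; set a := Num.sg _; set b := Num.sg _.
rewrite !addrA !cosBpihalf.
have sinBp (y : R) : sin (y - pi / 2) = - cos y.
  by rewrite sinB cos_pihalf sin_pihalf mulr0 mulr1 sub0r.
rewrite !sinBp !(mulrDl (freq R _)) !(mulNr (freq R _)).
rewrite [_ + freq R M * x + t.2]addrAC [_ - freq R M * x + t.2]addrAC.
rewrite !(cosD, sinD, cosN, sinN).
have E := cos2Dsin2 (freq R M * x).
set c := cos (freq R M * x) in E *; set s := sin (freq R M * x) in E *.
set c0 := cos (freq R _ * x); set s0 := sin (freq R _ * x).
set c1 := cos t.2; set s1 := sin t.2.
rewrite [LHS](_ : _ = (c ^+ 2 + s ^+ 2) * ((a - b) / 2 * (t.1.1 * (c0 * c1 - s0 * s1)))).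
  by rewrite E mul1r.
by field.
Qed.

Lemma sg_freq (k : int) : Num.sg (freq R k) = (Num.sg k)%:~R.
Proof.
rewrite /freq sgrM gtr0_sg ?mulr_gt0 ?pi_gt0 // mul1r.
by rewrite intr_sg.
Qed.

(** Dilation by 2 makes all frequencies even, so the odd edge [2 m + 1] is never hit and the value
    1/2 does not occur; [|2 k| < 2 m + 1] means [|k| <= m]. *)
Lemma window_psum1 m L x :
  let M : int := (2 * m + 1)%N in
  sin (freq R M * x) * trig1 (conjl (modcos M (dil1 2 L))) x -
  cos (freq R M * x) * trig1 (conjl (modsin M (dil1 2 L))) x =
  trig1 (psum1 m L) (2 * x).
Proof.
move=> M; rewrite window_conj /trig1 /psum1 big_map big_filter.
rewrite [RHS]big_mkcond /=; apply: eq_bigr => t _ /=.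
rewrite freqM -[freq R _ * _ * x]mulrA.
rewrite !sg_freq; case: ifP => km.
  have -> : Num.sg (2 * t.1.2 + M) = 1 by rewrite /M; apply: gtr0_sg; lia.
  have -> : Num.sg (2 * t.1.2 - M) = -1 by rewrite /M; apply: ltr0_sg; lia.
  by rewrite mulrNz opprK -(natrD R 1 1) divff ?pnatr_eq0 // mul1r mulrA.
have [k0|k0] := ltrP t.1.2 0.
  have -> : Num.sg (2 * t.1.2 + M) = -1 by rewrite /M; apply: ltr0_sg; lia.
  have -> : Num.sg (2 * t.1.2 - M) = -1 by rewrite /M; apply: ltr0_sg; lia.
  by rewrite subrr !mul0r.
have -> : Num.sg (2 * t.1.2 + M) = 1 by rewrite /M; apply: gtr0_sg; lia.
have -> : Num.sg (2 * t.1.2 - M) = 1 by rewrite /M; apply: gtr0_sg; lia.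
by rewrite subrr !mul0r.
Qed.

Lemma mean_le_lin2 (c : R) (F G H : R -> R) :
  continuous F -> continuous G -> continuous H ->
  (forall x, H x <= c * F x + c * G x) -> mean H <= c * mean F + c * mean G.
Proof.
move=> cF cG cH HFG.
have cM (E : R -> R) : continuous E -> continuous (fun x => c * E x).
  by move=> cE; apply: cont_mul => //; exact: cont_cst.
rewrite -!meanZ // -meanD; [|exact: cM|exact: cM].
by apply: le_mean => //; apply: cont_add; exact: cM.
Qed.

(** Dilating by 2 changes neither norm, and multiplying by a sine or cosine, before or after
    conjugation, increases none. What is left are two conjugate functions. *)
Lemma psum1_bound (p : R) : 1 < p ->
  exists2 K, 0 <= K & forall m L,
  mean (fun x => `|trig1 (psum1 m L) x| `^ p) <= K * mean (fun x => `|trig1 L x| `^ p).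
Proof.
move=> p1; have [K K0 HK] := conj_bound p1.
have p0 : 0 < p by lra.
have cp L : continuous (fun x => `|trig1 L x| `^ p).
  apply: (@cont_comp _ (trig1 L) (fun y => `|y| `^ p)); first exact: continuous_trig1.
  exact: continuous_norm_powR.
exists (2 `^ p * K + 2 `^ p * K) => [|m L].
  by rewrite addr_ge0 // mulr_ge0 // powR_ge0.
pose M : int := (2 * m + 1)%N.
set L2 := dil1 2 L.
rewrite -(@mean_dil1 _ p 2 (psum1 m L)) // -(@mean_dil1 _ p 2 L) // -/L2.
have mono L1 (c : R -> R) : trig1 L1 =1 (fun x => trig1 L2 x * c x) ->
    (forall x, `|c x| <= 1) ->
    mean (fun x => `|trig1 L1 x| `^ p) <= mean (fun x => `|trig1 L2 x| `^ p).
  move=> E c1; apply: le_mean => // x.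
  apply: ge0_ler_powR; rewrite ?nnegrE //; first exact: ltW.
  by rewrite E normrM ler_piMr.
have cos1 (y : R) : `|cos y| <= 1 by rewrite ler_norml cos_geN1 cos_le1.
have sin1 (y : R) : `|sin y| <= 1 by rewrite ler_norml sin_geN1 sin_le1.
have Hc := le_trans (HK _) (ler_wpM2l K0 (mono _ _ (trig1_modcos M L2) (fun x => cos1 _))).
have Hs := le_trans (HK _) (ler_wpM2l K0 (mono _ _ (trig1_modsin M L2) (fun x => sin1 _))).
have main : mean (fun x => `|trig1 (dil1 2 (psum1 m L)) x| `^ p) <=
    2 `^ p * mean (fun x => `|trig1 (conjl (modcos M L2)) x| `^ p)
     + 2 `^ p * mean (fun x => `|trig1 (conjl (modsin M L2)) x| `^ p).
  apply: mean_le_lin2; [exact: cp|exact: cp|exact: cp|].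
  move=> x; rewrite trig1_dil -window_psum1 -/M -/L2.
  apply: le_trans (powRD_le (ltW p0) (normr_ge0 _) (normr_ge0 _)).
  apply: ge0_ler_powR; rewrite ?nnegrE ?addr_ge0 //; first exact: ltW.
  apply: le_trans (ler_normB _ _) _; rewrite !normrM.
  by apply: lerD; rewrite ler_piMl.
apply: (le_trans main).
rewrite (mulrDl (2 `^ p * K)) -(mulrA (2 `^ p) K).
by apply: lerD; apply: (ler_wpM2l (powR_ge0 _ _)); [exact: Hc|exact: Hs].
Qed.

End partial_sums1.

(** * Fejer approximation *)

Section fejer.
Variable R : realType.
Implicit Types (L : seq (R * int * R)) (f : R -> R).

Lemma cont_sum (I : Type) (s : seq I) (F : I -> R -> R) : (forall i, continuous (F i)) ->
  continuous (fun x => \sum_(i <- s) F i x).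
Proof.
move=> cF; elim: s => [|i s IH].
  by under eq_fun do rewrite big_nil; exact: cont_cst.
by under eq_fun do rewrite big_cons; exact: cont_add.
Qed.

Lemma mean_sum (I : Type) (s : seq I) (F : I -> R -> R) : (forall i, continuous (F i)) ->
  mean (fun x => \sum_(i <- s) F i x) = \sum_(i <- s) mean (F i).
Proof.
move=> cF; elim: s => [|i s IH].
  by rewrite big_nil -[RHS]mean_cst; apply: eq_mean => x; rewrite big_nil.
rewrite big_cons -IH -meanD //; last exact: cont_sum.
by apply: eq_mean => x; rewrite big_cons.
Qed.

Lemma cont_id : continuous (fun x : R => x).
Proof. by move=> x; exact: cvg_id. Qed.

Lemma cont_affine (c d : R) : continuous (fun x => c * x + d).
Proof. by apply: cont_add; [apply: cont_mul; [exact: cont_cst|exact: cont_id]|exact: cont_cst]. Qed.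

Lemma cont_cosM (c d : R) : continuous (fun x => cos (c * x + d)).
Proof. by apply: (@cont_comp _ (fun x => c * x + d)); [exact: cont_affine|exact: continuous_cos]. Qed.

Lemma freq0 : freq R 0 = 0.
Proof. by rewrite /freq mulr0z mulr0. Qed.

Lemma freq_neq0 k : k != 0 -> freq R k != 0.
Proof. by move=> /(freq_ge1 R) k1; rewrite -normr_gt0 (lt_le_trans _ k1). Qed.

Lemma mean_cos (k : int) (d : R) :
  mean (fun t => cos (freq R k * t + d)) = if k == 0 then cos d else 0.
Proof.
case: eqVneq => [->|k0].
  by rewrite -[RHS]mean_cst; apply: eq_mean => t; rewrite freq0 mul0r add0r.
rewrite (_ : 0 = (freq R k)^-1 * sin (freq R k * 1 + d) - (freq R k)^-1 * sin (freq R k * 0 + d)).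
  apply: (@mean_derive _ _ (fun t => (freq R k)^-1 * sin (freq R k * t + d))); first exact: cont_cosM.
  move=> x; rewrite -[cos _](mulKf (freq_neq0 k0)) [_ * cos _]mulrC.
  by apply: is_derive1Z; apply: is_derive1_affine.
by rewrite -!cosBpihalf -!addrA cos_freq1 subrr.
Qed.

Lemma freqS (n : nat) : freq R n.+1 = freq R n + freq R 1.
Proof. by rewrite -freqD -PoszD addn1. Qed.

Definition dircos N (y : R) : R := \sum_(0 <= j < N) cos (freq R j * y).
Definition dirsin N (y : R) : R := \sum_(0 <= j < N) sin (freq R j * y).
Definition fejer N (y : R) : R := N%:R^-1 * (dircos N y ^+ 2 + dirsin N y ^+ 2).

Lemma fejer_ge0 N y : 0 <= fejer N y.
Proof. by rewrite mulr_ge0 ?invr_ge0 // addr_ge0 // sqr_ge0. Qed.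

Lemma fejerE N y : fejer N y =
  N%:R^-1 * \sum_(0 <= j < N) \sum_(0 <= l < N) cos (freq R (j%:Z - l%:Z) * y).
Proof.
rewrite /fejer !expr2 /dircos /dirsin !big_distrl -big_split /=; congr (_ * _).
apply: eq_bigr => j _; rewrite !big_distrr -big_split /=; apply: eq_bigr => l _.
by rewrite freqD freqN mulrDl mulNr cosB.
Qed.

Lemma sin_dircos N y :
  2 * sin (pi * y) * dircos N y = sin (freq R N * y - pi * y) + sin (pi * y).
Proof.
elim: N => [|N IH].
  by rewrite /dircos big_geq // mulr0 freq0 mul0r sub0r sinN addNr.
rewrite /dircos big_nat_recr //= mulrDr IH freqS (mulrDl (freq R _)).
have -> : freq R 1 * y = pi * y + pi * y by rewrite /freq; ring.
rewrite (_ : _ + (_ + _) - _ = freq R N * y + pi * y); last by ring.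
by rewrite !sinD sinN cosN; ring.
Qed.

Lemma sin_dirsin N y :
  2 * sin (pi * y) * dirsin N y = cos (pi * y) - cos (freq R N * y - pi * y).
Proof.
elim: N => [|N IH].
  by rewrite /dirsin big_geq // mulr0 freq0 mul0r sub0r cosN subrr.
rewrite /dirsin big_nat_recr //= mulrDr IH freqS (mulrDl (freq R _)).
have -> : freq R 1 * y = pi * y + pi * y by rewrite /freq; ring.
rewrite (_ : _ + (_ + _) - _ = freq R N * y + pi * y); last by ring.
by rewrite !cosD sinN cosN; ring.
Qed.

(** Summing the geometric progression, [2 |sin(pi y)|] times the modulus of the exponential sum is
    [|exp(2 pi i N y) - 1| <= 2]. *)
Lemma sin_fejer N y : sin (pi * y) ^+ 2 * fejer N y <= N%:R^-1.
Proof.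
rewrite /fejer mulrCA ler_piMr ?invr_ge0 //.
have := sin_dircos N y; have := sin_dirsin N y.
set s := sin (pi * y); set c := cos (pi * y).
have E : c ^+ 2 + s ^+ 2 = 1 by exact: cos2Dsin2.
have := cos2Dsin2 (freq R N * y - pi * y).
have : c * cos (freq R N * y - pi * y) - s * sin (freq R N * y - pi * y) = cos (freq R N * y).
  by rewrite -cosD addrC subrK.
have := cos_geN1 (freq R N * y).
move: (cos (_ - _)) (sin (_ - _)) (cos (freq R N * y)) (dircos _ _) (dirsin _ _) => a b d X Y.
clearbody s c; clear -E => d1 E2 E3 Hy Hx.
have : (2 * s * X) ^+ 2 + (2 * s * Y) ^+ 2 <= 4.
  rewrite Hx Hy.
  have -> : (b + s) ^+ 2 + (c - a) ^+ 2 = (a ^+ 2 + b ^+ 2) + (c ^+ 2 + s ^+ 2)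
    - 2 * (c * a - s * b) by ring.
  lra.
rewrite (_ : _ + _ = 4 * (s ^+ 2 * (X ^+ 2 + Y ^+ 2))); last by ring.
lra.
Qed.

Lemma fejer_shiftE N x t : fejer N (x - t) =
  N%:R^-1 * \sum_(0 <= j < N) \sum_(0 <= l < N)
    cos (- freq R (j%:Z - l%:Z) * t + freq R (j%:Z - l%:Z) * x).
Proof.
rewrite fejerE; congr (_ * _); apply: eq_bigr => j _; apply: eq_bigr => l _.
by rewrite mulrBr mulNr addrC.
Qed.

Lemma cont_fejer N x : continuous (fun t => fejer N (x - t)).
Proof.
under eq_fun do rewrite fejer_shiftE.
apply: cont_mul; first exact: cont_cst.
by apply: cont_sum => j; apply: cont_sum => l; exact: cont_cosM.
Qed.

Lemma mean_fejer_mul f N x : continuous f ->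
  mean (fun t => f t * fejer N (x - t)) =
  N%:R^-1 * \sum_(0 <= j < N) \sum_(0 <= l < N)
    mean (fun t => f t * cos (- freq R (j%:Z - l%:Z) * t + freq R (j%:Z - l%:Z) * x)).
Proof.
move=> cf.
have cc j l : continuous (fun t => f t *
    cos (- freq R (j%:Z - l%:Z) * t + freq R (j%:Z - l%:Z) * x)).
  by apply: cont_mul => //; exact: cont_cosM.
transitivity (mean (fun t => N%:R^-1 * \sum_(0 <= j < N) \sum_(0 <= l < N) (f t *
    cos (- freq R (j%:Z - l%:Z) * t + freq R (j%:Z - l%:Z) * x)))).
  apply: eq_mean => t; rewrite fejer_shiftE mulrCA; congr (_ * _).
  by rewrite mulr_sumr; apply: eq_bigr => j _; rewrite mulr_sumr.
rewrite meanZ; last by apply: cont_sum => j; exact: cont_sum.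
congr (_ * _); rewrite mean_sum; last by move=> j; exact: cont_sum.
by apply: eq_bigr => j _; rewrite mean_sum.
Qed.

Lemma mean_fejer N x : (0 < N)%N -> mean (fun t => fejer N (x - t)) = 1.
Proof.
move=> N0.
transitivity (mean (fun t => 1 * fejer N (x - t))).
  by apply: eq_mean => t; rewrite mul1r.
rewrite (@mean_fejer_mul (fun=> 1)); last exact: cont_cst.
rewrite (@eq_big_nat _ _ _ _ _ _ (fun=> 1)) => [|j /andP[_ jN]].
  by rewrite big_const_nat subn0 iter_addr_0 mulVf // pnatr_eq0 -lt0n.
rewrite (eq_bigr (fun l : nat => if - (j%:Z - l%:Z) == 0 then 1 else 0)) => [|l _].
  rewrite (bigD1_seq j) ?mem_index_iota ?iota_uniq //= subrr oppr0 eqxx big1 ?addr0 // => l lj.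
  by rewrite oppr_eq0 subr_eq0 eqz_nat eq_sym (negbTE lj).
rewrite -[LHS](_ : mean (fun t => cos (freq R (- (j%:Z - l%:Z)) * t +
    freq R (j%:Z - l%:Z) * x)) = _); last first.
  by apply: eq_mean => t; rewrite mul1r freqN.
rewrite mean_cos; case: eqP => // /eqP; rewrite oppr_eq0 => /eqP ->.
by rewrite freq0 mul0r cos0.
Qed.

(** Continuity is measured by [|sin(pi (x - t))|], which the kernel controls: with [s] this sine,
    [|s| <= eta + s^2 / eta], the kernel has mean 1, and [s^2] times the kernel is at most [1 / N]
    by [sin_fejer]. *)
Lemma fejer_approx f (Lf eta : R) N x : (0 < N)%N -> 0 < eta -> 0 <= Lf -> continuous f ->
  (forall t x, `|f t - f x| <= Lf * `|sin (pi * (x - t))|) ->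
  `|mean (fun t => f t * fejer N (x - t)) - f x| <= Lf * (eta + (eta * N%:R)^-1).
Proof.
move=> N0 e0 Lf0 cf Lip.
have cK := @cont_fejer N x.
have cF : continuous (fun t => (f t - f x) * fejer N (x - t)).
  by apply: cont_mul => //; apply: cont_add => //; exact: cont_cst.
have -> : mean (fun t => f t * fejer N (x - t)) - f x =
    mean (fun t => (f t - f x) * fejer N (x - t)).
  rewrite -[X in _ - X]mulr1 -(@mean_fejer N x N0) -mulNr -meanZ // -meanD.
  - by apply: eq_mean => t; rewrite mulrBl mulNr.
  - exact: cont_mul.
  - by apply: cont_mul => //; exact: cont_cst.
have cB : continuous (fun t => Lf * (eta * fejer N (x - t)) + Lf * (eta^-1 * N%:R^-1)).
  by apply: cont_add; [do 2 (apply: cont_mul; first exact: cont_cst)|exact: cont_cst].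
have ptw t : `|(f t - f x) * fejer N (x - t)| <=
    Lf * (eta * fejer N (x - t)) + Lf * (eta^-1 * N%:R^-1).
  have K0 := fejer_ge0 N (x - t); have sK := sin_fejer N (x - t).
  rewrite normrM (ger0_norm K0).
  apply: (le_trans (ler_wpM2r K0 (Lip t x))).
  rewrite -mulrA -mulrDr ler_wpM2l //.
  move: sK; set s := sin _.
  have : `|s| <= eta + eta^-1 * s ^+ 2.
    have -> : s ^+ 2 = `|s| ^+ 2 by rewrite real_normK // num_real.
    have : 0 <= (eta - `|s|) ^+ 2 + eta * `|s| by rewrite addr_ge0 ?sqr_ge0 // mulr_ge0 // ltW.
    move: (`|s|) => y Hy.
    rewrite -subr_ge0 (_ : _ - _ = eta^-1 * ((eta - y) ^+ 2 + eta * y)); last first.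
      by field; rewrite gt_eqF.
    by rewrite mulr_ge0 // invr_ge0 ltW.
  move=> /(ler_wpM2r K0) H1 H2; apply: (le_trans H1).
  rewrite mulrDl lerD2l -mulrA; apply: ler_wpM2l => //.
  by rewrite invr_ge0 ltW.
have E : mean (fun t => Lf * (eta * fejer N (x - t)) + Lf * (eta^-1 * N%:R^-1)) =
    Lf * (eta + (eta * N%:R)^-1).
  rewrite meanD; last exact: cont_cst.
    rewrite meanZ; last by apply: cont_mul => //; exact: cont_cst.
    by rewrite meanZ // mean_fejer // mean_cst mulr1 invfM mulrDr.
  by do 2 (apply: cont_mul; first exact: cont_cst).
rewrite -E ler_norml; apply/andP; split.
  have cN : continuous (fun t => -1 * (Lf * (eta * fejer N (x - t)) + Lf * (eta^-1 * N%:R^-1))).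
    by apply: cont_mul => //; exact: cont_cst.
  rewrite -mulN1r -meanZ //; apply: le_mean => // t.
  by rewrite mulN1r; have := ptw t; rewrite ler_norml => /andP[].
by apply: le_mean => // t; have := ptw t; rewrite ler_norml => /andP[].
Qed.

(** The kernel is a trigonometric polynomial in [x - t]; expanding it in [x], the amplitudes are the
    cosine and sine coefficients of [f]. *)
Lemma fejer_trig1 f N : continuous f ->
  exists L, forall x, mean (fun t => f t * fejer N (x - t)) = trig1 L x.
Proof.
move=> cf.
pose c k := mean (fun t => f t * cos (freq R k * t + 0)).
pose d k := mean (fun t => f t * cos (freq R k * t + - (pi / 2))).
exists (flatten [seq flatten [seq [:: (N%:R^-1 * c (j%:Z - l%:Z), j%:Z - l%:Z, 0);
  (N%:R^-1 * d (j%:Z - l%:Z), j%:Z - l%:Z, - (pi / 2))] | l <- index_iota 0 N] | j <- index_iota 0 N]).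
move=> x; rewrite mean_fejer_mul // /trig1 big_flatten big_map mulr_sumr.
apply: eq_bigr => j _; rewrite big_flatten big_map mulr_sumr.
apply: eq_bigr => l _; rewrite !big_cons big_nil /= !addr0; move: (j%:Z - l%:Z) => k.
rewrite -!mulrA -mulrDr; congr (_ * _).
rewrite [c k * _]mulrC [d k * _]mulrC -!meanZ; try (by apply: cont_mul => //; exact: cont_cosM).
rewrite -meanD; try (by apply: cont_mul; [exact: cont_cst|apply: cont_mul => //; exact: cont_cosM]).
apply: eq_mean => t; rewrite !addr0 !cosBpihalf cosD mulNr cosN sinN; ring.
Qed.

End fejer.

(** * The L_q norm of a probability space *)

Section norm.
Context d (X : measurableType d) (R : realType) (mu : {measure set X -> \bar R}).
Variable q : R.
Hypothesis q1 : 1 < q.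
Hypothesis mu1 : mu setT = 1%E.

Local Notation LL := (Lfun mu q%:E).
Implicit Types f g : X -> R.

(** The norm as a real number; on [LL] it is finite, so that [fine] loses nothing ([LnormE]). *)
Definition nm f : R := fine ('N[mu]_q%:E[EFin \o f])%E.

Let q0 : 0 < q. Proof. exact: lt_trans q1. Qed.
Let q_neq0 : q != 0. Proof. by rewrite gt_eqF. Qed.
Let qE1 : (1 <= q%:E)%E. Proof. by rewrite lee_fin ltW. Qed.

Lemma nm_ge0 f : 0 <= nm f.
Proof. by rewrite /nm fine_ge0 // Lnorm_ge0. Qed.

Lemma LL_measurable f : f \in LL -> measurable_fun setT f.
Proof. by move=> /andP[]; rewrite inE. Qed.

Lemma LnormE f : f \in LL -> 'N[mu]_q%:E[EFin \o f]%E = (nm f)%:E.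
Proof. by move=> fL; rewrite -(finite_norm_fine (Lfun_Sub qE1 fL)). Qed.

Lemma LL_add f g : f \in LL -> g \in LL -> (fun x => f x + g x) \in LL.
Proof. by move=> fL gL; have [_ H] := @Lfun_addr_closed _ _ _ mu _ qE1; exact: (H f g fL gL). Qed.

Lemma LL_scale c f : f \in LL -> (fun x => c * f x) \in LL.
Proof.
move=> fL; have [L0 L1] := @Lfun_submod_closed _ _ _ mu _ qE1.
have <- : c *: f + 0 = (fun x => c * f x) by apply/funext => x; rewrite addr0.
exact: L1.
Qed.

Lemma LL_sub f g : f \in LL -> g \in LL -> (fun x => f x - g x) \in LL.
Proof.
move=> fL gL; have <- : (fun x => f x + -1 * g x) = (fun x => f x - g x).
  by apply/funext => x; rewrite mulN1r.
exact: LL_add fL (LL_scale (-1) gL).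
Qed.

Lemma LL0 : (fun _ : X => 0) \in LL.
Proof. by have [] := @Lfun_submod_closed _ _ _ mu _ qE1. Qed.

Lemma LL_sum (I : Type) (s : seq I) (F : I -> X -> R) : (forall i, F i \in LL) ->
  (fun x => \sum_(i <- s) F i x) \in LL.
Proof.
move=> FL; elim: s => [|i s IH].
  by under eq_fun do rewrite big_nil; exact: LL0.
by under eq_fun do rewrite big_cons; exact: LL_add.
Qed.

Lemma nm_add f g : f \in LL -> g \in LL -> nm (fun x => f x + g x) <= nm f + nm g.
Proof.
by move=> fL gL; exact: (@ler_LnormD _ _ _ mu _ qE1 (Lfun_Sub qE1 fL) (Lfun_Sub qE1 gL)).
Qed.

Lemma nm_scale c f : f \in LL -> nm (fun x => c * f x) = `|c| * nm f.
Proof.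
move=> fL; have H := @LnormZ _ _ _ mu _ qE1 (Lfun_Sub qE1 fL) c.
transitivity (fine (`|c|%:E * 'N[mu]_q%:E[EFin \o f])%E); first by congr fine; exact: H.
by rewrite LnormE // -EFinM.
Qed.

Lemma nm_sub f g : f \in LL -> g \in LL -> nm (fun x => f x - g x) <= nm f + nm g.
Proof.
move=> fL gL; have := nm_add fL (LL_scale (-1) gL).
rewrite nm_scale // normrN1 mul1r; congr (_ <= _); congr nm.
by apply/funext => x; rewrite mulN1r.
Qed.

Lemma nm_distC f g : f \in LL -> g \in LL -> nm (fun x => f x - g x) = nm (fun x => g x - f x).
Proof.
move=> fL gL; have := nm_scale (-1) (LL_sub gL fL).
rewrite normrN1 mul1r => <-; congr nm.
by apply/funext => x; rewrite mulN1r opprB.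
Qed.

Lemma nm0 : nm (fun=> 0) = 0.
Proof.
have := nm_scale 0 LL0; rewrite normr0 [X in _ = X]mul0r => E.
by rewrite -[RHS]E; congr nm; apply/funext => x; rewrite mul0r.
Qed.

Lemma nm_sum (I : Type) (s : seq I) (F : I -> X -> R) : (forall i, F i \in LL) ->
  nm (fun x => \sum_(i <- s) F i x) <= \sum_(i <- s) nm (F i).
Proof.
move=> FL; elim: s => [|i s IH].
  by under eq_fun do rewrite big_nil; rewrite big_nil nm0.
under eq_fun do rewrite big_cons; rewrite big_cons.
by apply: le_trans (nm_add (FL i) (LL_sum s FL)) _; rewrite lerD2l.
Qed.

Local Notation Iq f := (\int[mu]_x (`|f x| `^ q)%:E)%E.

Lemma Lnorm_int f : 'N[mu]_q%:E[EFin \o f]%E = (Iq f `^ q^-1)%E.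
Proof.
by rewrite unlock.
Qed.

Lemma Iq_ge0 f : (0 <= Iq f)%E.
Proof. by apply: integral_ge0 => x _; rewrite lee_fin powR_ge0. Qed.

Lemma Lnorm_le_of_int f g (K : R) : 0 <= K -> g \in LL -> (Iq f <= K%:E * Iq g)%E ->
  ('N[mu]_q%:E[EFin \o f] <= (K `^ q^-1 * nm g)%:E)%E.
Proof.
move=> K0 gL H; rewrite EFinM -LnormE // !Lnorm_int -poweR_EFin -poweRM ?Iq_ge0 ?lee_fin //.
by apply: gt0_ler_poweR; rewrite ?invr_ge0 ?(ltW q0) ?in_itv /= ?leey ?Iq_ge0 ?mule_ge0 ?Iq_ge0.
Qed.

Lemma nm_le_of_int f g (K : R) : 0 <= K -> f \in LL -> g \in LL ->
  (Iq f <= K%:E * Iq g)%E -> nm f <= K `^ q^-1 * nm g.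
Proof. by move=> K0 fL gL H; rewrite -lee_fin -LnormE //; exact: Lnorm_le_of_int. Qed.

Lemma integral_one_cst (c : R) : (\int[mu]_x c%:E = c%:E)%E.
Proof. by rewrite integral_cst // mu1 mule1. Qed.

Lemma integral_powR_le (r : R) f (B : R) : 0 < r -> measurable_fun setT f ->
  (forall x, `|f x| <= B) -> 0 <= B -> (\int[mu]_x (`|f x| `^ r)%:E <= (B `^ r)%:E)%E.
Proof.
move=> r0 mf fB B0.
apply: (@le_trans _ _ (\int[mu]_x (B `^ r)%:E)%E); last by rewrite integral_one_cst.
apply: ge0_le_integral => //.
- apply/measurable_EFinP; apply: (@measurableT_comp _ _ _ _ _ _ (fun y : R => y `^ r)).
    exact: measurable_powR.
  exact: measurableT_comp.
- by move=> x _; rewrite lee_fin; apply: ge0_ler_powR; rewrite ?nnegrE ?(ltW r0).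
Qed.

Lemma bounded_LL f (B : R) : measurable_fun setT f -> (forall x, `|f x| <= B) -> f \in LL.
Proof.
move=> mf fB; rewrite inE /=; apply/andP; split; first by rewrite inE.
rewrite inE /finLfun /= /finite_norm Lnorm_int.
have IB : (Iq f <= (`|B| `^ q)%:E)%E.
  apply: integral_powR_le => // x; exact: le_trans (ler_norm B).
have IBy : (Iq f < +oo)%E by apply: le_lt_trans IB _; exact: ltry.
by apply: poweR_lty.
Qed.

Lemma nm_le_bound f (B : R) : measurable_fun setT f -> 0 <= B -> (forall x, `|f x| <= B) ->
  nm f <= B.
Proof.
move=> mf B0 fB; have fL := bounded_LL mf fB.
have oneL : (fun _ : X => 1 : R) \in LL by apply: (@bounded_LL _ 1) => // x; rewrite normr1.
have n1 : nm (fun=> 1) = 1.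
  by rewrite /nm Lnorm_int normr1 powR1 integral_one_cst poweR1r.
have := @nm_le_of_int f (fun=> 1) (B `^ q) (powR_ge0 _ _) fL oneL.
rewrite n1 mulr1 -powRrM divff // powRr1 //; apply.
rewrite normr1 powR1 integral_one_cst mule1.
exact: integral_powR_le.
Qed.

Lemma nm_eq f g : (forall x, f x = g x) -> nm f = nm g.
Proof. by move=> fg; congr nm; apply/funext. Qed.

Lemma bounded_integrable f (B : R) : measurable_fun setT f -> (forall x, `|f x| <= B) ->
  mu.-integrable setT (EFin \o f).
Proof.
move=> mf fB; apply: (@le_integrable _ _ _ mu setT measurableT _ (EFin \o (fun=> B))).
- exact/measurable_EFinP.
- by move=> x _ /=; rewrite lee_fin (le_trans (fB x)) // ler_norm.
- apply/integrableP; split; first exact/measurable_EFinP.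
  by rewrite /= integral_one_cst ltry.
Qed.

(** Hoelder's inequality: on a probability space [|g| <= 1] bounds the conjugate norm of [g] by 1.
    This gives the continuity of the coefficient functionals. *)
Lemma int_mul_le f g : f \in LL -> measurable_fun setT g -> (forall x, `|g x| <= 1) ->
  mu.-integrable setT (EFin \o (fun x => f x * g x)) ->
  `|\int[mu]_x (f x * g x)| <= nm f.
Proof.
move=> fL mg g1 ifg; apply: (le_trans (le_normr_Rintegral measurableT ifg)).
pose q' := q / (q - 1).
have q'0 : 0 < q' by rewrite divr_gt0 // subr_gt0.
have qq : q^-1 + q'^-1 = 1.
  by rewrite /q'; field; rewrite subr_eq0 !gt_eqF.
have mf := LL_measurable fL.
have H := hoelder mu mf mg q0 q'0 qq.
rewrite LnormE // in H.
have Hg : ('N[mu]_q'%:E[EFin \o g] <= 1)%E.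
  rewrite unlock -[leRHS](poweR1r q'^-1); apply: gt0_ler_poweR.
  - by rewrite invr_ge0 ltW.
  - rewrite in_itv /= leey andbT; apply: integral_ge0 => x _.
    by rewrite lee_fin powR_ge0.
  - by rewrite in_itv /= leey andbT.
  have := @integral_powR_le q' g 1 q'0 mg g1 ler01.
  by rewrite powR1.
rewrite Lnorm1 in H.
rewrite /Rintegral -lee_fin fineK.
  apply: (le_trans H); rewrite -[leRHS]mule1; apply: lee_wpmul2l => //.
  by rewrite lee_fin nm_ge0.
have /integrableP[_ Hi] := ifg.
rewrite ge0_fin_numE //; exact: integral_ge0.
Qed.

End norm.

(** * Trigonometric polynomials in several variables *)

Section cube_fubini.
Local Open Scope ereal_scope.
Context (R : realType).

(** The complement of [D] is null for the restricted measure, and both measures agree on subsets of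
    [D]. *)
Lemma integral_mrestr d (T : measurableType d) (mu : {measure set T -> \bar R})
    (D : set T) (mD : measurable D) (f : T -> \bar R) :
  measurable_fun setT f -> (forall x, 0 <= f x) ->
  \int[mrestr mu mD]_x f x = \int[mu]_(x in D) f x.
Proof.
move=> mf f0.
have mC : measurable (~` D) by exact: measurableC.
have m0 : mrestr mu mD (~` D) = 0 by rewrite /mrestr setICl measure0.
rewrite (ge0_negligible_integral mC measurableT mf (fun x _ => f0 x) m0).
rewrite setDE setTI setCK; apply: eq_measure_integral => A mA AD.
by rewrite /= /mrestr (setIidl AD).
Qed.

Lemma tcons_open_cube n :
  @tcons R n @^-1` (@open_cube R n.+1) = `]0%R, 1%R[%classic `*` @open_cube R n.
Proof.
apply/seteqP; split => -[x t] /= => [h|[h0 h] i].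
  by split=> [|i]; [have := h ord0|have := h (lift ord0 i); rewrite tnthS].
by case: (unliftP ord0 i) => [j|] ->; rewrite ?tnthS //; exact: h.
Qed.

Lemma measurable_tcons_t n (x : measurableTypeR R) :
  measurable_fun setT (fun t => @tcons R n (x, t)).
Proof. by apply: measurable_cons; [exact: measurable_cst|exact: measurable_id]. Qed.

Section step.
Variables (n : nat) (h : Rn R n.+1 -> \bar R).
Hypothesis mh : measurable_fun setT h.
Hypothesis h0 : forall x, 0 <= h x.

Let I : set (measurableTypeR R) := `]0%R, 1%R[%classic.
Let mI : measurable I. Proof. exact: measurable_itv. Qed.
Let Q := @open_cube R n.
Let mQ : measurable Q. Proof. exact: measurable_open_cube. Qed.

Let f (p : measurableTypeR R * Rn R n) : \bar R := h (tcons p).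

Let mf : measurable_fun setT f.
Proof. by apply: measurableT_comp => //; exact: measurable_tcons. Qed.

(** Extension by zero outside the cube, since the product measure lives on the whole space. *)
Let g := f \_ (I `*` Q).

Let mg : measurable_fun setT g.
Proof. by apply/(measurable_restrictT _ _).1; [exact: measurableX|exact: measurable_funTS]. Qed.

Let g0 x : 0 <= g x.
Proof. by rewrite /g patchE; case: ifP => // _; exact: h0. Qed.

Lemma cube_integral_prod :
  \int[cube_measure R n.+1]_t h t = \int[@lebesgue_measure R \x lebesgue_Rn R n]_z g z.
Proof.
rewrite /cube_measure integral_mrestr //.
rewrite [LHS](@ge0_integral_pushforward _ _ _ _ _ _ (@measurable_tcons R n)) //.
- by rewrite tcons_open_cube integral_mkcond.
- exact: measurable_open_cube.
- exact: measurable_funTS.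
Qed.

Lemma cube_integral_xt :
  \int[cube_measure R n.+1]_t h t =
  \int[@lebesgue_measure R]_(x in I) \int[cube_measure R n]_t h (tcons (x, t)).
Proof.
rewrite cube_integral_prod (fubini_tonelli1 _ mg g0) [RHS]integral_mkcond.
apply: eq_integral => x _; rewrite /fubini_F patchE; case: ifPn => xI.
  rewrite /cube_measure integral_mrestr //; last exact: measurableT_comp (measurable_tcons_t _).
  rewrite [RHS]integral_mkcond; apply: eq_integral => t _.
  rewrite /g !patchE; congr (if _ then _ else _).
  by rewrite in_setX xI.
apply: integral0_eq => t _; rewrite /g patchE in_setX (negbTE xI) //.
Qed.

Lemma cube_integral_tx :
  \int[cube_measure R n.+1]_t h t =
  \int[cube_measure R n]_t \int[@lebesgue_measure R]_(x in I) h (tcons (x, t)).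
Proof.
have mG : measurable_fun setT (fun t => \int[@lebesgue_measure R]_(x in I) h (tcons (x, t))).
  pose k := f \_ (I `*` setT).
  have mk : measurable_fun setT k.
    by apply/(measurable_restrictT _ _).1; [exact: measurableX|exact: measurable_funTS].
  have k0 x : 0 <= k x by rewrite /k patchE; case: ifP => // _; exact: h0.
  have := @measurable_fun_fubini_tonelli_G _ _ _ _ _ (@lebesgue_measure R) k mk k0.
  apply: eq_measurable_fun => t _; rewrite /fubini_G [RHS]integral_mkcond.
  apply: eq_integral => x _; rewrite /k !patchE in_setX.
  by rewrite [t \in _]mem_set // andbT.
rewrite cube_integral_prod (fubini_tonelli2 _ mg g0).
rewrite /cube_measure integral_mrestr //; last first.
  by move=> t; apply: integral_ge0 => x _; exact: h0.
rewrite [RHS]integral_mkcond.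
apply: eq_integral => t _; rewrite /fubini_G patchE; case: ifPn => tQ.
  rewrite [RHS]integral_mkcond; apply: eq_integral => x _.
  rewrite /g !patchE; congr (if _ then _ else _).
  by rewrite in_setX tQ andbT.
apply: integral0_eq => x _; rewrite /g patchE in_setX (negbTE tQ) andbF //.
Qed.

Lemma measurable_cube_t :
  measurable_fun setT (fun t => \int[@lebesgue_measure R]_(x in I) h (tcons (x, t))).
Proof.
pose k := f \_ (I `*` setT).
have mk : measurable_fun setT k.
  by apply/(measurable_restrictT _ _).1; [exact: measurableX|exact: measurable_funTS].
have k0 x : 0 <= k x by rewrite /k patchE; case: ifP => // _; exact: h0.
have := @measurable_fun_fubini_tonelli_G _ _ _ _ _ (@lebesgue_measure R) k mk k0.
apply: eq_measurable_fun => t _; rewrite /fubini_G [RHS]integral_mkcond.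
apply: eq_integral => x _; rewrite /k !patchE in_setX.
by rewrite [t \in _]mem_set // andbT.
Qed.

Lemma measurable_cube_x :
  measurable_fun setT (fun x => \int[cube_measure R n]_t h (tcons (x, t))).
Proof.
pose k := f \_ (setT `*` Q).
have mk : measurable_fun setT k.
  by apply/(measurable_restrictT _ _).1; [exact: measurableX|exact: measurable_funTS].
have k0 x : 0 <= k x by rewrite /k patchE; case: ifP => // _; exact: h0.
have := @measurable_fun_fubini_tonelli_F _ _ _ _ _ (lebesgue_Rn R n) k mk k0.
apply: eq_measurable_fun => x _; rewrite /fubini_F /cube_measure integral_mrestr //; last first.
  exact: measurableT_comp (measurable_tcons_t _).
rewrite [RHS]integral_mkcond.
apply: eq_integral => t _; rewrite /k !patchE in_setX.
by rewrite [x \in _]mem_set.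
Qed.

End step.

End cube_fubini.

(** * Rectangular partial sums in several variables *)

Section trign.
Variable R : realType.

Lemma integral01_mean (g : R -> R) : continuous g ->
  (\int[@lebesgue_measure R]_(x in `]0%R, 1%R[%classic) (g x)%:E = (mean g)%:E)%E.
Proof.
move=> cg; rewrite /mean /Rintegral fineK; last first.
  by apply: integrable_fin_num => //; exact: continuous_integrable01.
apply/esym; apply: (@integral_itv_bndoo R 0 1 (EFin \o g) true false).
apply/measurable_EFinP; apply: measurable_funTS.
exact: continuous_measurable_fun.
Qed.

Definition trign n (T : seq (R * n.-tuple int * R)) (x : Rn R n) : R :=
  \sum_(t <- T) t.1.1 * cos (2 * pi * dotZ t.1.2 x + t.2).

Lemma measurable_dotZ n (k : n.-tuple int) : measurable_fun setT (@dotZ R n k).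
Proof.
apply: measurable_sum => i; apply: measurable_funM; first exact: measurable_cst.
exact: measurable_tnth.
Qed.

Lemma measurable_trign n (T : seq (R * n.-tuple int * R)) : measurable_fun setT (trign T).
Proof.
apply: measurable_sum => t; apply: measurable_funM; first exact: measurable_cst.
apply: (@measurableT_comp _ _ _ _ _ _ (@cos R)).
  by apply: continuous_measurable_fun; exact: continuous_cos.
apply: measurable_funD; last exact: measurable_cst.
by apply: measurable_funM; [exact: measurable_cst|exact: measurable_dotZ].
Qed.

Lemma measurable_norm_powR d (X : measurableType d) (p : R) (f : X -> R) :
  measurable_fun setT f -> measurable_fun setT (fun x => (`|f x| `^ p)%:E).
Proof.
move=> mf; apply/measurable_EFinP.
apply: (@measurableT_comp _ _ _ _ _ _ (fun y : R => y `^ p)); first exact: measurable_powR.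
exact: measurableT_comp.
Qed.

Definition tbehead (X : Type) n (k : n.+1.-tuple X) : n.-tuple X := [tuple of behead k].

Lemma tnth_behead_lift (X : Type) n (k : n.+1.-tuple X) (i : 'I_n) :
  tnth (tbehead k) i = tnth k (lift ord0 i).
Proof. by rewrite !(tnth_nth (thead k)) nth_behead lift0. Qed.

Lemma dotZ_tcons n (k : n.+1.-tuple int) (x : R) (t : Rn R n) :
  dotZ k (tcons (x, t)) = (thead k)%:~R * x + dotZ (tbehead k) t.
Proof.
rewrite /dotZ big_ord_recl /=; congr (_ * _ + _).
by apply: eq_bigr => i _; rewrite tnthS tnth_behead_lift.
Qed.

(** Fixing all variables but the first moves their share of the inner product into the phase, so a
    slice is again a list of waves. [slice_x] does the same with the first variable fixed. *)
Definition slice_t n (T : seq (R * n.+1.-tuple int * R)) (x : Rn R n) : seq (R * int * R) :=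
  [seq (t.1.1, thead t.1.2, 2 * pi * dotZ (tbehead t.1.2) x + t.2) | t <- T].

Definition slice_x n (T : seq (R * n.+1.-tuple int * R)) (x : R) : seq (R * n.-tuple int * R) :=
  [seq (t.1.1, (tbehead t.1.2), freq R (thead t.1.2) * x + t.2) | t <- T].

Lemma trign_slice_t n (T : seq (R * n.+1.-tuple int * R)) x t :
  trign T (tcons (x, t)) = trig1 (slice_t T t) x.
Proof.
rewrite /trign /trig1 big_map; apply: eq_bigr => u _ /=.
by rewrite dotZ_tcons mulrDr mulrA addrA.
Qed.

Lemma trign_slice_x n (T : seq (R * n.+1.-tuple int * R)) x t :
  trign T (tcons (x, t)) = trign (slice_x T x) t.
Proof.
rewrite /trign big_map; apply: eq_bigr => u _ /=.
by rewrite dotZ_tcons mulrDr mulrA addrA [_ * x + _]addrC.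
Qed.

Definition psumn n (m : n.-tuple nat) (T : seq (R * n.-tuple int * R)) :=
  [seq t <- T | [forall i, (absz (tnth t.1.2 i) <= tnth m i)%N]].

Definition psumhd n (m : nat) (T : seq (R * n.+1.-tuple int * R)) :=
  [seq t <- T | (absz (thead t.1.2) <= m)%N].

Lemma slice_t_psumhd n m (T : seq (R * n.+1.-tuple int * R)) t :
  slice_t (psumhd m T) t = psum1 m (slice_t T t).
Proof. by rewrite /slice_t /psumhd /psum1 filter_map. Qed.

Lemma slice_x_psumn n (m : n.+1.-tuple nat) (T : seq (R * n.+1.-tuple int * R)) x :
  slice_x (psumn m T) x = psumn (tbehead m) (slice_x (psumhd (thead m) T) x).
Proof.
rewrite /slice_x /psumhd /psumn filter_map -filter_predI; congr map.
apply: eq_filter => t /=; apply/forallP/andP => [H|[/forallP H1 H0] i].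
  split; last exact: H.
  by apply/forallP => i; rewrite !tnth_behead_lift; exact: H.
have [j ->|->] := unliftP ord0 i; last exact: H0.
by have := H1 j; rewrite !tnth_behead_lift.
Qed.

Local Notation Lp p n T := (\int[cube_measure R n]_t (`|trign T t| `^ p)%:E)%E.

Lemma Lp_t (p : R) n (T : seq (R * n.+1.-tuple int * R)) : 0 < p ->
  (Lp p n.+1 T = \int[cube_measure R n]_t (mean (fun x => `|trig1 (slice_t T t) x| `^ p))%:E)%E.
Proof.
move=> p0; rewrite (cube_integral_tx (measurable_norm_powR p (measurable_trign T)) (fun x => powR_ge0 _ _)).
apply: eq_integral => t _; rewrite -integral01_mean.
  by apply: eq_integral => x _; rewrite trign_slice_t.
apply: (@cont_comp _ (trig1 _) (fun y => `|y| `^ p)); first exact: continuous_trig1.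
exact: continuous_norm_powR.
Qed.

Lemma measurable_mean_slice_t (p : R) n (T : seq (R * n.+1.-tuple int * R)) : 0 < p ->
  measurable_fun setT (fun t => (mean (fun x => `|trig1 (slice_t T t) x| `^ p))%:E).
Proof.
move=> p0.
have := @measurable_cube_t R n (fun x => (`|trign T x| `^ p)%:E).
move=> /(_ (measurable_norm_powR _ (measurable_trign T))) /(_ (fun x => powR_ge0 _ _)).
apply: eq_measurable_fun => t _; rewrite -integral01_mean.
  by apply: eq_integral => x _; rewrite trign_slice_t.
apply: (@cont_comp _ (trig1 _) (fun y => `|y| `^ p)); first exact: continuous_trig1.
exact: continuous_norm_powR.
Qed.

Lemma Lp_x (p : R) n (T : seq (R * n.+1.-tuple int * R)) :
  (Lp p n.+1 T = \int[@lebesgue_measure R]_(x in `]0%R, 1%R[%classic) Lp p n (slice_x T x))%E.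
Proof.
rewrite (cube_integral_xt (measurable_norm_powR p (measurable_trign T)) (fun x => powR_ge0 _ _)).
by apply: eq_integral => x _; apply: eq_integral => t _; rewrite trign_slice_x.
Qed.

Lemma measurable_Lp_slice_x (p : R) n (T : seq (R * n.+1.-tuple int * R)) :
  measurable_fun setT (fun x : measurableTypeR R => Lp p n (slice_x T x)).
Proof.
have := @measurable_cube_x R n (fun x => (`|trign T x| `^ p)%:E).
move=> /(_ (measurable_norm_powR _ (measurable_trign T))) /(_ (fun x => powR_ge0 _ _)).
by apply: eq_measurable_fun => x _; apply: eq_integral => t _; rewrite trign_slice_x.
Qed.

Lemma Lp_ge0 (p : R) n (T : seq (R * n.-tuple int * R)) : (0 <= Lp p n T)%E.
Proof. by apply: integral_ge0 => t _; rewrite lee_fin powR_ge0. Qed.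

Lemma mean_powR_ge0 (p : R) L : (0 <= (mean (fun x => `|trig1 L x| `^ p : R))%:E)%E.
Proof. by rewrite lee_fin; apply: mean_ge0 => x; rewrite powR_ge0. Qed.

(** Induction on the dimension. With the first variable fixed, the inductive bound undoes the
    truncation in the others; with the others fixed, [psum1_bound] undoes the truncation [psumhd] in
    the first. In dimension 0 nothing is truncated. *)
Lemma psumn_bound (p : R) n : 1 < p ->
  exists2 K, 0 <= K & forall m T, (Lp p n (psumn m T) <= K%:E * Lp p n T)%E.
Proof.
move=> p1; have [K1 K10 HK1] := psum1_bound p1; have p0 : 0 < p by lra.
elim: n => [|n [K K0 HK]].
  exists 1 => // m T; rewrite mul1e.
  rewrite (_ : psumn m T = T) // /psumn.
  by apply/all_filterP/allP => t _; apply/forallP => -[].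
exists (K * K1) => [|m T]; first exact: mulr_ge0.
apply: (@le_trans _ _ (K%:E * Lp p n.+1 (psumhd (thead m) T))%E).
  rewrite !Lp_x -ge0_integralZl //; last 2 first.
  - by apply: measurable_funTS; exact: measurable_Lp_slice_x.
  - by move=> x _; exact: Lp_ge0.
  apply: ge0_le_integral => //.
  - by move=> x _; exact: Lp_ge0.
  - by apply: measurable_funTS; exact: measurable_Lp_slice_x.
  - apply: measurable_funTS; apply: measurable_funeM; exact: measurable_Lp_slice_x.
  - by move=> x _; rewrite slice_x_psumn.
rewrite EFinM -muleA; apply: lee_wpmul2l => //.
rewrite !Lp_t // -ge0_integralZl //; last 2 first.
- exact: measurable_mean_slice_t.
- by move=> x _; exact: mean_powR_ge0.
apply: ge0_le_integral => //.
- by move=> t _; exact: mean_powR_ge0.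
- exact: measurable_mean_slice_t.
- by apply: measurable_funeM; exact: measurable_mean_slice_t.
- by move=> t _; rewrite slice_t_psumhd -EFinM lee_fin.
Qed.

End trign.

(** * Dilations and orthogonality on the cube *)

Section diln.
Variable R : realType.

Definition tscale n (j : int) (k : n.-tuple int) : n.-tuple int := [tuple j * tnth k i | i < n].

Definition diln n (j : int) (T : seq (R * n.-tuple int * R)) :=
  [seq (t.1.1, tscale j t.1.2, t.2) | t <- T].

(** Dilates all variables but the first: the halfway point from which [Lp_diln] changes one variable
    by [mean_dil1] and the others by induction. *)
Definition diltl n (j : int) (T : seq (R * n.+1.-tuple int * R)) :=
  [seq (t.1.1, [tuple of thead t.1.2 :: tscale j (tbehead t.1.2)], t.2) | t <- T].

Lemma thead_tscale n j (k : n.+1.-tuple int) : thead (tscale j k) = j * thead k.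
Proof. by rewrite /thead tnth_mktuple. Qed.

Lemma tbehead_tscale n j (k : n.+1.-tuple int) : tbehead (tscale j k) = tscale j (tbehead k).
Proof.
apply: eq_from_tnth => i.
by rewrite tnth_behead_lift !tnth_mktuple tnth_behead_lift.
Qed.

Lemma tbehead_cons (X : Type) n (a : X) (k : n.-tuple X) : tbehead [tuple of a :: k] = k.
Proof. exact: val_inj. Qed.

Lemma slice_t_diln n j (T : seq (R * n.+1.-tuple int * R)) t :
  slice_t (diln j T) t = dil1 j (slice_t (diltl j T) t).
Proof.
rewrite /slice_t /diln /dil1 /diltl -!map_comp; apply: eq_map => u /=.
by rewrite thead_tscale tbehead_tscale theadE tbehead_cons.
Qed.

Lemma slice_x_diltl n j (T : seq (R * n.+1.-tuple int * R)) x :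
  slice_x (diltl j T) x = diln j (slice_x T x).
Proof.
rewrite /slice_x /diln /diltl -!map_comp; apply: eq_map => u /=.
by rewrite theadE tbehead_cons.
Qed.

Local Notation Lp p n T := (\int[cube_measure R n]_t (`|trign T t| `^ p)%:E)%E.

Lemma Lp_diln (p : R) n j (T : seq (R * n.-tuple int * R)) : 0 < p -> j != 0 ->
  Lp p n (diln j T) = Lp p n T.
Proof.
move=> p0 j0; elim: n T => [|n IH] T.
  congr integral; apply/funext => t; congr ((`|_| `^ _)%:E).
  rewrite /trign big_map; apply: eq_bigr => u _ /=.
  by rewrite /dotZ !big_ord0.
rewrite (Lp_t (diln j T) p0); transitivity (Lp p n.+1 (diltl j T)).
  rewrite (Lp_t (diltl j T) p0); apply: eq_integral => t _.
  by rewrite slice_t_diln mean_dil1.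
by rewrite !Lp_x; apply: eq_integral => x _; rewrite slice_x_diltl IH.
Qed.

Lemma cube_measureT n : cube_measure R n setT = 1%E.
Proof.
rewrite /cube_measure /= /mrestr setTI.
rewrite (@lebesgue_Rn_box R n (fun=> `]0, 1[%classic)) // big1 // => i _.
by have /= -> := @lebesgue_measure_itv R `]0, 1[; rewrite lte01 sube0.
Qed.

Lemma integral_cube_cst n (c : R) : (\int[cube_measure R n]_t (c%:E) = c%:E)%E.
Proof. by rewrite integral_cst // cube_measureT mule1. Qed.

Definition tzero n : n.-tuple int := [tuple 0 | _ < n].

Lemma tzero_cons n (k : n.+1.-tuple int) :
  (k == tzero n.+1) = (thead k == 0) && (tbehead k == tzero n).
Proof.
apply/eqP/andP => [->|[/eqP h0 /eqP h1]].
  split; first by rewrite /thead tnth_mktuple.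
  by apply/eqP/eq_from_tnth => i; rewrite tnth_behead_lift !tnth_mktuple.
apply: eq_from_tnth => i; rewrite tnth_mktuple.
have [j ->|->] := unliftP ord0 i; last exact: h0.
by rewrite -tnth_behead_lift h1 tnth_mktuple.
Qed.

Lemma measurable_1cos n (k : n.-tuple int) (d : R) :
  measurable_fun setT (fun t => (1 + cos (2 * pi * dotZ k t + d))%:E).
Proof.
apply/measurable_EFinP; apply: measurable_funD; first exact: measurable_cst.
have := measurable_trign [:: (1 : R, k, d)].
by apply: eq_measurable_fun => t _; rewrite /trign big_seq1 mul1r.
Qed.

(* [1 +] makes the integrand nonnegative, so that Tonelli's theorem applies. *)
Lemma integral_1cos n (k : n.-tuple int) (d : R) :
  (\int[cube_measure R n]_t (1 + cos (2 * pi * dotZ k t + d))%:E =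
   (1 + if k == tzero n then cos d else 0)%:E)%E.
Proof.
elim: n k d => [|n IH] k d.
  have -> : (k == tzero 0) = true by rewrite (tuple0 k) [tzero 0]tuple0 eqxx.
  rewrite -[RHS](integral_cube_cst 0).
  by apply: eq_integral => t _; rewrite /dotZ big_ord0 mulr0 add0r.
have ge0 t : (0 <= (1 + cos (2 * pi * dotZ k t + d))%:E)%E.
  by rewrite lee_fin; have := cos_geN1 (2 * pi * dotZ k t + d); lra.
rewrite (cube_integral_tx (measurable_1cos k d) ge0).
transitivity (\int[cube_measure R n]_t
   (1 + if thead k == 0 then cos (2 * pi * dotZ (tbehead k) t + d) else 0)%:E)%E.
  apply: eq_integral => t _.
  rewrite -(mean_cos (thead k)) -[X in X + _](mean_cst 1) -meanD;
    [|exact: cont_cst|exact: cont_cosM].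
  rewrite -integral01_mean; last by apply: cont_add; [exact: cont_cst|exact: cont_cosM].
  by apply: eq_integral => x _; rewrite dotZ_tcons mulrDr mulrA addrA.
rewrite tzero_cons; case: (thead k == 0) => /=; first exact: IH.
by rewrite addr0 integral_cube_cst.
Qed.

End diln.

(** * A criterion for Pringsheim bases *)

Section coefficients.
Variables (R : realType) (n : nat) (u v : posZ n -> Rn R n -> R).

Definition coefs : Type := (R * (posZ n -> R) * (posZ n -> R))%type.
Implicit Types (c e : coefs) (m M : n.-tuple nat) (k : posZ n).

Definition rs c m : Rn R n -> R := rect_sum u v c m.

Definition csub c e : coefs :=
  (c.1.1 - e.1.1, fun k => c.1.2 k - e.1.2 k, fun k => c.2 k - e.2 k).

Definition cadd c e : coefs :=
  (c.1.1 + e.1.1, fun k => c.1.2 k + e.1.2 k, fun k => c.2 k + e.2 k).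

(** Zero coefficients outside [rect M] freeze the sum: over every larger rectangle it keeps the
    value it has over [rect M] ([rs_cut]). *)
Definition cut c M : coefs :=
  (c.1.1, fun k => if k \in rect M then c.1.2 k else 0,
          fun k => if k \in rect M then c.2 k else 0).

Definition tle m M : Prop := forall i, (tnth m i <= tnth M i)%N.

Definition tmax m M : n.-tuple nat := [tuple maxn (tnth m i) (tnth M i) | i < n].

Lemma tle_maxl m M : tle m (tmax m M).
Proof. by move=> i; rewrite tnth_mktuple leq_maxl. Qed.

Lemma tle_maxr m M : tle M (tmax m M).
Proof. by move=> i; rewrite tnth_mktuple leq_maxr. Qed.

Lemma tle_trans m M N : tle m M -> tle M N -> tle m N.
Proof. by move=> mM MN i; exact: leq_trans (mM i) (MN i). Qed.

Lemma rect_tle m M : tle m M -> rect m `<=` rect M.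
Proof. by move=> mM k /= km i; exact: leq_trans (km i) (mM i). Qed.

(** A duplicate-free list in place of the set [rect m], so that the lemmas on ordinary big sums
    apply. *)
Definition erect m : seq (posZ n) := finmap.enum_fset (fset_set (rect m)).

Lemma mem_erect m k : (k \in erect m) = (k \in rect m).
Proof. by rewrite /erect in_fset_set //; exact: finite_rect. Qed.

Lemma erect_uniq m : uniq (erect m).
Proof. exact: finmap.fset_uniq. Qed.

Lemma rsE c m x : rs c m x =
  c.1.1 + \sum_(k <- erect m) (c.1.2 k * u k x + c.2 k * v k x).
Proof.
rewrite /rs /rect_sum; case: c => -[a0 a] b /=.
by rewrite fsbig_finite //; exact: finite_rect.
Qed.

Lemma rs_sub c e m x : rs (csub c e) m x = rs c m x - rs e m x.
Proof.
rewrite !rsE /= opprD addrACA; congr (_ + _); rewrite -sumrB.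
by apply: eq_bigr => k _; ring.
Qed.

Lemma rs_add c e m x : rs (cadd c e) m x = rs c m x + rs e m x.
Proof.
rewrite !rsE /= addrACA; congr (_ + _); rewrite -big_split /=.
by apply: eq_bigr => k _; ring.
Qed.

Lemma erect_cond m M (F : posZ n -> R) : tle M m ->
  \sum_(k <- erect m) (if k \in rect M then F k else 0) = \sum_(k <- erect M) F k.
Proof.
move=> Mm; rewrite -big_mkcond -big_filter; apply: perm_big; apply: uniq_perm.
- by rewrite filter_uniq // /erect finmap.fset_uniq.
- exact: finmap.fset_uniq.
move=> k; rewrite mem_filter !mem_erect; case: (boolP (k \in rect M)) => //= kM.
by apply/mem_set; apply: (rect_tle Mm); exact: set_mem kM.
Qed.

Lemma rs_cut c m M x : tle M m -> rs (cut c M) m x = rs c M x.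
Proof.
move=> Mm; rewrite !rsE /=; congr (_ + _).
rewrite -(erect_cond (fun k => c.1.2 k * u k x + c.2 k * v k x) Mm).
by apply: eq_bigr => k _; case: ifP => // _; rewrite !mul0r addr0.
Qed.

Lemma near_tle M : \forall m \near @pringsheim n, tle M m.
Proof.
exists (\max_(i < n) tnth M i)%N => // m /= h i.
exact: leq_trans (leq_bigmax i) (h i).
Qed.

End coefficients.

Lemma harmonic_small (R : realType) (C eps : R) : 0 <= C -> 0 < eps ->
  exists j, forall i, (j <= i)%N -> C * i.+1%:R^-1 <= eps.
Proof.
move=> C0 e0; have dC : 0 < eps / (C + 1) by rewrite divr_gt0 // ltr_wpDl.
have [j _ Hj] := near_infty_natSinv_lt (PosNum dC).
exists j => i ji; apply: (le_trans (ler_wpM2l C0 (ltW (Hj i ji)))) => /=.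
by rewrite mulrCA ler_piMr ?(ltW e0) // ler_pdivrMr ?mul1r ?lerDl // ltr_wpDl.
Qed.

(** Completeness with a rate: letting [j] grow leaves only the error of [w i]. It serves both for
    limits of coefficients and for the Fourier series of the triangular wave. *)
Lemma harmonic_cauchy (R : realType) (w : nat -> R) (C : R) : 0 <= C ->
  (forall i j, `|w i - w j| <= C * (i.+1%:R^-1 + j.+1%:R^-1)) ->
  exists l, forall i, `|l - w i| <= C * i.+1%:R^-1.
Proof.
move=> C0 H.
have cw : cvgn w.
  apply/cauchy_cvgP/cauchy_exP => eps e0.
  have e3 : 0 < eps / 3 by rewrite divr_gt0.
  have [j Hj] := harmonic_small C0 e3.
  exists (w j); exists j => // i ji; rewrite /ball /=.
  apply: (le_lt_trans (H j i)); rewrite mulrDr.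
  have := Hj j (leqnn _); have := Hj i ji.
  move: (C * _) (C * _) => A B; clear -e0 => H1 H2; lra.
exists (limn w) => i; apply/ler_addgt0Pr => eps e0.
have e2 : 0 < eps / 2 by rewrite divr_gt0.
have [j Hj] := harmonic_small C0 e2.
have /cvgrPdist_le/(_ _ e2)[j' _ Hj'] := cw.
have := Hj' (maxn j j') (leq_maxr _ _); have := Hj (maxn j j') (leq_maxl _ _).
move: (maxn j j') => N H1 H2.
rewrite (_ : limn w - w i = (limn w - w N) + (w N - w i)); last by ring.
apply: (le_trans (ler_normD _ _)); apply: (le_trans (lerD H2 (H N i))).
rewrite mulrDr; move: (C * _) (C * _) H1 => A B; clear => H1; lra.
Qed.

(** * Bounded projections, bounded coefficients and density give a basis *)

Section criterion.
Variables (R : realType) (n : nat) (q : R) (u v : posZ n -> Rn R n -> R).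
Hypothesis q1 : 1 < q.
Hypothesis mu1 : cube_measure R n setT = 1%E.

Local Notation mu := (cube_measure R n).
Local Notation LL := (Lfun mu q%:E).
Local Notation nm := (nm mu q).
Local Notation rs := (rs u v).

Hypothesis uL : forall k, u k \in LL.
Hypothesis vL : forall k, v k \in LL.

Variable K : R.
Hypothesis K0 : 0 <= K.
Hypothesis projB : forall (c : coefs R n) m M, tle m M -> nm (rs c m) <= K * nm (rs c M).
Hypothesis coefB0 : exists2 C, 0 <= C & forall (c : coefs R n) M, `|c.1.1| <= C * nm (rs c M).
Hypothesis coefB : forall k, exists2 C, 0 <= C &
  forall (c : coefs R n) M, k \in rect M ->
    `|c.1.2 k| <= C * nm (rs c M) /\ `|c.2 k| <= C * nm (rs c M).
Hypothesis dense : forall f eps, f \in LL -> 0 < eps ->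
  exists (c : coefs R n) M, nm (fun x => f x - rs c M x) < eps.

Lemma cst_LL (a : R) : (fun=> a) \in LL.
Proof. by apply: (bounded_LL q1 mu1 (B := `|a|)) => //; exact: measurable_cst. Qed.

Lemma rs_LL c m : rs c m \in LL.
Proof.
rewrite (_ : rs c m = fun x => c.1.1 + \sum_(k <- erect m) (c.1.2 k * u k x + c.2 k * v k x)).
  apply: (LL_add q1); first exact: cst_LL.
  by apply: (LL_sum q1) => k; apply: (LL_add q1); apply: (LL_scale q1).
by apply/funext => x; rewrite rsE.
Qed.

(** Over a fixed rectangle a sum depends continuously on its finitely many coefficients: [D] adds up
    the norms of the functions involved, and 1 for the constant. *)
Lemma nm_rs_le c m : exists2 D, 0 <= D & forall e : coefs R n, (forall d, 
   `|e.1.1 - c.1.1| <= d -> (forall k, k \in rect m -> `|e.1.2 k - c.1.2 k| <= d /\ `|e.2 k - c.2 k| <= d) ->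
   nm (fun x => rs e m x - rs c m x) <= d * D).
Proof.
exists (1 + \sum_(k <- erect m) (nm (u k) + nm (v k))) => [|e d d0 dk].
  by rewrite addr_ge0 // sumr_ge0 // => k _; rewrite addr_ge0 // nm_ge0.
rewrite (nm_eq _ _ (fun x => esym (rs_sub u v e c m x))).
rewrite (nm_eq _ _ (fun x => rsE u v (csub e c) m x)) /=.
have sL k : (fun x => (e.1.2 k - c.1.2 k) * u k x + (e.2 k - c.2 k) * v k x) \in LL.
  by apply: (LL_add q1); apply: (LL_scale q1).
apply: (le_trans (nm_add q1 (cst_LL _) (LL_sum q1 _ sL))).
rewrite mulrDr mulr1; apply: lerD.
  apply: le_trans d0; apply: (nm_le_bound q1 mu1) => //.
apply: (le_trans (nm_sum q1 _ sL)); rewrite mulr_sumr big_seq [leRHS]big_seq.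
apply: ler_sum => k; rewrite mem_erect => km; have [d1 d2] := dk k km.
apply: (le_trans (nm_add q1 (LL_scale q1 _ (uL k)) (LL_scale q1 _ (vL k)))).
rewrite !(nm_scale q1) // mulrDr.
by apply: lerD; apply: ler_wpM2r => //; exact: nm_ge0.
Qed.

(** The partial sums of the difference [csub c e] tend to 0 in norm, and each coefficient is bounded
    by a constant times that norm on all large rectangles. *)
Lemma criterion_unique (c e : coefs R n) (f : Rn R n -> R) : f \in LL ->
  nm (fun x => f x - rs c m x) @[m --> @pringsheim n] --> 0 ->
  nm (fun x => f x - rs e m x) @[m --> @pringsheim n] --> 0 -> c = e.
Proof.
move=> fL cf ef.
have small (eps : R) : 0 < eps -> \forall m \near @pringsheim n, nm (rs (csub c e) m) <= eps.
  move=> e0; have e2 : 0 < eps / 2 by rewrite divr_gt0.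
  move/cvgrPdist_lt : cf => /(_ _ e2) Hc; move/cvgrPdist_lt : ef => /(_ _ e2) He.
  near=> m.
  rewrite (nm_eq _ _ (fun x => rs_sub u v c e m x)).
  rewrite (_ : nm _ = nm (fun x => (f x - rs e m x) - (f x - rs c m x))); last first.
    by apply: nm_eq => x; ring.
  apply: (le_trans (nm_sub q1 (LL_sub q1 fL (rs_LL _ _)) (LL_sub q1 fL (rs_LL _ _)))).
  have : `|0 - nm (fun x => f x - rs c m x)| < eps / 2 by near: m.
  have : `|0 - nm (fun x => f x - rs e m x)| < eps / 2 by near: m.
  by rewrite !sub0r !normrN !ger0_norm ?nm_ge0 //; lra.
have eq0 (y : R) (C : R) (P : n.-tuple nat -> Prop) : 0 <= C ->
    (\forall m \near @pringsheim n, P m) ->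
    (forall m, P m -> `|y| <= C * nm (rs (csub c e) m)) -> y = 0.
  move=> C0 nP H; apply/eqP; rewrite -normr_le0; apply/ler_addgt0Pr => d d0.
  have dC : 0 < d / (C + 1) by rewrite divr_gt0 // ltr_wpDl.
  have [m [Pm sm]] := filter_ex (filterI nP (small _ dC)).
  apply: le_trans (H m Pm) _; rewrite add0r.
  apply: (le_trans (ler_wpM2l C0 sm)).
  by rewrite mulrCA ler_piMr ?(ltW d0) // ler_pdivrMr ?mul1r ?lerDl // ltr_wpDl.
have [C C0 HC] := coefB0.
have E0 : c.1.1 = e.1.1.
  apply/eqP; rewrite -subr_eq0; apply/eqP; apply: (eq0 _ C (fun=> True) C0).
    exact: filterT.
  by move=> m _; exact: (HC (csub c e)).
have Ek k : c.1.2 k = e.1.2 k /\ c.2 k = e.2 k.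
  have [Ck Ck0 HCk] := coefB k.
  pose Mk : n.-tuple nat := [tuple absz (tnth (val k) i) | i < n].
  have kM m : tle Mk m -> k \in rect m.
    by move=> Mm; apply/mem_set => i /=; have := Mm i; rewrite tnth_mktuple.
  by split; apply/eqP; rewrite -subr_eq0; apply/eqP; apply: (eq0 _ Ck (tle Mk) Ck0);
    try exact: near_tle; move=> m /kM km; have [] := HCk (csub c e) m km.
case: c e E0 Ek {cf ef small eq0} => -[c0 c1] c2 [[e0 e1] e2] /= -> Ek.
by congr (_, _, _); apply/funext => k; have [] := Ek k.
Unshelve. all: end_near. Qed.

(** Finite sums [c i] approach [f] at the rate [1 / (i + 1)]. Their coefficients are Cauchy by the
    coefficient bounds, and the limits are the coefficients of [f]: the projection bound, uniform in
    the rectangle, makes all its large partial sums close to [f]. *)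
Lemma criterion_exists (f : Rn R n -> R) : f \in LL ->
  exists c : coefs R n, nm (fun x => f x - rs c m x) @[m --> @pringsheim n] --> 0.
Proof.
move=> fL.
have eps0 i : 0 < i.+1%:R^-1 :> R by rewrite invr_gt0.
have /choice[cM HcM] : forall i : nat, exists p : coefs R n * n.-tuple nat,
    nm (fun x => f x - rs p.1 p.2 x) < i.+1%:R^-1.
  by move=> i; have [c [M H]] := dense fL (eps0 i); exists (c, M).
(* After [cut], the approximation is equally good on every rectangle containing [M i]. *)
pose M i := (cM i).2; pose c i := cut (cM i).1 (M i).
have approx i m : tle (M i) m -> nm (fun x => f x - rs (c i) m x) <= i.+1%:R^-1.
  move=> Mm; apply: ltW; apply: le_lt_trans (HcM i); rewrite le_eqVlt; apply/orP; left.
  by apply/eqP; apply: nm_eq => x; rewrite rs_cut.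
have diff i j m : tle (M i) m -> tle (M j) m ->
    nm (rs (csub (c i) (c j)) m) <= i.+1%:R^-1 + j.+1%:R^-1.
  move=> Mi Mj; rewrite (nm_eq _ _ (fun x => rs_sub u v (c i) (c j) m x)).
  rewrite (_ : nm _ = nm (fun x => (f x - rs (c j) m x) - (f x - rs (c i) m x))); last first.
    by apply: nm_eq => x; ring.
  apply: (le_trans (nm_sub q1 (LL_sub q1 fL (rs_LL _ _)) (LL_sub q1 fL (rs_LL _ _)))).
  by rewrite addrC; apply: lerD; exact: approx.
have [C0 C00 HC0] := coefB0.
have [a0 Ha0] : exists l, forall i, `|l - (c i).1.1| <= C0 * i.+1%:R^-1.
  apply: harmonic_cauchy => // i j.
  apply: (le_trans (HC0 (csub (c i) (c j)) (tmax (M i) (M j)))).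
  by apply: ler_wpM2l => //; apply: diff; [exact: tle_maxl|exact: tle_maxr].
have coefk k : exists2 Ck, 0 <= Ck & 
    (exists l, forall i, `|l - (c i).1.2 k| <= Ck * i.+1%:R^-1) /\
    (exists l, forall i, `|l - (c i).2 k| <= Ck * i.+1%:R^-1).
  have [Ck Ck0 HCk] := coefB k; exists Ck => //.
  pose Mk : n.-tuple nat := [tuple absz (tnth (val k) i) | i < n].
  have kM m : tle Mk m -> k \in rect m.
    by move=> Mm; apply/mem_set => i /=; have := Mm i; rewrite tnth_mktuple.
  split; apply: harmonic_cauchy => // i j.
  - have [|H _] := HCk (csub (c i) (c j)) (tmax Mk (tmax (M i) (M j))).
      by apply: kM; exact: tle_maxl.
    apply: (le_trans H); apply: ler_wpM2l => //; apply: diff.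
      by apply: tle_trans (tle_maxr _ _); exact: tle_maxl.
    by apply: tle_trans (tle_maxr _ _); exact: tle_maxr.
  - have [|_ H] := HCk (csub (c i) (c j)) (tmax Mk (tmax (M i) (M j))).
      by apply: kM; exact: tle_maxl.
    apply: (le_trans H); apply: ler_wpM2l => //; apply: diff.
      by apply: tle_trans (tle_maxr _ _); exact: tle_maxl.
    by apply: tle_trans (tle_maxr _ _); exact: tle_maxr.
have /choice[Ck Hk] : forall k, exists Ck, 0 <= Ck /\
    (exists l, forall i, `|l - (c i).1.2 k| <= Ck * i.+1%:R^-1) /\
    (exists l, forall i, `|l - (c i).2 k| <= Ck * i.+1%:R^-1).
  by move=> k; have [Ck ? ?] := coefk k; exists Ck.
have /choice[a Ha] := fun k => (Hk k).2.1.
have /choice[b Hb] := fun k => (Hk k).2.2.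
pose cl : coefs R n := (a0, a, b); exists cl.
have lim m (eps : R) : 0 < eps -> exists j, (forall i, (i >= j)%N ->
    nm (fun x => rs cl m x - rs (c i) m x) <= eps).
  move=> e0; have [D D0 HD] := nm_rs_le cl m.
  have dD : 0 < eps / (D + 1) by rewrite divr_gt0 // ltr_wpDl.
  have Ck0 k : 0 <= Ck k by have [] := Hk k.
  have S0 : 0 <= \sum_(k <- erect m) Ck k by apply: sumr_ge0.
  have [j Hj] := harmonic_small (addr_ge0 C00 S0) dD.
  exists j => i ji; have Hi := Hj i ji.
  have i0 : 0 <= i.+1%:R^-1 :> R by rewrite invr_ge0.
  rewrite (nm_distC q1 (rs_LL _ _) (rs_LL _ _)).
  apply: (@le_trans _ _ (eps / (D + 1) * D)).
    apply: HD => /= [|k km].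
      rewrite distrC; apply: le_trans (Ha0 i) _; apply: le_trans Hi.
      by rewrite ler_wpM2r // lerDl.
    have CS : Ck k * i.+1%:R^-1 <= eps / (D + 1).
      apply: le_trans Hi; rewrite ler_wpM2r //.
      rewrite (big_rem k) /=; last by rewrite mem_erect.
      by rewrite addrCA lerDl addr_ge0 // sumr_ge0.
    split; rewrite distrC; apply: le_trans CS; [exact: Ha|exact: Hb].
  rewrite mulrAC ler_pdivrMr ?ltr_wpDl //.
  by rewrite ler_wpM2l ?(ltW e0) // lerDl.
have close i m : tle (M i) m ->
    nm (fun x => f x - rs cl m x) <= i.+1%:R^-1 + 2 * K * i.+1%:R^-1.
  move=> Mi; apply/ler_addgt0Pr => eps e0.
  have [j Hj] := lim m eps e0.
  (* [j' >= j] lets [cl] be replaced by [c j'] on [rect m] up to [eps]; [j' >= i] bounds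
     [1 / (j' + 1)] by [1 / (i + 1)]. *)
  pose j' := maxn i j.
  have := Hj j' (leq_maxr _ _) => Hj'.
  rewrite (_ : nm _ = nm (fun x => (f x - rs (c i) m x) +
    ((rs (c i) m x - rs (c j') m x) - (rs cl m x - rs (c j') m x)))); last first.
    by apply: nm_eq => x; ring.
  have L1 := LL_sub q1 fL (rs_LL (c i) m).
  have L2 := LL_sub q1 (rs_LL (c i) m) (rs_LL (c j') m).
  have L3 := LL_sub q1 (rs_LL cl m) (rs_LL (c j') m).
  apply: (le_trans (nm_add q1 L1 (LL_sub q1 L2 L3))).
  rewrite -addrA; apply: lerD; first exact: approx.
  apply: (le_trans (nm_sub q1 L2 L3)); apply: lerD => //.
  rewrite (nm_eq _ _ (fun x => esym (rs_sub u v (c i) (c j') m x))).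
  (* [rect m] may fail to contain [M j']; on the joint rectangle, which contains both [M i] and
     [M j'], [diff] applies. *)
  apply: (le_trans (projB _ (tle_maxl m (M j')))).
  rewrite (_ : 2 * K * i.+1%:R^-1 = K * (2 * i.+1%:R^-1)); last by ring.
  apply: ler_wpM2l => //.
  apply: (le_trans (diff _ _ _ _ _)).
  - exact: tle_trans Mi (tle_maxl _ _).
  - exact: tle_maxr.
  rewrite mulr2n mulrDl mul1r lerD2l lef_pV2 ?posrE // ler_nat ltnS; exact: leq_maxl.
apply/cvgrPdist_le => eps e0.
have K1 : 0 < 1 + 2 * K by rewrite ltr_pwDl // mulr_ge0.
have [i Hi] : exists i : nat, (1 + 2 * K) * i.+1%:R^-1 <= eps.
  by have [j Hj] := harmonic_small (ltW K1) e0; exists j; exact: Hj.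
near=> m; rewrite sub0r normrN ger0_norm ?nm_ge0 //.
apply: le_trans Hi; rewrite mulrDl mul1r; apply: close.
by near: m; exact: near_tle.
Unshelve. all: end_near. Qed.

End criterion.

(** * Fourier series of the triangular waves *)

Section triangular_wave.
Variable R : realType.

(** The distance from [y] to the nearest integer, by [distZ_le] and [distZ_attained]; its triangle
    inequality gives the Lipschitz bound for [Ctri]. *)
Definition distZ (y : R) : R := (1 - Ctri y) / 4.

Lemma CtriE (y : R) : Ctri y = 1 - 4 * distZ y.
Proof. by rewrite /distZ; field. Qed.

Lemma distZE (y : R) : distZ y = 1 / 2 - `|y - (Num.floor y)%:~R - 1 / 2|.
Proof. by rewrite /distZ /Ctri /periodize; field. Qed.

Lemma floor_bounds (y : R) : (Num.floor y)%:~R <= y /\ y < (Num.floor y)%:~R + 1.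
Proof. by have /andP[h0 h1] := floor_itv y; split => //; move: h1; rewrite intrD. Qed.

Lemma distZ_le (y : R) (m : int) : distZ y <= `|y - m%:~R|.
Proof.
rewrite distZE; have [k0 k1] := floor_bounds y.
move: k0 k1; set k := Num.floor y => k0 k1.
have := ler_norm (y - k%:~R - 1 / 2).
have := ler_norm (- (y - k%:~R - 1 / 2)); rewrite normrN.
move: `|y - k%:~R - 1 / 2| => a a1 a2.
have [mk|km] := leP m k.
  have mk' : m%:~R <= k%:~R :> R by rewrite ler_int.
  by have := ler_norm (y - m%:~R); lra.
have km' : k%:~R + 1 <= m%:~R :> R.
  by rewrite (_ : k%:~R + 1 = (k + 1)%:~R) ?ler_int ?lezD1 // intrD.
by have := ler_norm (- (y - m%:~R)); rewrite normrN; lra.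
Qed.

Lemma distZ_attained (y : R) : exists m : int, distZ y = `|y - m%:~R|.
Proof.
rewrite distZE; have [k0 k1] := floor_bounds y.
move: k0 k1; set k := Num.floor y => k0 k1.
have [r2|/ltW r2] := lerP (y - k%:~R) (1 / 2).
  exists k; have -> : `|y - k%:~R| = y - k%:~R by rewrite ger0_norm // subr_ge0.
  by lra.
exists (k + 1); rewrite intrD.
have -> : `|y - (k%:~R + 1)| = - (y - (k%:~R + 1)) by rewrite ler0_norm //; lra.
by lra.
Qed.

Lemma distZ_half (y : R) : distZ y <= 1 / 2.
Proof. by rewrite distZE gerBl. Qed.

Lemma distZ_sub (s t : R) : distZ t <= distZ s + distZ (t - s).
Proof.
have [m ->] := distZ_attained s; have [m' ->] := distZ_attained (t - s).
apply: (le_trans (distZ_le t (m + m'))).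
rewrite (_ : t - (m + m')%:~R = (s - m%:~R) + (t - s - m'%:~R)); last by rewrite intrD; ring.
exact: ler_normD.
Qed.

(** With [x = pi r / 2], [sin(2 x) = 2 sin x cos x] and [sin x = x cos c] by the mean value theorem.
    Both cosines are at least [cos(pi / 4)], so the sine is at least [x], and [x >= r] because
    [pi >= 2]. *)
Lemma sin_pi_ge (r : R) : 0 <= r -> r <= 1 / 2 -> r <= sin (pi * r).
Proof.
move=> r0 r1; have p0 := pi_gt0 R; have p2 := pi_ge2 R.
pose x := pi * r / 2; have x0 : 0 <= x by rewrite /x divr_ge0 // mulr_ge0 // ltW.
have x4 : x <= pi / 4 by rewrite /x; nra.
have c4 : cos (pi / 4) ^+ 2 = 1 / 2 :> R.
  have := cos_pihalf R; rewrite (_ : pi / 2 = pi / 4 + pi / 4); last by field.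
  rewrite cosD -!expr2 sin2cos2; lra.
have c40 : 0 <= cos (pi / 4 : R) by apply: cos_ge0_pihalf; lra.
have cosle (z : R) : 0 <= z -> z <= pi / 4 -> cos (pi / 4) <= cos z.
  by move=> z0 z4; rewrite leNgt ltr_cos ?in_itv /= -?leNgt //; lra.
have [c /andP[cx0 cx]] := MVT1 (fun z : R => is_derive_sin z) x0.
rewrite sin0 !subr0 => sx.
have -> : pi * r = x + x by rewrite /x; field.
rewrite sinD sx.
have h1 := cosle c cx0 (le_trans cx x4); have h2 := cosle x x0 x4.
have h3 : 1 / 2 <= cos c * cos x.
  by rewrite -c4 expr2; apply: ler_pM.
rewrite (_ : _ + _ = 2 * x * (cos c * cos x)); last by ring.
have : 2 * x * (1 / 2) <= 2 * x * (cos c * cos x).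
  by rewrite ler_wpM2l // mulr_ge0.
apply: le_trans; rewrite /x; nra.
Qed.

Lemma distZ_sin (y : R) : distZ y <= `|sin (pi * y)|.
Proof.
have [m E] := distZ_attained y; have := distZ_half y; rewrite E.
set s := y - m%:~R => s2.
have sq (z : R) : sin (pi * z) ^+ 2 = (1 - cos (2 * pi * z)) / 2.
  rewrite (_ : 2 * pi * z = pi * z + pi * z); last by ring.
  by rewrite cosD -!expr2 cos2sin2; field.
have -> : `|sin (pi * y)| = `|sin (pi * s)|.
  apply/eqP; rewrite -(@eqrXn2 _ 2) // -!normrX !ger0_norm ?sqr_ge0 // !sq.
  rewrite (_ : 2 * pi * y = 2 * pi * s + freq R m); last by rewrite /s /freq; ring.
  by rewrite cosDfreq.
have -> : `|sin (pi * s)| = `|sin (pi * `|s|)|.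
  have [s0|/ltW s0] := leP 0 s; first by rewrite (ger0_norm s0).
  by rewrite (ler0_norm s0) mulrN sinN normrN.
by apply: le_trans (ler_norm _); exact: sin_pi_ge.
Qed.

(** The modulus of continuity in the form that [fejer_approx] takes; it follows from subadditivity
    of [distZ] and its bound by the sine. *)
Lemma Ctri_lipschitz (t x : R) : `|Ctri t - Ctri x| <= 4 * `|sin (pi * (x - t))|.
Proof.
rewrite !CtriE.
have H1 := distZ_sub x t; have H2 := distZ_sub t x.
have S1 := distZ_sin (x - t); have := distZ_sin (t - x).
rewrite -(opprB x t) mulrN sinN normrN => S2.
rewrite -(opprB x t) in H1.
by rewrite ler_norml; move: H1 H2 S1 S2; move: `|_| => a; lra.
Qed.

Lemma continuous_lip_sin (f : R -> R) (C : R) : 0 < C ->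
  (forall t x, `|f t - f x| <= C * `|sin (pi * (x - t))|) -> continuous f.
Proof.
move=> C0 Lip x; apply/cvgrPdist_le => e e0.
have cs : {for x, continuous (fun z => sin (pi * z + - (pi * x)))}.
  apply: (@cont_comp _ (fun z => pi * z + - (pi * x))); first exact: cont_affine.
  exact: continuous_sin.
have eC : 0 < e / C by rewrite divr_gt0.
move/cvgrPdist_le : cs => /(_ _ eC); apply: filterS => z.
rewrite subrr sin0 sub0r normrN -mulrBr => H.
by apply: (le_trans (Lip x z)); rewrite mulrC -ler_pdivlMr.
Qed.

Lemma continuous_Ctri : continuous (@Ctri R).
Proof. by apply: (@continuous_lip_sin _ 4) => // t x; exact: Ctri_lipschitz. Qed.

Lemma Ctri01 (x : R) : 0 <= x -> x <= 1 -> Ctri x = 4 * `|x - 1 / 2| - 1.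
Proof.
move=> x0 x1; have E (y : R) : Ctri y = 4 * `|y - (Num.floor y)%:~R - 1 / 2| - 1 by [].
rewrite E; have [->|xn1] := eqVneq x 1.
  by rewrite floor1 mulr1z subrr sub0r normrN; congr (4 * `|_| - 1); field.
have -> : Num.floor x = 0; last by rewrite mulr0z subr0.
by apply/eqP; rewrite floor_eq mulr0z x0 add0r mulr1z lt_neqAle xn1.
Qed.

End triangular_wave.

(** * The cosine series of C with an explicit remainder *)

Section tri_fourier.
Variable R : realType.

Lemma Rintegral_FTC (f F : R -> R) (a b : R) : a < b -> continuous f ->
  (forall x : R, is_derive x 1 F (f x)) ->
  \int[@lebesgue_measure R]_(x in `[a, b]) f x = F b - F a.
Proof.
move=> ab cf dF.
have dF' (x : R) : derivable F x 1 by have [] := dF x.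
have cF : continuous F by move=> x; apply/differentiable_continuous/derivable1_diffP/dF'.
rewrite /Rintegral (@continuous_FTC2 _ f F)//.
- exact: continuous_subspaceT.
- split.
  + by move=> x _; exact: dF'.
  + by apply: cvg_at_right_filter; exact: cF.
  + by apply: cvg_at_left_filter; exact: cF.
- by move=> x _; rewrite derive1E; have [] := dF x.
Qed.

Lemma mean_half (f : R -> R) : continuous f ->
  mean f = \int[@lebesgue_measure R]_(x in `[0, 1 / 2]) f x +
           \int[@lebesgue_measure R]_(x in `[1 / 2, 1]) f x.
Proof.
move=> cf.
have if01 := continuous_integrable01 cf.
have := @Rintegral_itvB R f (BLeft 0) (BRight 1) (1 / 2) if01.
rewrite !bnd_simp => /(_ _ _) H.
have cc : (@lebesgue_measure R).-integrable `[1 / 2, 1] (EFin \o f).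
  apply: continuous_compact_integrable; first exact: segment_compact.
  exact: continuous_subspaceT.
have io : (@lebesgue_measure R).-integrable `]1 / 2, 1] (EFin \o f).
  by apply: integrableS cc => //; exact: subset_itv_oc_cc.
rewrite -(Rintegral_itv_obnd_cbnd io) -H; [|lra|lra].
by rewrite addrC subrK.
Qed.

Lemma cos_half_even (j : int) (d : R) : cos (freq R (2 * j) * (1 / 2) + d) = cos d.
Proof.
rewrite (_ : freq R (2 * j) * (1 / 2) + d = d + freq R j) ?cosDfreq //.
by rewrite freqM addrC; field.
Qed.

Lemma cos_half_odd (j : int) (d : R) : cos (freq R (2 * j + 1) * (1 / 2) + d) = - cos d.
Proof.
rewrite (_ : freq R (2 * j + 1) * (1 / 2) + d = d + pi + freq R j) ?cosDfreq ?cosDpi //.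
by rewrite freqD freqM /freq; field.
Qed.

Lemma sin_freq1 k (d : R) : sin (freq R k * 1 + d) = sin (freq R k * 0 + d).
Proof. by rewrite -!cosBpihalf -!addrA cos_freq1. Qed.

(** [Ctri] is [1 - 4 t] and [4 t - 3] on the two halves of the period. Integrating by parts, the
    boundary terms with sines cancel by continuity and periodicity; what remains are the jumps of
    the slope at 0 and 1/2. *)
Lemma mean_Ctri_cos k (d : R) : k != 0 ->
  mean (fun t => Ctri t * cos (freq R k * t + d)) =
  8 / freq R k ^+ 2 * (cos d - cos (freq R k * (1 / 2) + d)).
Proof.
move=> k0; have f0 := freq_neq0 R k0.
have E (a b : R) : continuous (fun t => (a * t + b) * cos (freq R k * t + d)) /\
    forall x : R, is_derive x 1 (fun t => (a * t + b) * ((freq R k)^-1 * sin (freq R k * t + d)) +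
      a * ((freq R k)^-2 * cos (freq R k * t + d))) ((a * x + b) * cos (freq R k * x + d)).
  split; first by apply: cont_mul; [exact: cont_affine|exact: cont_cosM].
  move=> x.
  have d1 : is_derive x 1 (fun t => a * t + b) (1 * a).
    by apply: (@is_derive1_affine _ id) => //; exact: is_derive_id.
  have d2 : is_derive x 1 (fun t => (freq R k)^-1 * sin (freq R k * t + d))
      ((freq R k)^-1 * (cos (freq R k * x + d) * freq R k)).
    by apply: is_derive1Z; apply: is_derive1_affine.
  have d3 : is_derive x 1 (fun t => a * ((freq R k)^-2 * cos (freq R k * t + d)))
      (a * ((freq R k)^-2 * (- sin (freq R k * x + d) * freq R k))).
    by do 2 apply: is_derive1Z; apply: is_derive1_affine.
  apply: is_derive_eq (is_derive1D (is_derive1M d1 d2) d3) _.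
  by field.
have cC : continuous (fun t => Ctri t * cos (freq R k * t + d)).
  by apply: cont_mul; [exact: continuous_Ctri|exact: cont_cosM].
rewrite (mean_half cC).
have [c1 D1] := E (-4) 1; have [c2 D2] := E 4 (-3).
rewrite (_ : \int[@lebesgue_measure R]_(x in `[0, 1 / 2]) _ =
  \int[@lebesgue_measure R]_(x in `[0, 1 / 2]) ((-4 * x + 1) * cos (freq R k * x + d))); last first.
  apply: eq_Rintegral => x; rewrite inE /= in_itv /= => /andP[x0 x1].
  by rewrite Ctri01; [rewrite ler0_norm; [congr (_ * _); field|lra]|lra|lra].
rewrite (_ : \int[@lebesgue_measure R]_(x in `[1 / 2, 1]) _ =
  \int[@lebesgue_measure R]_(x in `[1 / 2, 1]) ((4 * x + -3) * cos (freq R k * x + d))); last first.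
  apply: eq_Rintegral => x; rewrite inE /= in_itv /= => /andP[x0 x1].
  by rewrite Ctri01; [rewrite ger0_norm; [congr (_ * _); field|lra]|lra|lra].
rewrite (Rintegral_FTC _ c1 D1); last lra.
rewrite (Rintegral_FTC _ c2 D2); last lra.
rewrite sin_freq1 cos_freq1 !mulr0 !add0r.
by field.
Qed.

Lemma mean_Ctri : mean (@Ctri R) = 0.
Proof.
have E (a b : R) : continuous (fun t : R => 2 * a * t + b) /\
    forall x : R, is_derive x 1 (fun t => (a * t + b) * t) (2 * a * x + b).
  split; first exact: cont_affine.
  move=> x.
  have d1 : is_derive x 1 (fun t => a * t + b) (1 * a).
    by apply: (@is_derive1_affine _ id) => //; exact: is_derive_id.
  have d2 : is_derive x 1 (fun t : R => t) 1 by exact: is_derive_id.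
  by apply: is_derive_eq (is_derive1M d1 d2) _; ring.
rewrite (mean_half (@continuous_Ctri R)).
have [c1 D1] := E (-2) 1; have [c2 D2] := E 2 (-3).
rewrite (_ : \int[@lebesgue_measure R]_(x in `[0, 1 / 2]) _ =
  \int[@lebesgue_measure R]_(x in `[0, 1 / 2]) (2 * -2 * x + 1)); last first.
  apply: eq_Rintegral => x; rewrite inE /= in_itv /= => /andP[x0 x1].
  by rewrite Ctri01; [rewrite ler0_norm; lra|lra|lra].
rewrite (_ : \int[@lebesgue_measure R]_(x in `[1 / 2, 1]) _ =
  \int[@lebesgue_measure R]_(x in `[1 / 2, 1]) (2 * 2 * x + -3)); last first.
  apply: eq_Rintegral => x; rewrite inE /= in_itv /= => /andP[x0 x1].
  by rewrite Ctri01; [rewrite ger0_norm; lra|lra|lra].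
rewrite (Rintegral_FTC _ c1 D1); last lra.
rewrite (Rintegral_FTC _ c2 D2); last lra.
by field.
Qed.

Definition weight (i : nat) : R := (2 * i + 1)%:R ^- 2.

(** The integers congruent to 1 modulo 4 in the order 1, -3, 5, -7, ..., that is by absolute value
    [2 i + 1], which matches [weight i]. *)
Definition jidx (i : nat) : int := 1 + 4 * (if odd i then - (i./2.+1)%:Z else (i./2)%:Z).

Definition gam : R := 8 / pi ^+ 2.

Lemma gam_gt0 : 0 < gam.
Proof. by rewrite divr_gt0 // exprn_gt0 // pi_gt0. Qed.

Lemma absz_jidx i : absz (jidx i) = (2 * i + 1)%N.
Proof.
rewrite /jidx; have := odd_double_half i; case: (odd i); move: (i./2) => h; lia.
Qed.

Lemma cos_freq_abs (k : int) (x : R) : cos (freq R (absz k)%:Z * x) = cos (freq R k * x).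
Proof.
by case: k => k //=; rewrite NegzE freqN mulNr cosN.
Qed.

(** The summand of frequency [k] in the Fejer mean of [Ctri] at [x], in the shape produced by
    [mean_fejer_mul]. *)
Definition fcoef (x : R) (k : int) : R :=
  mean (fun t => Ctri t * cos (- freq R k * t + freq R k * x)).

Lemma fcoef_even x (j : int) : fcoef x (2 * j) = 0.
Proof.
have [->|j0] := eqVneq j 0.
  rewrite /fcoef mulr0 -[RHS]mean_Ctri; apply: eq_mean => t.
  by rewrite freq0 oppr0 !mul0r addr0 cos0 mulr1.
rewrite /fcoef -freqN (_ : - (2 * j) = 2 * - j); last by rewrite mulrN.
rewrite mean_Ctri_cos; last by rewrite mulf_neq0 // oppr_eq0.
by rewrite cos_half_even subrr mulr0.
Qed.

Lemma fcoef_odd x (j : int) :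
  fcoef x (2 * j + 1) = gam / 2 * ((2 * j + 1)%:~R ^- 2 * cos (freq R (2 * j + 1) * x)).
Proof.
have k0 : 2 * j + 1 != 0 by lia.
rewrite /fcoef -freqN mean_Ctri_cos ?oppr_eq0 //.
rewrite (_ : - (2 * j + 1) = 2 * (- j - 1) + 1); last by lia.
rewrite cos_half_odd (_ : 2 * (- j - 1) + 1 = - (2 * j + 1)); last by lia.
rewrite freqN /gam; move: (cos _) => c; rewrite /freq.
have p0 : (pi : R) != 0 by rewrite gt_eqF // pi_gt0.
have kR : (2 * j + 1)%:~R != 0 :> R by rewrite intr_eq0.
by move: (_%:~R) kR pi p0 => a a0 b b0; field; rewrite a0 b0.
Qed.

Definition dsum (e : int -> R) (m : nat) : R := e 0 + \sum_(1 <= k < m.+1) (e k%:Z + e (- k%:Z)).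

(** Going from [N] to [N + 1] adds one row, one column and a corner, whose differences run once
    through the integers from [- N] to [N]. So Fejer means are Cesaro means of symmetric partial
    sums. *)
Lemma double_sum_dsum (e : int -> R) N :
  \sum_(0 <= j < N) \sum_(0 <= l < N) e (j%:Z - l%:Z) = \sum_(0 <= m < N) dsum e m.
Proof.
elim: N => [|N IH]; first by rewrite !big_geq.
rewrite [RHS]big_nat_recr //= -IH big_nat_recr //=.
under eq_bigr do rewrite big_nat_recr //=.
rewrite big_split /= -addrA; congr (_ + _).
rewrite big_nat_recr //= subrr addrA addrC /dsum; congr (_ + _).
rewrite big_split /= addrC; congr (_ + _).
  rewrite big_nat_rev /= [RHS]big_add1 /=; apply: eq_big_nat => l /andP[_ lN].
  by congr e; lia.
rewrite big_nat_rev /= [RHS]big_add1 /=; apply: eq_big_nat => l /andP[_ lN].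
by congr e; lia.
Qed.

Definition osum (x : R) (I : nat) : R :=
  \sum_(0 <= i < I) weight i * cos (freq R (jidx i) * x).

(** Even frequencies contribute nothing, and for odd [k] the terms of [k] and [- k] coincide;
    [uphalf m] counts the odd numbers up to [m]. The signs in [jidx] do not matter here, the cosine
    being even. *)
Lemma dsum_fcoef x m : dsum (fcoef x) m = gam * osum x (uphalf m).
Proof.
elim: m => [|m IH].
  by rewrite /dsum /osum !big_geq // addr0 mulr0 (fcoef_even x 0).
rewrite /dsum big_nat_recr //= addrA -/(dsum _ _) IH.
have [om|em] := boolP (odd m).
  have -> : m.+1%:Z = 2 * (m./2.+1)%:Z by have := odd_double_half m; rewrite om; lia.
  by rewrite -mulrN !fcoef_even !addr0 uphalf_half om add1n.
have h : uphalf m = m./2 by move: em; rewrite uphalf_half; case: (odd m).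
rewrite h /osum [in RHS]big_nat_recr //= mulrDr; congr (_ + _).
have E : m.+1%:Z = 2 * (m./2)%:Z + 1 by have := odd_double_half m; rewrite (negbTE em); lia.
rewrite E fcoef_odd (_ : - _ = 2 * (- (m./2)%:Z - 1) + 1); last by lia.
rewrite fcoef_odd (_ : 2 * (- (m./2)%:Z - 1) + 1 = - (2 * (m./2)%:Z + 1)); last by lia.
rewrite freqN mulNr cosN mulrNz sqrrN -cos_freq_abs.
rewrite -[in RHS]cos_freq_abs absz_jidx.
have -> : absz (2 * (m./2)%:Z + 1) = (2 * m./2 + 1)%N by lia.
rewrite /weight (_ : (2 * (m./2)%:Z + 1)%:~R = (2 * m./2 + 1)%:R :> R).
  have : (2 * m./2 + 1)%:R != 0 :> R by rewrite pnatr_eq0 addn1.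
  by move: ((2 * m./2 + 1)%:R : R) (cos _) => a c a0; field.
by rewrite natrD natrM intrD intrM.
Qed.

(** A telescoping bound: [4 i (i + 1) <= (2 i + 1)^2]. At [I = 0] it yields the 1/4 of the
    perturbation argument. *)
Lemma weight_tail (I J : nat) : (I <= J)%N ->
  \sum_(I.+1 <= i < J.+1) weight i <= 1 / 4 * (I.+1%:R^-1 - J.+1%:R^-1).
Proof.
elim: J => [|J IH]; first by rewrite leqn0 => /eqP ->; rewrite big_geq // subrr mulr0.
rewrite leq_eqVlt => /predU1P[->|]; first by rewrite big_geq // subrr mulr0.
rewrite ltnS => IJ; rewrite big_nat_recr //=.
apply: (le_trans (lerD (IH IJ) (lexx _))).
suff H : weight J.+1 <= 1 / 4 * (J.+1%:R^-1 - J.+2%:R^-1).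
  by apply: (le_trans (lerD (lexx _) H)); rewrite -mulrDr addrA subrK.
rewrite /weight.
have -> : (2 * J.+1 + 1)%:R = 2 * J.+1%:R + 1 :> R by rewrite natrD natrM.
have -> : J.+2%:R = J.+1%:R + 1 :> R by rewrite -addn1 natrD.
have : 0 < J.+1%:R :> R by [].
move: (J.+1%:R) => a a0.
rewrite -subr_ge0 (_ : _ - _ = (4 * a * (a + 1) * (2 * a + 1) ^+ 2)^-1); last first.
  by field; rewrite !gt_eqF //; lra.
by rewrite invr_ge0 !mulr_ge0 ?sqr_ge0 //; lra.
Qed.

Lemma weight_ge0 i : 0 <= weight i.
Proof. by rewrite /weight invr_ge0 sqr_ge0. Qed.

Lemma osum_cauchy x (I J : nat) :
  `|osum x I.+1 - osum x J.+1| <= 1 / 4 * (I.+1%:R^-1 + J.+1%:R^-1).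
Proof.
wlog IJ : I J / (I <= J)%N => [H|].
  have [IJ|/ltnW JI] := leqP I J; first exact: H.
  by rewrite distrC (addrC I.+1%:R^-1); exact: H.
rewrite distrC /osum [X in X - _](@big_cat_nat _ _ _ I.+1) //= addrAC subrr add0r.
apply: (le_trans (ler_norm_sum _ _ _)).
apply: (@le_trans _ _ (\sum_(I.+1 <= i < J.+1) weight i)).
  apply: ler_sum => i _; rewrite normrM (ger0_norm (weight_ge0 i)) ler_piMr ?weight_ge0 //.
  by rewrite ler_norml cos_geN1 cos_le1.
apply: (le_trans (weight_tail IJ)).
have : 0 <= J.+1%:R^-1 :> R by rewrite invr_ge0.
by move: (J.+1%:R^-1) (I.+1%:R^-1) => a b; lra.
Qed.

(** The partial sums converge with this rate by [osum_cauchy]. The limit is identified through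
    Cesaro means: these converge to the same limit, and, being Fejer means, to [Ctri x]. *)
Lemma tri_cos_series x I :
  `|gam^-1 * Ctri x - osum x I.+1| <= 1 / 4 * I.+1%:R^-1.
Proof.
have [||l Hl] := @harmonic_cauchy R (fun i => osum x i.+1) (1 / 4); first by lra.
  exact: osum_cauchy.
suff -> : gam^-1 * Ctri x = l by exact: Hl.
have g0 := gam_gt0.
have cvgD : dsum (fcoef x) @ \oo --> gam * l.
  apply/cvgrPdist_le => eps e0.
  have [j Hj] := harmonic_small (ltW (divr_gt0 g0 (ltr0n R 4))) e0.
  exists (2 * j + 2)%N => // m /= jm; rewrite dsum_fcoef -mulrBr normrM gtr0_norm //.
  have [i ij ->] : exists2 i, (j <= i)%N & uphalf m = i.+1.
    have hm : (j < uphalf m)%N.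
      by rewrite uphalf_half; have := odd_double_half m; case: (odd m) => /=; rewrite -addnn; lia.
    by exists (uphalf m).-1; [rewrite -ltnS prednK //; apply: leq_ltn_trans hm|rewrite prednK //; apply: leq_ltn_trans hm].
  apply: (le_trans (ler_wpM2l (ltW g0) (Hl i))).
  apply: le_trans (Hj i ij); rewrite le_eqVlt; apply/orP; left; apply/eqP.
  by move: (i.+1%:R^-1) => a; field.
have cvgS := cesaro cvgD.
have cvgC : arithmetic_mean (dsum (fcoef x)) @ \oo --> Ctri x.
  apply/cvgrPdist_le => eps e0.
  (* The error is [4 (eta + 1 / (eta (N + 1)))], and for large [N] both summands in the parentheses
     are at most [eps / 8]. *)
  pose eta := eps / 8; have eta0 : 0 < eta by rewrite divr_gt0.
  have etai : 0 <= 8 / eps by rewrite divr_ge0 // ltW.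
  have [j Hj] := harmonic_small etai eta0.
  exists j => // N /= jN; rewrite distrC.
  have -> : arithmetic_mean (dsum (fcoef x)) N =
      mean (fun t => Ctri t * fejer N.+1 (x - t)).
    rewrite mean_fejer_mul; last exact: continuous_Ctri.
    by rewrite (double_sum_dsum (fcoef x)) /arithmetic_mean /series /= mulrC.
  have := @fejer_approx R _ 4 eta N.+1 x isT eta0 _ (@continuous_Ctri R) (@Ctri_lipschitz R).
  move=> /(_ (ler0n _ _)) H; apply: (le_trans H).
  have -> : (eta * N.+1%:R)^-1 = 8 / eps * N.+1%:R^-1 by rewrite invfM /eta invf_div.
  by have := Hj N jN; rewrite /eta; move: (_ * _) => a; lra.
have E : Ctri x = gam * l.
  by rewrite -(cvg_lim (@norm_hausdorff _ R) cvgC) (cvg_lim (@norm_hausdorff _ R) cvgS).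
by rewrite E mulKf // gt_eqF.
Qed.

End tri_fourier.

(** * The sine series of S by a quarter-period shift *)

Section stri.
Variable R : realType.

Lemma StriE (y : R) : Stri y = Ctri (y - 1 / 4).
Proof.
have CE (z : R) (k : int) : k%:~R <= z -> z < k%:~R + 1 ->
    Ctri z = 4 * `|z - k%:~R - 1 / 2| - 1.
  move=> k0 k1; have : Num.floor z = k by apply/eqP; rewrite floor_eq k0 intrD.
  by rewrite /Ctri /periodize => ->.
have [k0 k1] := floor_bounds y.
have -> : Stri y = `|2 - 4 * `|y - (Num.floor y)%:~R - 1 / 4| | - 1 by [].
move: (Num.floor y) k0 k1 => k k0 k1.
(* The integer part of [y - 1 / 4] is that of [y], or one less. *)
have [r|r] : 1 / 4 <= y - k%:~R \/ y - k%:~R < 1 / 4.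
- by case: (leP (1 / 4) (y - k%:~R)) => _; [left|right].
- rewrite (CE _ k).
  + rewrite (_ : y - 1 / 4 - k%:~R - 1 / 2 = y - k%:~R - 3 / 4); last by field.
    rewrite (ger0_norm (x := y - k%:~R - 1 / 4)); last lra.
    rewrite (_ : 2 - 4 * _ = - (4 * (y - k%:~R - 3 / 4))); last by field.
    by rewrite normrN normrM ger0_norm.
  + lra.
  + lra.
- rewrite (CE _ (k - 1)); rewrite intrD.
  + rewrite (ltr0_norm (x := y - k%:~R - 1 / 4)); last lra.
    rewrite (ger0_norm (x := y - 1 / 4 - _ - _)); last lra.
    rewrite ger0_norm; lra.
  + lra.
  + lra.
Qed.

(** As [jidx i = 1 + 4 m], shifting the argument by 1/4 changes the phase by [- pi / 2] up to a
    multiple of the period. *)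
Lemma tri_sin_series (x : R) I :
  `|(gam R)^-1 * Stri x -
    \sum_(0 <= i < I.+1) weight R i * cos (freq R (jidx i) * x - pi / 2)| <= 1 / 4 * I.+1%:R^-1.
Proof.
rewrite StriE; have := tri_cos_series (x - 1 / 4) I; congr (`|_ - _| <= _).
apply: eq_bigr => i _; congr (_ * _); rewrite /jidx; move: (if _ then _ else _) => m.
rewrite -[RHS](cosDfreq (- m)); congr cos.
by rewrite freqN freqD freqM /freq; field.
Qed.

Lemma jidx0 : jidx 0 = 1. Proof. by []. Qed.

Lemma weight0 : weight R 0 = 1. Proof. by rewrite /weight expr1n invr1. Qed.

Lemma jidx_neq0 i : jidx i != 0.
Proof. by rewrite -absz_eq0 absz_jidx addn1. Qed.

Lemma Ctri0 : Ctri (0 : R) = 1.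
Proof. by rewrite Ctri01 // sub0r normrN ger0_norm //; field. Qed.

(** The cosine series at 0. The sum of the weights is the factor by which [T] multiplies
    constants. *)
Lemma weight_series I :
  `|(gam R)^-1 - \sum_(0 <= i < I.+1) weight R i| <= 1 / 4 * I.+1%:R^-1.
Proof.
have := @tri_cos_series R 0 I; rewrite Ctri0 mulr1; congr (`|_ - _| <= _).
by apply: eq_bigr => i _; rewrite mulr0 cos0 mulr1.
Qed.

End stri.

(** * Density of trigonometric polynomials *)

Section density.
Context d (X : measurableType d) (R : realType) (mu : {measure set X -> \bar R}).
Variable q : R.
Hypothesis q1 : 1 < q.
Hypothesis mu1 : mu setT = 1%E.

Local Notation LL := (Lfun mu q%:E).
Local Notation nm := (nm mu q).
Implicit Types f g : X -> R.

Let q0 : 0 < q. Proof. exact: lt_trans q1. Qed.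

Local Notation Iq f := (\int[mu]_x (`|f x| `^ q)%:E)%E.

Lemma measurable_Iq f : measurable_fun setT f -> measurable_fun setT (fun x => (`|f x| `^ q)%:E).
Proof.
move=> mf; apply/measurable_EFinP; apply: (@measurableT_comp _ _ _ _ _ _ (fun y : R => y `^ q)).
  exact: measurable_powR.
exact: measurableT_comp.
Qed.

Lemma Iq_lty f : f \in LL -> (Iq f < +oo)%E.
Proof.
move=> fL; have := LnormE q1 fL; rewrite Lnorm_int => E.
by apply: (@lty_poweRy _ _ q^-1); rewrite ?invr_eq0 ?gt_eqF // E ltry.
Qed.

Lemma Iq_le f g : measurable_fun setT f -> measurable_fun setT g -> (forall x, `|f x| <= `|g x|) ->
  (Iq f <= Iq g)%E.
Proof.
move=> mf mg fg; apply: ge0_le_integral => //.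
- exact: measurable_Iq.
- exact: measurable_Iq.
- by move=> x _; rewrite lee_fin; apply: ge0_ler_powR; rewrite ?nnegrE ?(ltW q0).
Qed.

Lemma LL_dominated f g : measurable_fun setT f -> g \in LL -> (forall x, `|f x| <= `|g x|) ->
  f \in LL.
Proof.
move=> mf gL fg; rewrite inE /=; apply/andP; split; first by rewrite inE.
rewrite inE /finLfun /= /finite_norm Lnorm_int; apply: poweR_lty.
exact: le_lt_trans (Iq_le mf (LL_measurable gL) fg) (Iq_lty gL).
Qed.

Lemma nm_le_Iq f (eps : R) : 0 <= eps -> f \in LL -> (Iq f <= (eps `^ q)%:E)%E -> nm f <= eps.
Proof.
move=> e0 fL H; rewrite -lee_fin -(LnormE q1) // Lnorm_int.
rewrite -[eps]powRr1 // -(divff (lt0r_neq0 q0)) powRrM -poweR_EFin.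
apply: gt0_ler_poweR => //.
- by rewrite invr_ge0 ltW.
- rewrite in_itv /= leey andbT; apply: integral_ge0 => x _.
  by rewrite lee_fin powR_ge0.
- by rewrite in_itv /= leey andbT lee_fin powR_ge0.
Qed.

(** Dominated convergence, applied to the [q]-th powers. *)
Lemma nm_dominated (f_ : nat -> X -> R) (g : X -> R) (eps : R) :
  (forall i, measurable_fun setT (f_ i)) -> g \in LL ->
  (forall i x, `|f_ i x| <= g x) ->
  {ae mu, forall x, f_ i x @[i --> \oo] --> (0 : R)} -> 0 < eps ->
  exists i, nm (f_ i) <= eps.
Proof.
move=> mf gL fg f0 e0.
have mg := LL_measurable gL.
have ig : mu.-integrable setT (fun x => (`|g x| `^ q)%:E).
  apply/integrableP; split; first exact: measurable_Iq.
  have := Iq_lty gL; congr (_ < _)%E; apply: eq_integral => x _.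
  by rewrite gee0_abs // lee_fin powR_ge0.
have H1 : {ae mu, forall x, setT x -> (`|f_ i x| `^ q)%:E @[i --> \oo] --> 0%E}.
  apply: filterS f0 => x fx _; apply: cvg_EFin; first exact: nearW.
  have c0 := @continuous_norm_powR R q q0 (0 : R).
  rewrite /continuous_at normr0 powR0 ?gt_eqF // in c0.
  exact: cvg_comp fx c0.
have H2 : {ae mu, forall x, forall i, setT x -> (`|(`|f_ i x| `^ q)%:E| <= (`|g x| `^ q)%:E)%E}.
  apply: aeW => x i _; rewrite gee0_abs ?lee_fin ?powR_ge0 //.
  by apply: ge0_ler_powR; rewrite ?nnegrE ?(ltW q0) // (le_trans (fg i x)) // ler_norm.
have [_ _] := @dominated_convergence _ _ _ mu setT measurableT
  (fun i x => (`|f_ i x| `^ q)%:E) (fun=> 0%E) (fun x => (`|g x| `^ q)%:E)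
  (fun i => measurable_Iq (mf i)) (measurable_cst _) H1 ig H2.
rewrite integral0 => /fine_cvg /cvgrPdist_lt /(_ (eps `^ q)).
rewrite powR_gt0 // => /(_ isT) [i _ Hi]; exists i.
have fL := LL_dominated (mf i) gL (fun x => le_trans (fg i x) (ler_norm _)).
apply: nm_le_Iq => //; first exact: ltW.
have := Hi i (leqnn i) => /=; rewrite sub0r normrN ger0_norm; last first.
  by apply: fine_ge0; apply: integral_ge0 => x _; rewrite lee_fin powR_ge0.
move=> /ltW; rewrite -lee_fin fineK // ge0_fin_numE ?Iq_lty //.
by apply: integral_ge0 => x _; rewrite lee_fin powR_ge0.
Qed.

Variable S : set (X -> R).
Hypothesis SL : forall f, S f -> f \in LL.
Hypothesis Sadd : forall f g, S f -> S g -> S (fun x => f x + g x).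
Hypothesis Sscale : forall c f, S f -> S (fun x => c * f x).

Definition dcl f := f \in LL /\ forall eps : R, 0 < eps ->
  exists2 g, S g & nm (fun x => f x - g x) <= eps.

Lemma dcl_sub f : S f -> dcl f.
Proof.
move=> Sf; split => [|eps e0]; first exact: SL.
exists f => //; rewrite (nm_eq _ _ (fun x => subrr (f x))) nm0 // ltW //.
Qed.

Lemma dcl_add f g : dcl f -> dcl g -> dcl (fun x => f x + g x).
Proof.
move=> [fL Hf] [gL Hg]; split => [|eps e0]; first exact: LL_add.
have e2 : 0 < eps / 2 by rewrite divr_gt0.
have [f' Sf Hf'] := Hf _ e2; have [g' Sg Hg'] := Hg _ e2.
exists (fun x => f' x + g' x); first exact: Sadd.
rewrite (_ : nm _ = nm (fun x => (f x - f' x) + (g x - g' x))); last first.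
  by apply: nm_eq => x; ring.
apply: (le_trans (nm_add q1 (LL_sub q1 fL (SL Sf)) (LL_sub q1 gL (SL Sg)))).
lra.
Qed.

Lemma dcl_scale c f : dcl f -> dcl (fun x => c * f x).
Proof.
move=> [fL Hf]; split => [|eps e0]; first exact: LL_scale.
have c1 : 0 < `|c| + 1 by rewrite ltr_wpDl.
have e2 : 0 < eps / (`|c| + 1) by rewrite divr_gt0.
have [f' Sf Hf'] := Hf _ e2.
exists (fun x => c * f' x); first exact: Sscale.
rewrite (_ : nm _ = nm (fun x => c * (f x - f' x))); last first.
  by apply: nm_eq => x; ring.
rewrite nm_scale //; last by apply: LL_sub => //; exact: SL.
apply: (le_trans (ler_wpM2l (normr_ge0 _) Hf')).
by rewrite mulrCA ler_piMr ?(ltW e0) // ler_pdivrMr // mul1r lerDl.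
Qed.

Lemma dcl_eq f g : (forall x, f x = g x) -> dcl f -> dcl g.
Proof. by move=> /funext ->. Qed.

Lemma dcl_lim f : f \in LL ->
  (forall eps : R, 0 < eps -> exists2 g, dcl g & nm (fun x => f x - g x) <= eps) -> dcl f.
Proof.
move=> fL H; split => // eps e0.
have e2 : 0 < eps / 2 by rewrite divr_gt0.
have [g [gL Hg] fg] := H _ e2; have [h Sh gh] := Hg _ e2.
exists h => //; rewrite (_ : nm _ = nm (fun x => (f x - g x) + (g x - h x))); last first.
  by apply: nm_eq => x; ring.
apply: (le_trans (nm_add q1 (LL_sub q1 fL gL) (LL_sub q1 gL (SL Sh)))).
lra.
Qed.

Lemma dcl_dominated f (f_ : nat -> X -> R) (g : X -> R) : measurable_fun setT f ->
  (forall i, dcl (f_ i)) -> g \in LL -> f \in LL ->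
  (forall i x, `|f x - f_ i x| <= g x) ->
  {ae mu, forall x, f_ i x @[i --> \oo] --> f x} -> dcl f.
Proof.
move=> mf df gL fL fg fc; apply: dcl_lim => // eps e0.
have [||i Hi] := @nm_dominated (fun i x => f x - f_ i x) g eps _ gL fg _ e0.
- by move=> i; apply: measurable_funB => //; apply: LL_measurable; exact: (df i).1.
- apply: filterS fc => x fx; rewrite -(subrr (f x)).
  by apply: cvgB => //; exact: cvg_cst.
by exists (f_ i).
Qed.

Lemma indic_LL A : measurable A -> (\1_A : X -> R) \in LL.
Proof.
move=> mA; apply: (bounded_LL q1 mu1 (B := 1)); first exact: measurable_indic.
by move=> x; rewrite indicE; case: (_ \in _); rewrite ?normr1 ?normr0.
Qed.

Lemma dcl_sum (I : Type) (s : seq I) (F : I -> X -> R) : S (fun=> 0) ->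
  (forall i, dcl (F i)) -> dcl (fun x => \sum_(i <- s) F i x).
Proof.
move=> S0 dF; elim: s => [|i s IH].
  by apply: dcl_eq (dcl_sub S0) => x; rewrite big_nil.
by apply: dcl_eq (dcl_add (dF i) IH) => x; rewrite big_cons.
Qed.

(** The sets whose indicator lies in the closure of [S] form a Dynkin class: complements by
    subtracting from 1, disjoint unions by dominated convergence, since the partial sums of the
    indicators take only the values 0 and 1. *)
Lemma dcl_indic (G : set (set X)) : @measurable _ X = <<s G >> -> setI_closed G ->
  S (fun=> 1) -> (forall A, G A -> dcl (\1_A : X -> R)) ->
  forall A, measurable A -> dcl (\1_A : X -> R).
Proof.
move=> mG GI S1 GS.
have S0 : S (fun=> 0).
  by have := Sscale 0 S1; rewrite mul0r.
move=> A mA.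
apply: (@dynkin_induction _ X G (fun B => dcl (\1_B : X -> R)) mG GI); last by rewrite -mG.
- by apply: dcl_eq (dcl_sub S1) => x; rewrite indicT.
- exact: GS.
- move=> B mB dB; apply: dcl_eq (dcl_add (dcl_sub S1) (dcl_scale (-1) dB)) => x.
  by rewrite mulN1r !indicE in_setC; case: (_ \in _); rewrite ?subrr ?subr0.
move=> F mF tF dF.
have mU : measurable (\bigcup_k F k) by exact: bigcup_measurable.
pose f_ N := fun x => \sum_(0 <= k < N) (\1_(F k) x : R).
have f01 N x : `|(\1_(\bigcup_k F k) x : R) - f_ N x| <= 1 /\
    ((\bigcup_k F k) x -> exists k, forall N, (k < N)%N -> f_ N x = 1) /\
    (~ (\bigcup_k F k) x -> f_ N x = 0).
  have [[k _ Fkx]|nUx] := pselect ((\bigcup_k F k) x); last first.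
    have f0 : f_ N x = 0.
      rewrite /f_ big1 // => k _; rewrite indicE memNset // => Fkx.
      by apply: nUx; exists k.
    by split; [rewrite f0 indicE memNset // subrr normr0|split].
  have one l : (\1_(F l) x : R) = (l == k)%:R.
    rewrite indicE; case: eqVneq => [->|lk]; first by rewrite mem_set.
    rewrite memNset // => Flx; move/eqP: lk; apply.
    by apply: (tF l k) => //; exists x.
  have fE M : f_ M x = (k < M)%N%:R.
    rewrite /f_; under eq_bigr do rewrite one.
    case: ltnP => kM.
      rewrite (bigD1_seq k) ?mem_index_iota ?iota_uniq //= eqxx big1 ?addr0 // => l lk.
      by rewrite (negbTE lk).
    rewrite big_seq big1 // => l; rewrite mem_index_iota /= => lM.
    by rewrite ltn_eqF // (leq_trans lM).
  have Ux : (\bigcup_k F k) x by exists k.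
  split; first by rewrite fE indicE mem_set //; case: (k < N)%N; rewrite ?subrr ?subr0 ?normr0 ?normr1.
  by split => // _; exists k => M kM; rewrite fE kM.
apply: (@dcl_dominated _ f_ (fun=> 1)).
- exact: measurable_indic.
- by move=> N; exact: dcl_sum.
- exact: SL.
- exact: indic_LL.
- by move=> N x; have [] := f01 N x.
- apply: aeW => x; have [Ux|nUx] := pselect ((\bigcup_k F k) x).
    have [_ [/(_ Ux) [k Hk] _]] := f01 0%N x.
    rewrite indicE mem_set //; apply: cvg_near_cst.
    by exists k.+1 => // N /= kN; rewrite Hk.
  rewrite indicE memNset //; apply: cvg_near_cst; apply: nearW => N.
  by have [_ [_ ->]] := f01 N x.
Qed.

Import HBNNSimple.

Lemma dcl_nnsfun (G : set (set X)) : @measurable _ X = <<s G >> -> setI_closed G ->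
  S (fun=> 1) -> (forall A, G A -> dcl (\1_A : X -> R)) ->
  forall h : {nnsfun X >-> R}, dcl h.
Proof.
move=> mG GI S1 GS h.
have S0 : S (fun=> 0).
  by have := Sscale 0 S1; rewrite mul0r.
have [s sE] : exists s : seq R, forall x, \sum_(y <- s) y * \1_(h @^-1` [set y]) x = h x.
  by exists (finmap.enum_fset (fset_set (range h))) => x; rewrite fimfunE fsbig_finite.
apply: (dcl_eq sE).
apply: dcl_sum => // y; apply: dcl_scale; apply: (dcl_indic mG GI S1 GS).
by rewrite -[X in measurable X]setTI; exact: measurable_funP.
Qed.

(** A nonnegative [f] dominates the simple functions increasing to it; a general one is split into
    positive and negative parts. *)
Lemma dcl_LL (G : set (set X)) : @measurable _ X = <<s G >> -> setI_closed G ->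
  S (fun=> 1) -> (forall A, G A -> dcl (\1_A : X -> R)) ->
  forall f, f \in LL -> dcl f.
Proof.
move=> mG GI S1 GS.
have pos f : f \in LL -> (forall x, 0 <= f x) -> dcl f.
  move=> fL f0; have mf := LL_measurable fL.
  have mfE : measurable_fun setT (EFin \o f) by exact/measurable_EFinP.
  have fE0 x : setT x -> (0 <= (EFin \o f) x)%E by rewrite lee_fin.
  pose h := nnsfun_approx measurableT mfE.
  have hc x : h i x @[i --> \oo] --> f x.
    have := @cvg_nnsfun_approx _ _ _ _ measurableT _ mfE fE0 x Logic.I.
    by move=> /fine_cvg.
  have hle i x : h i x <= f x.
    rewrite -(cvg_lim (@norm_hausdorff _ R) (hc x)).
    apply: (nondecreasing_cvgn_le (u_ := fun i => h i x)); last by apply/cvg_ex; exists (f x); exact: hc.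
    by move=> a b ab; have /lefP := nd_nnsfun_approx measurableT mfE ab; exact.
  apply: (@dcl_dominated _ (fun i => h i) f) => //.
  - by move=> i; exact: (dcl_nnsfun mG GI S1 GS).
  - by move=> i x; rewrite ger0_norm ?subr_ge0 // gerBl.
  - by apply: aeW => x.
move=> f fL.
have mf := LL_measurable fL.
have aL : (fun x => `|f x|) \in LL.
  by apply: (LL_dominated _ fL) => [|x]; [exact: measurableT_comp|rewrite normr_id].
have p1 : dcl (fun x => 1 / 2 * (`|f x| + f x)).
  apply: dcl_scale; apply: pos => [|x]; first exact: LL_add.
  by have := ler_norm (- f x); rewrite normrN; lra.
have p2 : dcl (fun x => 1 / 2 * (`|f x| - f x)).
  apply: dcl_scale; apply: pos => [|x]; first exact: LL_sub.
  by have := ler_norm (f x); lra.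
by apply: dcl_eq (dcl_add p1 (dcl_scale (-1) p2)) => x; field.
Qed.

End density.

(** * Bounded approximation of indicators of rays *)

Section good_sides.
Variable R : realType.
Implicit Types (L : seq (R * int * R)) (f : R -> R).

Lemma fejer_uniform f (C e : R) : 0 < C -> 0 < e ->
  (forall t x, `|f t - f x| <= C * `|sin (pi * (x - t))|) ->
  exists L, forall x, `|trig1 L x - f x| <= e.
Proof.
move=> C0 e0 Lip; have cf := continuous_lip_sin C0 Lip.
(* [C (eta + eta) = e], and [N >= eta^-2] makes the second term of the Fejer error at most [eta]. *)
pose eta := e / (2 * C); have eta0 : 0 < eta by rewrite divr_gt0 // mulr_gt0.
pose N := (Num.truncn (eta * eta)^-1).+1.
have [L HL] := @fejer_trig1 _ f N cf; exists L => x; rewrite -HL.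
apply: (le_trans (@fejer_approx _ f C eta N x isT eta0 (ltW C0) cf Lip)).
have N0 : 0 < N%:R :> R by rewrite ltr0n.
have H : (eta * N%:R)^-1 <= eta.
  rewrite -[(eta * _)^-1]div1r ler_pdivrMr; last exact: mulr_gt0.
  rewrite mulrA mulrC -ler_pdivrMr; last exact: mulr_gt0.
  by rewrite div1r; apply: ltW; exact: truncnS_gt.
have E : C * (eta + eta) = e by rewrite /eta; field; rewrite gt_eqF.
by rewrite -[leRHS]E ler_pM2l // lerD2l.
Qed.

(** The uniform bound 2 supplies the dominating function for products over the coordinates.
    Convergence is asked only inside the unit interval, because a periodic limit takes equal values
    at 0 and 1. *)
Definition good (A : set R) := exists L : nat -> seq (R * int * R),
  (forall M x, `|trig1 (L M) x| <= 2) /\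
  (forall x, 0 < x < 1 -> trig1 (L M) x @[M --> \oo] --> (\1_A x : R)).

Lemma good_setT : good setT.
Proof.
exists (fun=> [:: (1, 0, 0)]).
have E x : trig1 [:: (1, 0, 0 : R)] x = 1.
  by rewrite /trig1 big_seq1 /= freq0 mul0r add0r cos0 mul1r.
split => [M x|x _]; first by rewrite E normr1; lra.
by rewrite indicT E; exact: cvg_cst.
Qed.

(** The factor [sin (pi * (t - x))] shows that [sin(pi x) sin(pi (b - x))] is Lipschitz in the sense
    of [fejer_uniform]. *)
Lemma sin_prod_diff (b t x : R) :
  sin (pi * t) * sin (pi * (b - t)) - sin (pi * x) * sin (pi * (b - x)) =
  sin (pi * (t - x)) * sin (pi * (b - t - x)).
Proof.
rewrite !mulrBr; move: (pi * t) (pi * b) (pi * x) => {}t {}b {}x.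
have -> : b - t - x = b - (t + x) by ring.
rewrite !sinB sinD cosD.
have := cos2Dsin2 t; have := cos2Dsin2 x.
move: (cos t) (sin t) (cos x) (sin x) (cos b) (sin b) => ct st cx sx cb sb Hx Ht.
transitivity ((cx ^+ 2 + sx ^+ 2) * (sb * ct * st - cb * st ^+ 2)
  - (ct ^+ 2 + st ^+ 2) * (sb * cx * sx - cb * sx ^+ 2)); last by ring.
by rewrite Hx Ht; ring.
Qed.

Lemma clamp_lip (u v : R) :
  `|Num.min 1 (Num.max 0 u) - Num.min 1 (Num.max 0 v)| <= `|u - v|.
Proof.
have mx (w : R) : (Num.max 0 w = w /\ 0 <= w) \/ (Num.max 0 w = 0 /\ w <= 0).
  by case: (leP 0 w) => H; [left|right]; split => //; exact: ltW.
have mn (w : R) : (Num.min 1 w = w /\ w <= 1) \/ (Num.min 1 w = 1 /\ 1 <= w).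
  by case: (leP 1 w) => H; [right|left]; split => //; exact: ltW.
have n1 := ler_norm (u - v); have n2 := ler_norm (v - u); rewrite distrC in n2.
rewrite ler_norml.
by case: (mx u) => -[-> ?]; case: (mx v) => -[-> ?];
  case: (mn u) => -[? ?]; case: (mn v) => -[? ?]; case: (mn 0) => -[? ?]; lra.
Qed.

(** On the open unit interval [g] is positive to the left of [b] and nonpositive from [b] on.
    Scaling it by [M + 1] and clamping to [[0, 1]] gives Lipschitz periodic functions that tend to
    the indicator; Fejer approximation within [1 / (M + 1)] turns them into polynomials bounded by
    2. *)
Lemma good_ray (a : R) : good `]-oo, a[.
Proof.
(* Within the unit interval the ray up to [a] is the ray up to this clamped endpoint. *)
pose b := Num.max 0 (Num.min a 1).
have b0 : 0 <= b by rewrite le_max lexx.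
have b1 : b <= 1 by rewrite ge_max ge_min lexx orbT ler01.
pose g x := sin (pi * x) * sin (pi * (b - x)).
have gLip t x : `|g t - g x| <= `|sin (pi * (x - t))|.
  rewrite /g sin_prod_diff normrM -[x - t]opprB mulrN sinN normrN.
  by apply: ler_piMr => //; exact: sin_max.
pose h (M : nat) x := Num.min 1 (Num.max 0 (M.+1%:R * g x)).
have hLip M t x : `|h M t - h M x| <= M.+1%:R * `|sin (pi * (x - t))|.
  have H : `|M.+1%:R * g t - M.+1%:R * g x| <= M.+1%:R * `|sin (pi * (x - t))|.
    rewrite -mulrBr normrM ger0_norm //; exact: ler_wpM2l.
  by apply: (le_trans _ H); exact: clamp_lip.
have h01 M x : `|h M x| <= 1.
  by rewrite ger0_norm /h ?ge_min ?lexx // le_min ler01 le_max lexx.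
have M0 (M : nat) : 0 < M.+1%:R :> R by rewrite ltr0n.
have M0' (M : nat) : 0 < M.+1%:R^-1 :> R by rewrite invr_gt0.
have /choice[L HL] (M : nat) := @fejer_uniform (h M) _ _ (M0 M) (M0' M) (hLip M).
exists L; split.
  move=> M x; have := HL M x; have := h01 M x.
  have : (M.+1%:R^-1 : R) <= 1 by rewrite invf_le1 // ler1n.
  rewrite -[X in _ -> _ -> _ -> `|X| <= _](subrK (h M x)) => H0 H1 H2.
  by apply: (le_trans (ler_normD _ _)); move: H0 H1 H2; move: (_^-1) (`|_|) (`|_|) => ? ? ?; lra.
move=> x /andP[x0 x1].
have sx0 : 0 < sin (pi * x).
  by apply: sin_gt0_pi; rewrite ?mulr_gt0 ?pi_gt0 //= gtr_pMr ?pi_gt0.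
have hE : \forall M \near \oo, h M x = \1_`]-oo, a[ x.
  have [xa|ax] := ltP x a.
    have xb : x < b by rewrite lt_max lt_min xa x1 orbT.
    have g0 : 0 < g x.
      apply: (mulr_gt0 sx0); apply: sin_gt0_pi; apply/andP; split.
        by apply: mulr_gt0; [exact: pi_gt0|rewrite subr_gt0].
      by rewrite gtr_pMr ?pi_gt0 //; lra.
    exists (Num.truncn (g x)^-1) => // M /= NM.
    rewrite indicE mem_set /= ?in_itv //= /h.
    have H : 1 <= M.+1%:R * g x.
      rewrite -ler_pdivrMr // div1r; apply: (le_trans (ltW (truncnS_gt _))).
      by rewrite ler_nat.
    by apply/min_idPl; rewrite le_max H orbT.
  have bx : b <= x by rewrite ge_max (ltW x0) ge_min ax.
  have g0 : g x <= 0.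
    rewrite pmulr_rle0 // -oppr_ge0 -sinN -mulrN opprB; apply: sin_ge0_pi; apply/andP; split.
      by apply: mulr_ge0; [exact: pi_ge0|rewrite subr_ge0].
    by rewrite ler_piMr ?pi_ge0 //; lra.
  apply: nearW => M; rewrite indicE memNset /= ?in_itv /= ?ltNge ?ax // /h.
  have -> : Num.max 0 (M.+1%:R * g x) = 0 by apply/max_idPl; rewrite pmulr_rle0.
  by apply/min_idPr; exact: ler01.
apply/cvgrPdist_le => e e0.
have : \forall M \near \oo, (e^-1 : R) <= M.+1%:R.
  exists (Num.truncn e^-1) => // M /= NM.
  by apply: (le_trans (ltW (truncnS_gt _))); rewrite ler_nat.
move: hE; apply: filterS2 => M <- eM.
rewrite distrC; apply: (le_trans (HL M x)); rewrite -[e]invrK.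
by rewrite lef_pV2 ?posrE ?invr_gt0 ?ltr0n.
Qed.

End good_sides.

(** * Boxes and density of polynomials on the cube *)

Section boxes.
Variables (R : realType) (n : nat).
Implicit Types (T U : seq (R * n.-tuple int * R)) (k l : n.-tuple int) (x : Rn R n).

Definition taddz k l : n.-tuple int := [tuple tnth k i + tnth l i | i < n].
Definition tsubz k l : n.-tuple int := [tuple tnth k i - tnth l i | i < n].

Lemma dotZ_add k l x : dotZ (taddz k l) x = dotZ k x + dotZ l x.
Proof.
rewrite /dotZ -big_split /=; apply: eq_bigr => i _.
by rewrite tnth_mktuple intrD mulrDl.
Qed.

Lemma dotZ_sub k l x : dotZ (tsubz k l) x = dotZ k x - dotZ l x.
Proof.
rewrite /dotZ -sumrB /=; apply: eq_bigr => i _.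
by rewrite tnth_mktuple intrB mulrBl.
Qed.

Lemma trign_cat T U x : trign (T ++ U) x = trign T x + trign U x.
Proof. by rewrite /trign big_cat. Qed.

Definition trign_scale (c : R) T := [seq (c * t.1.1, t.1.2, t.2) | t <- T].

Lemma trign_scaleE c T x : trign (trign_scale c T) x = c * trign T x.
Proof.
rewrite /trign big_map mulr_sumr; apply: eq_bigr => t _ /=.
by rewrite mulrA.
Qed.

Definition trign_prod T U :=
  [seq (t.1.1 * u.1.1 / 2, taddz t.1.2 u.1.2, t.2 + u.2) | t <- T, u <- U] ++
  [seq (t.1.1 * u.1.1 / 2, tsubz t.1.2 u.1.2, t.2 - u.2) | t <- T, u <- U].

Lemma trign_prodE T U x : trign (trign_prod T U) x = trign T x * trign U x.
Proof.
rewrite trign_cat /trign !big_allpairs_dep -big_split mulr_suml /=; apply: eq_bigr => t _.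
rewrite -big_split mulr_sumr /=; apply: eq_bigr => u _.
rewrite dotZ_add dotZ_sub (mulrDr (2 * pi)) (mulrBr (2 * pi)).
move: (2 * pi * dotZ t.1.2 x) (2 * pi * dotZ u.1.2 x) => a b.
have -> : a + b + (t.2 + u.2) = (a + t.2) + (b + u.2) by ring.
have -> : a - b + (t.2 - u.2) = (a + t.2) - (b + u.2) by ring.
rewrite cosD cosB; move: (cos _) (sin _) (cos _) (sin _) => c s c' s'.
by field.
Qed.

Definition axis (i : 'I_n) (L : seq (R * int * R)) : seq (R * n.-tuple int * R) :=
  [seq (t.1.1, [tuple if j == i then t.1.2 else 0 | j < n], t.2) | t <- L].

Lemma axisE i L x : trign (axis i L) x = trig1 L (tnth x i).
Proof.
rewrite /trign /trig1 big_map; apply: eq_bigr => t _ /=.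
have -> : dotZ [tuple if j == i then t.1.2 else 0 | j < n] x = t.1.2%:~R * tnth x i.
  rewrite /dotZ (bigD1 i) //= tnth_mktuple eqxx big1 ?addr0 // => j /negbTE ji.
  by rewrite tnth_mktuple ji mul0r.
by rewrite /freq -!mulrA.
Qed.

Lemma axis_prod (s : seq 'I_n) (L : 'I_n -> seq (R * int * R)) :
  exists T, forall x, trign T x = \prod_(i <- s) trig1 (L i) (tnth x i).
Proof.
elim: s => [|i s [T HT]].
  exists [:: (1, tzero n, 0)] => x; rewrite /trign big_seq1 big_nil /=.
  have -> : dotZ (tzero n) x = 0 by rewrite /dotZ big1 // => j _; rewrite tnth_mktuple mul0r.
  by rewrite mulr0 add0r cos0 mul1r.
exists (trign_prod (axis i (L i)) T) => x.
by rewrite big_cons trign_prodE axisE HT.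
Qed.

Definition box (A : 'I_n -> set (measurableTypeR R)) : set (Rn R n) :=
  [set x | forall i, A i (tnth x i)].

Lemma indic_box A x : \1_(box A) x = \prod_(i < n) \1_(A i) (tnth x i) :> R.
Proof.
have [Ax|nAx] := pselect (box A x).
  rewrite indicE mem_set // big1 // => i _; rewrite indicE mem_set //; exact: Ax.
rewrite indicE memNset //; apply/esym/eqP/prodf_eq0.
have [i nA] : exists i, ~ A i (tnth x i) by apply/existsNP.
by exists i => //; rewrite indicE memNset.
Qed.

Lemma cvg_prod_seq (s : seq 'I_n) (u : 'I_n -> nat -> R) (l : 'I_n -> R) :
  (forall i, u i M @[M --> \oo] --> l i) ->
  \prod_(i <- s) u i M @[M --> \oo] --> \prod_(i <- s) l i.
Proof.
move=> ul; elim: s => [|i s IH].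
  by rewrite big_nil; under eq_fun do rewrite big_nil; exact: cvg_cst.
by rewrite big_cons; under eq_fun do rewrite big_cons; apply: cvgM.
Qed.

Lemma box_approx A : (forall i, good (A i)) -> exists T : nat -> seq _,
  (forall M x, `|trign (T M) x| <= 2 ^+ n) /\
  (forall x, open_cube x -> trign (T M) x @[M --> \oo] --> (\1_(box A) x : R)).
Proof.
move=> /choice[L HL].
have /choice[T HT] (M : nat) := axis_prod (index_enum 'I_n) (fun i => L i M).
exists T; split => [M x|x ox].
  rewrite HT normr_prod -[X in 2 ^+ X]card_ord -prodr_const.
  by apply: ler_prod => i _; rewrite normr_ge0 /=; have [H _] := HL i; exact: H.
rewrite indic_box; under eq_fun do rewrite HT.
apply: cvg_prod_seq => i; have [_ H] := HL i; apply: H.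
by have := ox i; rewrite in_itv.
Qed.

Lemma ae_cube (P : Rn R n -> Prop) : (forall x, open_cube x -> P x) ->
  {ae cube_measure R n, forall x, P x}.
Proof.
have mo := @measurable_open_cube R n.
move=> H; exists (~` @open_cube R n); split; first exact: measurableC mo.
  by rewrite /cube_measure /= /mrestr setICl; exact: (measure0 (lebesgue_Rn R n)).
by move=> x /= nP ox; apply: nP; exact: H.
Qed.

Definition boxes : set (set (Rn R n)) :=
  [set C | exists2 A : 'I_n -> set R,
    forall i, A i = setT \/ exists a, A i = `]-oo, a[%classic & C = box A].

Lemma boxesI : setI_closed boxes.
Proof.
move=> _ _ [A HA ->] [B HB ->]; exists (fun i => A i `&` B i).
  move=> i; case: (HA i) => [->|[a ->]]; case: (HB i) => [->|[b ->]];
    rewrite ?setTI ?setIT; [by left|by right; exists b|by right; exists a|].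
  right; exists (Num.min a b); apply/seteqP; split => x /=; rewrite !in_itv /= lt_min.
    by move=> [-> ->].
  by move=> /andP[].
apply/seteqP; split => x /=; first by move=> [Ax Bx] i; split; [exact: Ax|exact: Bx].
by move=> H; split => i; have [] := H i.
Qed.

(** The product sigma-algebra is generated by the coordinate maps and the Borel sets of the line by
    the open left rays, so the preimages of rays under one coordinate suffice. *)
Lemma measurable_boxesE : @measurable _ (Rn R n) = <<s boxes >>.
Proof.
apply/seteqP; split; last first.
  apply: smallest_sub; first exact: sigma_algebra_measurable.
  move=> _ [A HA ->]; apply: measurable_box => i.
  by case: (HA i) => [->|[a ->]] //; exact: measurable_itv.
apply: smallest_sub; first exact: smallest_sigma_algebra.
move=> C; rewrite /= -bigcup_seq => -[i _ [B mB <-]]; rewrite setTI.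
pose Q := image_set_system setT (fun x : Rn R n => tnth x i) <<s boxes >>.
suff : (@measurable _ (measurableTypeR R)) `<=` Q.
  by move=> /(_ _ mB); rewrite /Q /image_set_system /= setTI.
have -> : (@measurable _ (measurableTypeR R)) = <<s (@RGenInftyO.G R) >>.
  exact: RGenInftyO.measurableE.
apply: smallest_sub.
  by apply: sigma_algebra_image; exact: smallest_sigma_algebra.
move=> _ [a ->]; rewrite /Q /image_set_system /= setTI.
apply: sub_sigma_algebra; exists (fun j => if j == i then `]-oo, a[%classic else setT).
  by move=> j; case: eqVneq => _; [right; exists a|left].
apply/seteqP; split => x /=.
  by move=> H j; case: eqVneq => [->|].
by move=> /(_ i); rewrite eqxx.
Qed.

Lemma trign_bounded T x : `|trign T x| <= \sum_(t <- T) `|t.1.1|.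
Proof.
apply: (le_trans (ler_norm_sum _ _ _)); apply: ler_sum => t _.
by rewrite normrM ler_piMr //; exact: cos_max.
Qed.

Variable q : R.
Hypothesis q1 : 1 < q.

Lemma trign_LL T : trign T \in Lfun (cube_measure R n) q%:E.
Proof.
apply: (bounded_LL q1 (cube_measureT R n) (B := \sum_(t <- T) `|t.1.1|)).
  exact: measurable_trign.
exact: trign_bounded.
Qed.

Lemma trign_dense f (eps : R) : f \in Lfun (cube_measure R n) q%:E -> 0 < eps ->
  exists T, nm (cube_measure R n) q (fun x => f x - trign T x) <= eps.
Proof.
move=> fL e0.
pose S : set (Rn R n -> R) := [set g | exists T, g = trign T].
have SL g : S g -> g \in Lfun (cube_measure R n) q%:E by move=> [T ->]; exact: trign_LL.
have Sadd g h : S g -> S h -> S (fun x => g x + h x).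
  by move=> [T ->] [U ->]; exists (T ++ U); apply/funext => x; rewrite trign_cat.
have Sscale c g : S g -> S (fun x => c * g x).
  by move=> [T ->]; exists (trign_scale c T); apply/funext => x; rewrite trign_scaleE.
have S1 : S (fun=> 1).
  have [T HT] := axis_prod [::] (fun=> [::]); exists T; apply/funext => x.
  by rewrite HT big_nil.
have SG A : boxes A -> dcl (cube_measure R n) q S (\1_A : Rn R n -> R).
  move=> [B HB ->] {A}; move: B HB => A HA.
  have gA i : good (A i).
    by case: (HA i) => [->|[a ->]]; [exact: good_setT|exact: good_ray].
  have [T [T1 T2]] := box_approx gA.
  have mA : measurable (box A).
    apply: measurable_box => i.
    by case: (HA i) => [->|[a ->]] //; exact: measurable_itv.
  (* The dominating constant adds the bound [2 ^+ n] of the polynomials to the bound 1 of the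
     indicator. *)
  apply: (dcl_dominated q1 SL (f_ := fun M => trign (T M)) (g := fun=> 2 ^+ n + 1)).
  - exact: measurable_indic.
  - move=> M; by apply: (dcl_sub q1 SL); exists (T M).
  - exact: (bounded_LL q1 (cube_measureT R n) (B := `|2 ^+ n + 1|)).
  - exact: (indic_LL q1 (cube_measureT R n)).
  - move=> M x; apply: (le_trans (ler_normB _ _)); rewrite addrC lerD //.
    by rewrite indicE; case: (_ \in _); rewrite ?normr1 ?normr0.
  - exact: ae_cube.
have [_ /(_ _ e0)[_ [T ->] H]] := dcl_LL q1 (cube_measureT R n) SL Sadd Sscale
  measurable_boxesE boxesI S1 SG fL.
by exists T.
Qed.

End boxes.

(** * The trigonometric system *)

Section lex.
Variable n : nat.
Implicit Types k l : n.-tuple int.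

Lemma head_filter_opp (s : seq int) :
  head 0 [seq j <- map -%R s | j != 0] = - head 0 [seq j <- s | j != 0].
Proof. by elim: s => //= a s IH; rewrite oppr_eq0; case: eqP. Qed.

Lemma lex_pos_tzero : lex_pos (tzero n) = false.
Proof.
rewrite /lex_pos (_ : [seq _ <- _ | _] = [::]) //; apply/eqP; rewrite -(negbK (_ == _)) -has_filter.
by apply/hasPn => j /mapP[i _ ->]; rewrite negbK.
Qed.

Lemma lex_pos_opp k l : (forall i, tnth l i = - tnth k i) -> lex_pos l = (head 0 [seq j <- k | j != 0] < 0).
Proof.
move=> kl; rewrite /lex_pos.
have -> : tval l = map -%R k.
  apply: (@eq_from_nth _ 0) => [|i]; rewrite ?size_map !size_tuple // => il.
  have H := kl (Ordinal il).
  by rewrite (nth_map 0) ?size_tuple // -!(tnth_nth 0 _ (Ordinal il)).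
by rewrite head_filter_opp oppr_gt0.
Qed.

(** Two positive indices never cancel, so sum frequencies contribute nothing to the integrals in
    [coef_int]. *)
Lemma lex_pos_add k l : lex_pos k -> lex_pos l -> taddz k l == tzero n = false.
Proof.
move=> kp lp; apply/eqP => E; move: lp; rewrite (@lex_pos_opp k); last first.
  move=> i; apply/eqP; rewrite -addr_eq0 addrC.
  by have := congr1 (fun t => tnth t i) E; rewrite !tnth_mktuple => ->.
by move=> h; move: kp; rewrite /lex_pos ltNge (ltW h).
Qed.

Lemma tsub_eq0 k l : (tsubz k l == tzero n) = (k == l).
Proof.
apply/eqP/eqP => [E|->]; apply: eq_from_tnth => i; last by rewrite !tnth_mktuple subrr.
apply/eqP; rewrite -subr_eq0.
by have := congr1 (fun t => tnth t i) E; rewrite !tnth_mktuple => ->.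
Qed.

Lemma tadd0z k : taddz (tzero n) k = k.
Proof. by apply: eq_from_tnth => i; rewrite !tnth_mktuple add0r. Qed.

Lemma lex_trichotomy k : [\/ k = tzero n, lex_pos k | lex_pos (tsubz (tzero n) k)].
Proof.
have : lex_pos (tsubz (tzero n) k) = (head 0 [seq j <- k | j != 0] < 0).
  by apply: lex_pos_opp => i; rewrite !tnth_mktuple sub0r.
rewrite /lex_pos => E; have [h|h|h] := ltrgtP (head 0 [seq j <- k | j != 0]) 0.
- by apply: Or33; rewrite E.
- by apply: Or32.
apply: Or31; apply: eq_from_tnth => i; rewrite tnth_mktuple; apply/eqP/negPn/negP => ki.
have : has (fun j => j != 0) k by apply/hasP; exists (tnth k i) => //; exact: mem_tnth.
rewrite has_filter; have : all (fun j => j != 0) [seq j <- k | j != 0] by exact: filter_all.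
by move: h; case: [seq j <- k | j != 0] => //= a s ->.
Qed.

End lex.

(** * Trigonometric sums over positive indices and their coefficients *)

Section trig_system.
Variables (R : realType) (n : nat).
Implicit Types (c e : coefs R n) (m M N : n.-tuple nat) (k : posZ n) (x : Rn R n)
  (T : seq (R * n.-tuple int * R)).

(** The phase 0 here, and the sine written as a cosine of phase [- (pi / 2)], make both functions
    literal waves of [trign]. *)
Definition cosk k x : R := cos (2 * pi * dotZ (val k) x + 0).
Definition sink k x : R := cos (2 * pi * dotZ (val k) x + - (pi / 2)).

Definition trl c M : seq (R * n.-tuple int * R) :=
  (c.1.1, tzero n, 0) ::
  flatten [seq [:: (c.1.2 k, val k, 0); (c.2 k, val k, - (pi / 2))] | k <- erect M].

Lemma big_trl c M (P : pred (n.-tuple int)) (G : R * n.-tuple int * R -> R) :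
  \sum_(t <- trl c M | P t.1.2) G t =
  (if P (tzero n) then G (c.1.1, tzero n, 0) else 0) +
  \sum_(k <- erect M) if P (val k) then
     G (c.1.2 k, val k, 0) + G (c.2 k, val k, - (pi / 2)) else 0.
Proof.
rewrite /trl big_cons big_flatten big_map /=.
have -> : \sum_(k <- erect M) \sum_(t <- [:: (c.1.2 k, val k, 0); (c.2 k, val k, - (pi / 2))] |
    P t.1.2) G t = \sum_(k <- erect M) if P (val k) then
     G (c.1.2 k, val k, 0) + G (c.2 k, val k, - (pi / 2)) else 0.
  apply: eq_bigr => k _; rewrite !big_cons big_nil /=.
  by case: (P (val k)); rewrite ?addr0.
by case: (P (tzero n)); rewrite ?add0r.
Qed.

Lemma dotZ_tzero x : dotZ (tzero n) x = 0.
Proof. by rewrite /dotZ big1 // => j _; rewrite tnth_mktuple mul0r. Qed.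

Lemma trign_trl c M x : trign (trl c M) x = rs cosk sink c M x.
Proof.
rewrite /trign (big_trl c M xpredT) rsE /=; congr (_ + _).
by rewrite dotZ_tzero mulr0 add0r cos0 mulr1.
Qed.

Lemma rect_forall m k : (k \in rect m) = [forall i, (absz (tnth (val k) i) <= tnth m i)%N].
Proof.
by apply/idP/forallP => [|h]; [rewrite inE|rewrite inE].
Qed.

Lemma trign_psumn c m M x : tle m M -> trign (psumn m (trl c M)) x = rs cosk sink c m x.
Proof.
move=> mM; rewrite /trign /psumn big_filter.
rewrite (big_trl c M (fun k : n.-tuple int => [forall i, (absz (tnth k i) <= tnth m i)%N])) rsE /=.
have -> : [forall i, (absz (tnth (tzero n) i) <= tnth m i)%N].
  by apply/forallP => i; rewrite tnth_mktuple.
rewrite dotZ_tzero mulr0 add0r cos0 mulr1; congr (_ + _).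
rewrite -(erect_cond (fun k => c.1.2 k * cosk k x + c.2 k * sink k x) mM).
by apply: eq_bigr => k _; rewrite rect_forall.
Qed.

(** Cutting first keeps the coefficients of each sum from reaching into the larger joint
    rectangle. *)
Lemma rs_join (u v : posZ n -> Rn R n -> R) c e M N x :
  rs u v (cadd (cut c M) (cut e N)) (tmax M N) x = rs u v c M x + rs u v e N x.
Proof. by rewrite rs_add !rs_cut //; [exact: tle_maxr|exact: tle_maxl]. Qed.

Lemma trig_term (A d : R) k : exists c M, forall x,
  A * cos (2 * pi * dotZ (val k) x + d) = rs cosk sink c M x.
Proof.
exists (0, fun k' => if k' == k then A * cos d else 0,
           fun k' => if k' == k then - (A * sin d) else 0).
pose M := [tuple absz (tnth (val k) i) | i < n]; exists M => x.
have kM : k \in erect M by rewrite mem_erect rect_forall; apply/forallP => i; rewrite tnth_mktuple.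
rewrite rsE /= add0r (bigD1_seq k) ?erect_uniq //= eqxx big1 => [|l /negbTE ->]; last first.
  by rewrite !mul0r addr0.
rewrite addr0 /cosk /sink addr0 cosD -[X in _ = _ + _ * cos X]opprB cosN cosB cos_pihalf sin_pihalf.
by move: (cos _) (sin _) (cos _) (sin _) => ? ? ? ?; ring.
Qed.

(** A wave of frequency [k] is split into cosine and sine; if [- k] is the positive index, evenness
    of the cosine reverses frequency and phase first. *)
Lemma trign_rs T : exists c M, forall x, trign T x = rs cosk sink c M x.
Proof.
elim: T => [|[[A k] d] T [c [M HT]]].
  exists (0, fun=> 0, fun=> 0), [tuple 0%N | _ < n] => x.
  by rewrite rsE /trign big_nil /= add0r big1 // => k _; rewrite !mul0r addr0.
suff [e [N HN]] : exists e N, forall x, A * cos (2 * pi * dotZ k x + d) = rs cosk sink e N x.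
  exists (cadd (cut e N) (cut c M)), (tmax N M) => x.
  by rewrite rs_join -HT -HN /trign big_cons.
have [->|kp|kn] := lex_trichotomy k.
- exists (A * cos d, fun=> 0, fun=> 0), [tuple 0%N | _ < n] => x.
  rewrite rsE /= big1 ?addr0 => [|l _]; last by rewrite !mul0r addr0.
  by rewrite dotZ_tzero mulr0 add0r.
- exact: (trig_term A d (exist (@lex_pos n) k kp)).
- have [e [N H]] := trig_term A (- d) (exist (@lex_pos n) _ kn); exists e, N => x.
  rewrite -H /= dotZ_sub dotZ_tzero sub0r mulrN -opprD cosN; reflexivity.
Qed.

Variable q : R.
Hypothesis q1 : 1 < q.

Local Notation mu := (cube_measure R n).
Local Notation LL := (Lfun mu q%:E).
Local Notation nm := (nm mu q).
Let mu1 := cube_measureT R n.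

Lemma trl_LL c M : rs cosk sink c M \in LL.
Proof.
have -> : rs cosk sink c M = trign (trl c M) by apply/funext => x; rewrite trign_trl.
exact: trign_LL.
Qed.

Lemma trig_proj : exists2 K, 0 <= K &
  forall c m M, tle m M -> nm (rs cosk sink c m) <= K * nm (rs cosk sink c M).
Proof.
have [K K0 HK] := psumn_bound (R := R) n q1.
exists (K `^ q^-1) => [|c m M mM]; first exact: powR_ge0.
rewrite -(nm_eq mu q (fun x => trign_psumn c x mM)) -(nm_eq mu q (trign_trl c M)).
by apply: (nm_le_of_int q1 K0) => //; exact: trign_LL.
Qed.

Lemma trig_dense f (eps : R) : f \in LL -> 0 < eps ->
  exists c M, nm (fun x => f x - rs cosk sink c M x) <= eps.
Proof.
move=> fL e0; have [T HT] := trign_dense q1 fL e0.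
have [c [M HM]] := trign_rs T; exists c, M; rewrite -(nm_eq mu q (f := fun x => f x - trign T x)) //.
by move=> x; rewrite HM.
Qed.

Lemma trign_integrable T : mu.-integrable setT (EFin \o trign T).
Proof.
apply: (bounded_integrable mu1 (B := \sum_(t <- T) `|t.1.1|)).
  exact: measurable_trign.
exact: trign_bounded.
Qed.

Lemma int_cos (l : n.-tuple int) (d : R) :
  \int[mu]_x cos (2 * pi * dotZ l x + d) = if l == tzero n then cos d else 0.
Proof.
have mc : measurable_fun setT (fun x : Rn R n => cos (2 * pi * dotZ l x + d)).
  have := measurable_trign [:: (1, l, d)]; apply: eq_measurable_fun => x _.
  by rewrite /trign big_seq1 mul1r.
have ic : mu.-integrable setT (EFin \o (fun x : Rn R n => cos (2 * pi * dotZ l x + d))).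
  by apply: (bounded_integrable mu1 (B := 1)) => // x; exact: cos_max.
have i1 : mu.-integrable setT (EFin \o (fun _ : Rn R n => 1 : R)).
  by apply: (bounded_integrable mu1 (B := 1)) => // x; rewrite normr1.
have := congr1 fine (integral_1cos l d).
rewrite -[fine (integral _ _ _)]/(\int[mu]_x (1 + cos (2 * pi * dotZ l x + d))).
rewrite RintegralD // /= => E; apply: (addrI 1); rewrite -E; congr (_ + _).
by rewrite /Rintegral integral_cst //= mu1 mule1.
Qed.

Lemma int_trign T : \int[mu]_x trign T x =
  \sum_(t <- T) t.1.1 * (if t.1.2 == tzero n then cos t.2 else 0).
Proof.
elim: T => [|t T IH].
  rewrite big_nil /Rintegral integral0_eq // => x _; by rewrite /trign big_nil.
rewrite big_cons -IH -int_cos.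
have ic : mu.-integrable setT (EFin \o (fun x => cos (2 * pi * dotZ t.1.2 x + t.2))).
  have := trign_integrable [:: (1, t.1.2, t.2)]; apply: eq_integrable => // x _ /=.
  by rewrite /trign big_seq1 mul1r.
have -> : trign (t :: T) = fun x => t.1.1 * cos (2 * pi * dotZ t.1.2 x + t.2) + trign T x.
  by apply/funext => x; rewrite /trign big_cons.
rewrite RintegralD //; last exact: trign_integrable.
  by rewrite RintegralZl.
exact: (integrableZl _ _ ic).
Qed.

(** In the product-to-sum expansion only the zero difference frequency survives integration. [d = 0]
    isolates the cosine coefficient and [d = - (pi / 2)] the sine coefficient, each halved, whence
    the 2 in [trig_coef]. *)
Lemma coef_int c M k (d : R) : k \in rect M ->
  \int[mu]_x (trign (trl c M) x * cos (2 * pi * dotZ (val k) x + d)) =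
  1 / 2 * (c.1.2 k * cos d + c.2 k * cos (pi / 2 + d)).
Proof.
move=> kM.
transitivity (\int[mu]_x trign (trign_prod (trl c M) [:: (1, val k, d)]) x).
  apply: eq_Rintegral => x _; rewrite trign_prodE; congr (_ * _).
  by rewrite /trign big_seq1 mul1r.
rewrite int_trign /trign_prod big_cat !big_allpairs_dep /=.
under eq_bigr do rewrite big_seq1 /=.
under [X in _ + X]eq_bigr do rewrite big_seq1 /=.
rewrite (big_trl c M xpredT (fun t => t.1.1 * 1 / 2 *
  (if taddz t.1.2 (val k) == tzero n then cos (t.2 + d) else 0))).
rewrite (big_trl c M xpredT (fun t => t.1.1 * 1 / 2 *
  (if tsubz t.1.2 (val k) == tzero n then cos (t.2 - d) else 0))) /=.
have kp := valP k.
have k0 : (val k == tzero n) = false.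
  by apply/eqP => E; move: kp; rewrite E lex_pos_tzero.
rewrite tadd0z (tsub_eq0 (tzero n)) (eq_sym (tzero n)) k0 !mulr0 big1 => [|l _]; last by rewrite (lex_pos_add (valP l) kp) !mulr0 addr0.
rewrite !add0r (bigD1_seq k) ?erect_uniq ?mem_erect //= big1 => [|l lk]; last first.
  by rewrite tsub_eq0 val_eqE (negbTE lk) !mulr0 addr0.
rewrite tsub_eq0 eqxx cosN -opprD cosN.
by move: (cos _) (cos _) => ? ?; field.
Qed.

Lemma trig_coef0 c M : `|c.1.1| <= nm (rs cosk sink c M).
Proof.
rewrite -(nm_eq mu q (trign_trl c M)).
have H : \int[mu]_x (trign (trl c M) x * 1) = c.1.1.
  under eq_Rintegral do rewrite mulr1.
  rewrite int_trign (big_trl c M xpredT (fun t => t.1.1 * (if t.1.2 == tzero n then cos t.2 else 0))).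
  rewrite /= eqxx cos0 mulr1 big1 ?addr0 // => k _.
  have -> : (val k == tzero n) = false.
    by apply/eqP => E; have := valP k; rewrite E lex_pos_tzero.
  by rewrite !mulr0 addr0.
rewrite -{1}H; apply: (int_mul_le q1 mu1) => //; first exact: trign_LL.
  by move=> x; rewrite normr1.
have := trign_integrable (trl c M); apply: eq_integrable => // x _ /=.
by rewrite mulr1.
Qed.

Lemma trig_coef_int_le c M k d : `|\int[mu]_x (trign (trl c M) x * cos (2 * pi * dotZ (val k) x + d))|
  <= nm (rs cosk sink c M).
Proof.
rewrite -(nm_eq mu q (trign_trl c M)).
apply: (int_mul_le q1 mu1 (g := fun x => cos (2 * pi * dotZ (val k) x + d))).
- exact: trign_LL.
- have := measurable_trign [:: (1, val k, d)]; apply: eq_measurable_fun => x _.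
  by rewrite /trign big_seq1 mul1r.
- by move=> x; exact: cos_max.
have := trign_integrable (trign_prod (trl c M) [:: (1, val k, d)]); apply: eq_integrable => // x _.
by rewrite /= trign_prodE; congr (_ * _)%:E; rewrite /trign big_seq1 mul1r.
Qed.

Lemma trig_coef c M k : k \in rect M ->
  `|c.1.2 k| <= 2 * nm (rs cosk sink c M) /\ `|c.2 k| <= 2 * nm (rs cosk sink c M).
Proof.
move=> kM; have := trig_coef_int_le c M k 0; have := trig_coef_int_le c M k (- (pi / 2)).
rewrite !coef_int // cosN subrr addr0 cos0 cos_pihalf !mulr0 !mulr1 addr0 add0r.
rewrite !(normrM (1 / 2)) (ger0_norm (x := 1 / 2)); last by lra.
by move: (`|_|) (`|_|) (nm _) => a b N ? ?; split; lra.
Qed.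

End trig_system.

(** * The triangular system *)

Section triangular_system.
Variables (R : realType) (n : nat) (q : R).
Hypothesis q1 : 1 < q.
Implicit Types (c e : coefs R n) (m M N : n.-tuple nat) (k : posZ n) (x : Rn R n).

Local Notation mu := (cube_measure R n).
Local Notation LL := (Lfun mu q%:E).
Local Notation nm := (nm mu q).
Local Notation trig := (rs (@cosk R n) (@sink R n)).
Local Notation tri :=
  (rs (fun k x => Num.sqrt 3 * Ck k x) (fun k x => Num.sqrt 3 * Sk k x)).
Let mu1 := cube_measureT R n.

Lemma Ctri_bounded (y : R) : `|Ctri y| <= 1.
Proof.
rewrite CtriE; have h := distZ_half y; have [j E] := distZ_attained y.
have h0 : 0 <= distZ y by rewrite E.
by rewrite ler_norml; apply/andP; split; lra.
Qed.

Lemma measurable_Ctri_dotZ (l : n.-tuple int) (d : R) :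
  measurable_fun setT (fun x : Rn R n => Ctri (dotZ l x - d)).
Proof.
apply: (@measurableT_comp _ _ _ _ _ _ (@Ctri R)).
  by apply: continuous_measurable_fun; exact: continuous_Ctri.
by apply: measurable_funB; [exact: measurable_dotZ|exact: measurable_cst].
Qed.

Lemma Ck_LL k : (fun x => Num.sqrt 3 * Ck k x) \in LL.
Proof.
apply: (LL_scale q1); apply: (bounded_LL q1 mu1 (B := 1)); last by move=> x; exact: Ctri_bounded.
by have := measurable_Ctri_dotZ (val k) 0; apply: eq_measurable_fun => x _; rewrite subr0.
Qed.

Lemma Sk_LL k : (fun x => Num.sqrt 3 * Sk k x) \in LL.
Proof.
apply: (LL_scale q1); apply: (bounded_LL q1 mu1 (B := 1)).
  by have := measurable_Ctri_dotZ (val k) (1 / 4); apply: eq_measurable_fun => x _; rewrite -StriE.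
by move=> x; rewrite /Sk StriE; exact: Ctri_bounded.
Qed.

Let tri_LL c M : tri c M \in LL. Proof. exact: rs_LL q1 mu1 Ck_LL Sk_LL _ _. Qed.
Let trig_LL c M : trig c M \in LL. Proof. exact: trl_LL. Qed.

(** [T] maps a cosine to [Ck / gam], which is [1 / gs] times the normalised function
    [sqrt 3 * Ck]. *)
Definition gs : R := gam R * Num.sqrt 3.

Lemma gs_neq0 : gs != 0.
Proof. by rewrite mulf_neq0 // gt_eqF ?gam_gt0 ?sqrtr_gt0. Qed.

Lemma gam_neq0 : gam R != 0. Proof. by rewrite gt_eqF ?gam_gt0. Qed.

(* If f is the trigonometric sum with coefficients c then T f, with T as in the
   header, is the triangular sum with coefficients [to_tri c]. *)
Definition to_tri c : coefs R n :=
  (c.1.1 / gam R, fun k => c.1.2 k / gs, fun k => c.2 k / gs).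

Definition of_tri c : coefs R n :=
  (c.1.1 * gam R, fun k => c.1.2 k * gs, fun k => c.2 k * gs).

Lemma of_triK c : to_tri (of_tri c) = c.
Proof.
case: c => [[a0 a] b]; rewrite /to_tri /of_tri /=; congr (_, _, _).
- by rewrite mulfK // gam_neq0.
- by apply/funext => k; rewrite mulfK // gs_neq0.
- by apply/funext => k; rewrite mulfK // gs_neq0.
Qed.

Lemma tri_to_triE c M x : tri (to_tri c) M x = c.1.1 * (gam R)^-1 +
  \sum_(k <- erect M) (c.1.2 k * ((gam R)^-1 * Ctri (dotZ (val k) x)) +
                       c.2 k * ((gam R)^-1 * Stri (dotZ (val k) x))).
Proof.
rewrite rsE /=; congr (_ + _); apply: eq_bigr => k _.
rewrite /Ck /Sk /gs; move: (Ctri _) (Stri _) => C S.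
have := gam_neq0; move: (gam R) => g g0.
have : Num.sqrt 3 != 0 :> R by rewrite gt_eqF ?sqrtr_gt0.
by move: (Num.sqrt 3) => s s0; field; apply/andP.
Qed.

Lemma dotZ_tscale (j : int) (l : n.-tuple int) x : dotZ (tscale j l) x = j%:~R * dotZ l x.
Proof.
rewrite /dotZ mulr_sumr; apply: eq_bigr => i _.
by rewrite tnth_mktuple intrM mulrA.
Qed.

Lemma trign_dilnE (j : int) (T : seq (R * n.-tuple int * R)) x : trign (diln j T) x =
  \sum_(t <- T) t.1.1 * cos (freq R j * dotZ t.1.2 x + t.2).
Proof.
rewrite /trign /diln big_map; apply: eq_bigr => t _ /=.
by rewrite dotZ_tscale /freq mulrA.
Qed.

Lemma trign_dil1 (T : seq (R * n.-tuple int * R)) x : trign (diln 1 T) x = trign T x.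
Proof.
rewrite trign_dilnE; apply: eq_bigr => t _.
by rewrite /freq mulr1.
Qed.

Definition csize c M : R := `|c.1.1| + \sum_(k <- erect M) (`|c.1.2 k| + `|c.2 k|).

Lemma csize_ge0 c M : 0 <= csize c M.
Proof. by rewrite addr_ge0 // sumr_ge0 // => k _; rewrite addr_ge0. Qed.

(** The sum over [i] is the partial sum of [T] applied to the polynomial. The pointwise series at
    [k . x] give a uniform error; its factor [csize] depends on the coefficients, which is harmless
    since [I] tends to infinity while [c] and [M] stay fixed. *)
Lemma tri_partial c M x I :
  `|tri (to_tri c) M x -
    \sum_(0 <= i < I.+1) weight R i * trign (diln (jidx i) (trl c M)) x| <=
  csize c M * (1 / 4 * I.+1%:R^-1).
Proof.
have -> : \sum_(0 <= i < I.+1) weight R i * trign (diln (jidx i) (trl c M)) x =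
  c.1.1 * (\sum_(0 <= i < I.+1) weight R i) + \sum_(k <- erect M)
    (c.1.2 k * osum (dotZ (val k) x) I.+1 +
     c.2 k * \sum_(0 <= i < I.+1) weight R i * cos (freq R (jidx i) * dotZ (val k) x - pi / 2)).
  transitivity (\sum_(0 <= i < I.+1) (c.1.1 * weight R i + \sum_(k <- erect M)
    (c.1.2 k * (weight R i * cos (freq R (jidx i) * dotZ (val k) x)) +
     c.2 k * (weight R i * cos (freq R (jidx i) * dotZ (val k) x - pi / 2))))).
    apply: eq_bigr => i _; rewrite trign_dilnE.
    rewrite (big_trl c M xpredT (fun t => t.1.1 * cos (freq R (jidx i) * dotZ t.1.2 x + t.2))) /=.
    rewrite dotZ_tzero mulr0 add0r cos0 mulr1 mulrDr [weight R i * c.1.1]mulrC mulr_sumr.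
    congr (_ + _); apply: eq_bigr => k _; rewrite (addr0 (freq _ _ * _)).
    by move: (weight _ _) (cos _) (cos _) => ? ? ?; ring.
  rewrite big_split /= mulr_sumr exchange_big /=; congr (_ + _); apply: eq_bigr => k _.
  by rewrite big_split /= -!mulr_sumr.
rewrite tri_to_triE opprD addrACA -mulrBr -sumrB /csize [leRHS]mulrDl.
apply: (le_trans (ler_normD _ _)); apply: lerD.
  by rewrite normrM; apply: ler_wpM2l => //; exact: weight_series.
apply: (le_trans (ler_norm_sum _ _ _)); rewrite mulr_suml; apply: ler_sum => k _.
rewrite opprD addrACA -!mulrBr [leRHS]mulrDl; apply: (le_trans (ler_normD _ _)).
rewrite !(normrM (_ k)); apply: lerD; apply: ler_wpM2l => //.
  exact: tri_cos_series.
exact: tri_sin_series.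
Qed.

Lemma nm_diln (j : int) (T : seq (R * n.-tuple int * R)) : j != 0 ->
  nm (trign (diln j T)) <= nm (trign T).
Proof.
move=> j0; have q0 : 0 < q by exact: lt_trans q1.
have := nm_le_of_int q1 ler01 (trign_LL q1 (diln j T)) (trign_LL q1 T).
by rewrite powR1 mul1r mul1e; apply; rewrite (Lp_diln T q0 j0).
Qed.

(** The term [i = 0] is the polynomial itself. In the remainder [W] each dilate has norm at most
    that of the polynomial and the weights sum to at most 1/4; the uniform error vanishes as [I]
    grows. *)
Lemma tri_close c M : nm (fun x => tri (to_tri c) M x - trig c M x) <= 1 / 4 * nm (trig c M).
Proof.
have W_ge0 I : 0 <= \sum_(1 <= i < I.+1) weight R i by apply: sumr_ge0 => i _; exact: weight_ge0.
pose W x I := \sum_(1 <= i < I.+1) weight R i * trign (diln (jidx i) (trl c M)) x.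
have WL I : (fun x => W x I) \in LL.
  by apply: (LL_sum q1) => i; apply: (LL_scale q1); exact: trign_LL.
have DL I : (fun x => tri (to_tri c) M x - (trig c M x + W x I)) \in LL.
  by apply: (LL_sub q1) => //; exact: (LL_add q1).
have D I x : `|tri (to_tri c) M x - (trig c M x + W x I)| <= csize c M * (1 / 4 * I.+1%:R^-1).
  have := tri_partial c M x I; rewrite big_ltn // weight0 mul1r jidx0 trign_dil1 trign_trl.
  by [].
have bnd I : nm (fun x => tri (to_tri c) M x - trig c M x) <=
    csize c M * (1 / 4 * I.+1%:R^-1) + 1 / 4 * nm (trig c M).
  rewrite (nm_eq mu q (g := fun x => (tri (to_tri c) M x - (trig c M x + W x I)) + W x I)); last first.
    by move=> x; ring.
  apply: (le_trans (nm_add q1 (DL I) (WL I))); apply: lerD.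
    apply: (nm_le_bound q1 mu1); last exact: D.
      exact: (LL_measurable (DL I)).
    by rewrite mulr_ge0 ?csize_ge0 // mulr_ge0 // invr_ge0.
  have step : nm (fun x => W x I) <= \sum_(1 <= i < I.+1) weight R i * nm (trig c M).
    apply: (le_trans (nm_sum q1 _ _)).
      by move=> i; apply: (LL_scale q1); exact: trign_LL.
    apply: ler_sum => i _; rewrite nm_scale //; last exact: trign_LL.
    rewrite ger0_norm ?weight_ge0 //; apply: ler_wpM2l; first exact: weight_ge0.
    by rewrite -(nm_eq mu q (trign_trl c M)); apply: nm_diln; exact: jidx_neq0.
  apply: (le_trans step); rewrite -mulr_suml; apply: ler_wpM2r; first exact: nm_ge0.
  have := @weight_tail R 0 I isT; have : 0 <= I.+1%:R^-1 :> R by rewrite invr_ge0.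
  by rewrite invr1; move: (_^-1) (\sum_(_ <= _ < _) _) => a b; lra.
apply/ler_addgt0Pr => eps e0.
have [j Hj] := harmonic_small (csize_ge0 c M) e0.
apply: (le_trans (bnd j)); rewrite addrC lerD2l; apply: (le_trans _ (Hj j (leqnn _))).
apply: ler_wpM2l; first exact: csize_ge0.
have : 0 <= j.+1%:R^-1 :> R by rewrite invr_ge0.
by move: (_^-1) => a; lra.
Qed.

(** The triangle inequality with [tri_close]: [4 / 3] is [1 / (1 - 1 / 4)], and [5 / 4] in the next
    lemma is [1 + 1 / 4]. *)
Lemma nm_trig_le c M : nm (trig c M) <= 4 / 3 * nm (tri (to_tri c) M).
Proof.
have := tri_close c M.
have := nm_sub q1 (tri_LL (to_tri c) M) (LL_sub q1 (tri_LL (to_tri c) M) (trig_LL c M)).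
rewrite (nm_eq mu q (g := trig c M)); last by move=> x; ring.
by move: (nm _) (nm _) (nm _) => a b d; lra.
Qed.

Lemma nm_tri_le c M : nm (tri (to_tri c) M) <= 5 / 4 * nm (trig c M).
Proof.
have := tri_close c M.
have := nm_add q1 (LL_sub q1 (tri_LL (to_tri c) M) (trig_LL c M)) (trig_LL c M).
rewrite (nm_eq mu q (f := fun x => _ - _ + _) (g := tri (to_tri c) M)); last by move=> x; ring.
by move: (nm _) (nm _) (nm _) => a b d; lra.
Qed.

(** [to_tri] rescales each coefficient separately and so commutes with truncation; the trigonometric
    projection bound is carried over by the two norm comparisons. *)
Lemma tri_proj : exists2 K, 0 <= K &
  forall c m M, tle m M -> nm (tri c m) <= K * nm (tri c M).
Proof.
have [K K0 HK] := @trig_proj R n q q1.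
exists (5 / 4 * (K * (4 / 3))) => [|c m M mM].
  by lra.
rewrite -(of_triK c); apply: (le_trans (nm_tri_le _ _)).
have h2 := HK (of_tri c) _ _ mM; have h3 := ler_wpM2l K0 (nm_trig_le (of_tri c) M).
by move: h2 h3; move: (nm _) (nm _) (nm _) => a b d h2 h3; lra.
Qed.

Lemma tri_coef0 : exists2 C, 0 <= C & forall c M, `|c.1.1| <= C * nm (tri c M).
Proof.
have g0 : 0 <= (gam R)^-1 by rewrite invr_ge0 ltW // gam_gt0.
exists ((gam R)^-1 * (4 / 3)) => [|c M]; first by lra.
have H := le_trans (trig_coef0 q1 (of_tri c) M) (nm_trig_le (of_tri c) M).
rewrite of_triK /= in H.
rewrite -mulrA -[leLHS](mulKf gam_neq0); apply: ler_wpM2l => //.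
by rewrite -[X in X * _](ger0_norm (ltW (gam_gt0 R))) -normrM mulrC.
Qed.

Lemma tri_coef k : exists2 C, 0 <= C & forall c M, k \in rect M ->
  `|c.1.2 k| <= C * nm (tri c M) /\ `|c.2 k| <= C * nm (tri c M).
Proof.
have s0 : 0 < `|gs| by rewrite normr_gt0 gs_neq0.
exists (`|gs|^-1 * (2 * (4 / 3))) => [|c M kM].
  by apply: mulr_ge0; [rewrite invr_ge0|lra].
have [Ha Hb] := trig_coef q1 (of_tri c) kM.
have H := nm_trig_le (of_tri c) M; rewrite of_triK in H.
have aux (y : R) : `|y * gs| <= 2 * nm (trig (of_tri c) M) ->
    `|y| <= `|gs|^-1 * (2 * (4 / 3)) * nm (tri c M).
  rewrite normrM => Hy; rewrite -mulrA ler_pdivlMl // mulrC.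
  apply: (le_trans Hy); rewrite -mulrA; exact: ler_wpM2l.
by split; apply: aux.
Qed.

(** Take a polynomial [g] within [d / 2] of [f]; then [f - T g = (f - g) - (T g - g)], and the
    second difference has norm at most a quarter of that of [g]. *)
Lemma tri_contract f (d : R) : f \in LL -> 0 < d ->
  exists c M, nm (fun x => f x - tri c M x) <= 1 / 4 * nm f + d.
Proof.
move=> fL d0; have d2 : 0 < d / 2 by rewrite divr_gt0.
have [c [M H]] := trig_dense q1 fL d2; exists (to_tri c), M.
have L1 := LL_sub q1 fL (trig_LL c M).
have L2 := LL_sub q1 (tri_LL (to_tri c) M) (trig_LL c M).
have := nm_sub q1 L1 L2; have := tri_close c M; have := nm_sub q1 fL L1.
rewrite (nm_eq mu q (f := fun x => f x - (f x - _)) (g := trig c M)); last by move=> x; ring.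
rewrite (nm_eq mu q (f := fun x => _ - _ - (_ - _)) (g := fun x => f x - tri (to_tri c) M x)); last first.
  by move=> x; ring.
by move: H; move: (nm _) (nm _) (nm _) (nm _) (nm _) => a b c' e g; lra.
Qed.

Lemma tri_dense f (eps : R) : f \in LL -> 0 < eps ->
  exists c M, nm (fun x => f x - tri c M x) < eps.
Proof.
move=> fL e0; have e4 : 0 < eps / 8 by rewrite divr_gt0.
(* Each contraction divides the residual by 4, but the weaker rate [1 / (j + 1)] suffices. The
   additive errors stay below [eps / 4], since a quarter of it plus the new [eps / 8] is less than
   [eps / 4]. *)
have iter j : exists c M, nm (fun x => f x - tri c M x) <= nm f * j.+1%:R^-1 + eps / 4.
  elim: j => [|j [c [M H]]].
    exists (0, fun=> 0, fun=> 0), [tuple 0%N | _ < n].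
    rewrite (nm_eq mu q (g := f)) ?invr1 ?mulr1 ?lerDl ?divr_ge0 ?ltW // => x.
    by rewrite rsE /= add0r big1 ?subr0 // => k _; rewrite !mul0r addr0.
  have [e [N HN]] := tri_contract (LL_sub q1 fL (tri_LL c M)) e4.
  exists (cadd (cut c M) (cut e N)), (tmax M N).
  rewrite (nm_eq mu q (g := fun x => f x - tri c M x - tri e N x)); last first.
    by move=> x; rewrite rs_join; ring.
  apply: (le_trans HN).
  have h : 1 / 4 * j.+1%:R^-1 <= j.+2%:R^-1 :> R.
    by rewrite mul1r -invfM lef_pV2 ?posrE ?mulr_gt0 ?ltr0n // -natrM ler_nat; lia.
  have := ler_wpM2l (nm_ge0 mu q f) h.
  move: H; rewrite [nm f * (1 / 4 * _)]mulrCA.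
  by move: (nm f * _) (nm f * _) (nm _) => a b d; lra.
have e2 : 0 < eps / 2 by rewrite divr_gt0.
have [j Hj] := harmonic_small (nm_ge0 mu q f) e2; have [c [M H]] := iter j.
exists c, M; apply: (le_lt_trans H); have := Hj j (leqnn _).
by move: (nm f * _) => a; lra.
Qed.

Lemma Lnorm_cvg0 (f : Rn R n -> R) c : f \in LL ->
  ('N[mu]_q%:E[EFin \o (f \- tri c m)%R]%E @[m --> @pringsheim n] --> 0%E) <->
  (nm (fun x => f x - tri c m x) @[m --> @pringsheim n] --> 0).
Proof.
move=> fL.
have E : (fun m => 'N[mu]_q%:E[EFin \o (f \- tri c m)%R]%E) =
         (fun m => (nm (fun x => f x - tri c m x))%:E).
  by apply/funext => m; apply: (LnormE q1); exact: (LL_sub q1).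
rewrite E; split => [/fine_cvg //|H].
by apply: cvg_EFin; [exact: nearW|exact: H].
Qed.

End triangular_system.

Theorem theorem3p9 (R : realType) (n : nat) (q : R) (hn : (1 <= n)%N)
    (hq : 1 < q) :
  @pringsheim_schauder_basis R n q
    (fun k x => Num.sqrt 3 * Ck k x)
    (fun k x => Num.sqrt 3 * Sk k x).
Proof.
have CL := @Ck_LL R n q hq; have SL := @Sk_LL R n q hq.
split => // f fL.
have mu1 := cube_measureT R n.
have [K K0 HK] := @tri_proj R n q hq.
have [c Hc] := criterion_exists hq mu1 CL SL K0 HK (@tri_coef0 R n q hq) (@tri_coef R n q hq)
  (@tri_dense R n q hq) fL.
exists c; split => [|e He].
  by apply/(Lnorm_cvg0 hq c fL).
move/(Lnorm_cvg0 hq e fL) : He => He.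
exact: (criterion_unique hq mu1 CL SL (@tri_coef0 R n q hq) (@tri_coef R n q hq) fL Hc He).
Qed.
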